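(* Let $k\geq 1$, $\alpha\geq 1$ and $m\geq 1$ be integers with $\gcd(m,2)=1$. Then the set $\{n\in\mathbb{N}: \bar a_{2^\alpha m}(n)\equiv 0 \pmod{2^k}\}$ has arithmetic density $1$, i.e. $$\lim_{X\to\infty}\frac{\#\{0\leq n\leq X: \bar a_{2^\alpha m}(n)\equiv 0\pmod{2^k}\}}{X}=1.$$
   Context: For an integer $k\geq 1$ let $f_k:=\prod_{n\geq 1}(1-q^{kn})$. For an integer $c\geq1$, the generalized overcubic partition function $\bar a_c(n)$ is defined by the generating function $\sum_{n\geq 0}\bar a_c(n)q^n=\dfrac{f_4^{c-1}}{f_1^2f_2^{2c-3}}$. *)

(* Defs.v *)
From HB Require Import structures.
From mathcomp Require Import all_boot all_order all_algebra.
From mathcomp Require Import all_classical all_reals all_analysis.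
Set Implicit Arguments. Unset Strict Implicit. Unset Printing Implicit Defensive.
Import Order.TTheory GRing.Theory Num.Theory.
Local Open Scope ring_scope.

(* Truncation of f_k = prod_{j>=1} (1 - q^{k j}) modulo q^{N+1}:
   factors with k*j > N are congruent to 1 mod q^{N+1}, so keeping
   j = 1..N gives a polynomial agreeing with f_k up to degree N
   (for k >= 1). *)
Definition f_trunc (k N : nat) : {poly int} :=
  \prod_(1 <= j < N.+1) (1 - 'X^(k * j)).

(* Truncation of 1/f_k = prod_{j>=1} sum_{i>=0} q^{k j i} mod q^{N+1}
   (agrees with 1/f_k up to degree N, for k >= 1). *)
Definition finv_trunc (k N : nat) : {poly int} :=
  \prod_(1 <= j < N.+1) \sum_(0 <= i < N.+1) 'X^(k * j * i).

Definition fpow_trunc (k : nat) (e : int) (N : nat) : {poly int} :=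
  match e with
  | Posz n => (f_trunc k N) ^+ n
  | Negz n => (finv_trunc k N) ^+ n.+1
  end.

(* Generalized overcubic partition function:
   sum_n abar c n q^n = f_4^{c-1} / (f_1^2 f_2^{2c-3})
                      = f_4^{c-1} * f_1^{-2} * f_2^{-(2c-3)}.
   The coefficient of q^n only depends on the factors modulo q^{n+1}. *)
Definition abar (c n : nat) : int :=
  (fpow_trunc 4 (c%:Z - 1) n * fpow_trunc 1 (-2) n
     * fpow_trunc 2 (- (2 * c%:Z - 3)) n)`_n.

Definition count_div (c k X : nat) : nat :=
  count (fun n => ((2 ^ k)%:Z %| abar c n)%Z) (iota 0 X.+1).

(* Main.v *)
(** Write phi(q) = sum_n q^(n^2).  By Gauss, the generating function is
    1 / (phi(-q) phi(-q^2)^(c-1)) with c even.  A power series f is called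
    lacunary here if for every K there is r such that 2^K divides f_n as soon
    as r primes p, odd and not 1 mod 8, divide n exactly once; since the
    reciprocals of these primes have a divergent sum, a lacunary series has
    almost all coefficients divisible by 2^K.

    Modulo 2 one has E4 = 1 and Delta = sum of q^((2n+1)^2), so that the powers
    of Delta live on exponents in one class modulo 8 and the Hecke operators
    T_p with p not 1 mod 8 strictly lower the degree in Delta: products of many
    T_p kill E4^i Delta^j modulo 2, and iterating, modulo 2^K.  Hence
    Z[E4, Delta] consists of lacunary series, and so does its 2-adic closure
    under division by 2.  With a = phi(q)^2, P = phi(-q)^2, w = q psi(q)^8 one
    has E4 = 16 a^4 - 16 a^2 P^2 + P^4 and Delta = w P^8; solving for w, P, a,
    phi(-q^2) by 2-adic contractions shows that the generating function lies
    in that closure.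

    The stability of span E4^(3(m-j)) Delta^j under T_p is classical: the theta
    inversion formula (proved with Riemann sums of Gaussians, whose shifts and
    rotations are compared by telescoping) makes E4 and Delta modular of level
    one, T_p preserves modularity, and a form of weight 12m vanishing to order
    m+1 is zero, by the Cauchy bound applied to its quotient by Delta^m. *)
Require Import Defs.
From HB Require Import structures.
From mathcomp Require Import all_boot all_order all_algebra.
From mathcomp Require Import all_classical all_reals all_analysis.
From mathcomp Require Import complex.
From mathcomp Require Import zify ring lra.
Set Implicit Arguments. Unset Strict Implicit. Unset Printing Implicit Defensive.
Import Order.TTheory GRing.Theory Num.Theory.
Import numFieldNormedType.Exports.
Local Open Scope ring_scope.

(** * Power series with integer coefficients *)

(** The generating function has negative weight and higher level, so it is never placed in a space
    of modular forms; it is reached from level one by 2-adic approximation only. The delicate point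
    is extracting square roots. For a series 1 + 4x the square is 1 + 8(x + 2x^2), and x = z - 2x^2
    is a contraction. For 1 + 2u the square is 1 + 4(u + u^2), which is no contraction in u: the
    class of u modulo 2 has to be known beforehand. This is why phi(q) is not treated alone. For
    phi(q) phi(-q^2) the missing class is supplied by f(q)^2 = f(q^2) modulo 2. Since 1/phi(-q) =
    phi(q)/phi(-q^2)^2, an even c leaves exactly this product times an even power of 1/phi(-q^2).

    Primes that are 1 modulo 8 are left out because T_p then preserves classes of exponents modulo
    8, and nothing forces the leading power of Delta to disappear.

    On the analytic side no integral is evaluated: Riemann sums of Gaussians are only compared with
    one another, and the value 1 of the limit comes from the self-dual point. Cauchy's estimate is
    likewise an average over roots of unity. *)

Record fps := Fps { cf :> nat -> int }.

Lemma fpsP (f g : fps) : (forall n, f n = g n) -> f = g.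
Proof. by case: f g => [f] [g] /= /funext ->. Qed.

HB.instance Definition _ := gen_eqMixin fps.
HB.instance Definition _ := gen_choiceMixin fps.

Definition fps_add (f g : fps) := Fps (fun n => f n + g n).
Definition fps_opp (f : fps) := Fps (fun n => - f n).
Definition fps_mul (f g : fps) := Fps (fun n => \sum_(i < n.+1) f i * g (n - i)%N).
Definition fps_one := Fps (fun n => (n == 0%N)%:R).

Definition ftrunc (f : fps) (N : nat) : {poly int} := \poly_(i < N) f i.

Lemma ftruncM (f g : fps) (n N : nat) : (n < N)%N ->
  (ftrunc f N * ftrunc g N)`_n = fps_mul f g n.
Proof.
move=> nN; rewrite coefM /=; apply: eq_bigr => i _.
have iN : (i < N)%N by have := ltn_ord i; lia.
by rewrite !coef_poly iN (leq_ltn_trans (leq_subr _ _) nN).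
Qed.

Fact fps_addA : associative fps_add.
Proof. by move=> f g h; apply: fpsP => n /=; rewrite addrA. Qed.
Fact fps_addC : commutative fps_add.
Proof. by move=> f g; apply: fpsP => n /=; rewrite addrC. Qed.
Fact fps_add0 : left_id (Fps (fun=> 0)) fps_add.
Proof. by move=> f; apply: fpsP => n /=; rewrite add0r. Qed.
Fact fps_addN : left_inverse (Fps (fun=> 0)) fps_opp fps_add.
Proof. by move=> f; apply: fpsP => n /=; rewrite addNr. Qed.

HB.instance Definition _ := GRing.isZmodule.Build fps
  fps_addA fps_addC fps_add0 fps_addN.

Fact fps_mulC : commutative fps_mul.
Proof.
move=> f g; apply: fpsP => n.
by rewrite -!(@ftruncM _ _ n n.+1) // mulrC.
Qed.

Lemma ftrunc_mul f g N n : (n < N)%N ->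
  (ftrunc (fps_mul f g) N)`_n = (ftrunc f N * ftrunc g N)`_n.
Proof. by move=> nN; rewrite coef_poly nN ftruncM. Qed.

Fact fps_mulA : associative fps_mul.
Proof.
move=> f g h; apply: fpsP => n.
rewrite -!(@ftruncM _ _ n n.+1) //.
transitivity ((ftrunc f n.+1 * (ftrunc g n.+1 * ftrunc h n.+1))`_n).
  rewrite !coefM; apply: eq_bigr => i _; congr (_ * _).
  by rewrite ftrunc_mul //; lia.
rewrite mulrA !coefM; apply: eq_bigr => i _; congr (_ * _).
by rewrite ftrunc_mul //; have := ltn_ord i; lia.
Qed.

Fact fps_mul1 : left_id fps_one fps_mul.
Proof.
move=> f; apply: fpsP => n /=.
rewrite big_ord_recl /= mul1r subn0 big1 ?addr0 // => i _.
by rewrite mul0r.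
Qed.

Fact fps_mulDl : left_distributive fps_mul fps_add.
Proof.
move=> f g h; apply: fpsP => n /=; rewrite -big_split /=.
by apply: eq_bigr => i _; rewrite mulrDl.
Qed.

Fact fps_oner_neq0 : fps_one != Fps (fun=> 0).
Proof. by apply/eqP => /(congr1 (fun f : fps => f 0%N)). Qed.

HB.instance Definition _ := GRing.Zmodule_isComNzRing.Build fps
  fps_mulA fps_mulC fps_mul1 fps_mulDl fps_oner_neq0.

Lemma cfD (f g : fps) n : (f + g) n = f n + g n. Proof. by []. Qed.
Lemma cfN (f : fps) n : (- f) n = - f n. Proof. by []. Qed.
Lemma cfB (f g : fps) n : (f - g) n = f n - g n. Proof. by []. Qed.
Lemma cf0 n : (0 : fps) n = 0. Proof. by []. Qed.
Lemma cf1 n : (1 : fps) n = (n == 0%N)%:R. Proof. by []. Qed.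
Lemma cfM (f g : fps) n : (f * g) n = \sum_(i < n.+1) f i * g (n - i)%N.
Proof. by []. Qed.
Lemma cfMn (f : fps) k n : (f *+ k) n = f n *+ k.
Proof. by elim: k => [|k IH]; rewrite ?mulr0n // !mulrS cfD IH. Qed.
Lemma cf_sum I (r : seq I) (P : pred I) (F : I -> fps) n :
  (\sum_(i <- r | P i) F i) n = \sum_(i <- r | P i) F i n.
Proof. by elim/big_rec2: _ => // i x y _ <-. Qed.
Lemma cfMz (f : fps) (c : int) n : (c%:~R * f) n = c * f n.
Proof.
rewrite mulrzl; case: c => k; first by rewrite -pmulrn cfMn -mulr_natl natz.
by rewrite NegzE -nmulrn cfN cfMn mulNr -mulr_natl natz.
Qed.
Lemma cfMz_nat (f : fps) (k n : nat) : (k%:R * f) n = k%:R * f n.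
Proof. by rewrite mulr_natl cfMn mulr_natl. Qed.

Definition fpoly (p : {poly int}) : fps := Fps (fun n => p`_n).
Fact fpoly_is_zmod_morphism : zmod_morphism fpoly.
Proof. by move=> p q; apply: fpsP => n /=; rewrite coefB. Qed.
Fact fpoly_is_monoid_morphism : monoid_morphism fpoly.
Proof.
split=> [|p q]; apply: fpsP => n /=; first by rewrite coef1.
by rewrite coefM.
Qed.
HB.instance Definition _ := GRing.isZmodMorphism.Build _ _ fpoly fpoly_is_zmod_morphism.
HB.instance Definition _ := GRing.isMonoidMorphism.Build _ _ fpoly fpoly_is_monoid_morphism.

Definition X : fps := fpoly 'X.
Lemma cfX n : X n = (n == 1%N)%:R. Proof. by rewrite /X /= coefX. Qed.
Lemma cfXn k n : (X ^+ k) n = (n == k)%:R.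
Proof. by rewrite /X -rmorphXn /= coefXn. Qed.
Lemma cfXM (f : fps) k n : (X ^+ k * f) n = if (n < k)%N then 0 else f (n - k)%N.
Proof.
rewrite cfM; case: ltnP => nk.
  by rewrite big1 // => i _; rewrite cfXn; case: eqP => [ik|]; rewrite ?mul0r //; have := ltn_ord i; lia.
have kn : (k < n.+1)%N by [].
rewrite (bigD1 (Ordinal kn)) //= cfXn eqxx mul1r big1 ?addr0 // => i /negPf ik.
by rewrite cfXn -[nat_of_ord i == k]/(i == Ordinal kn) ik mul0r.
Qed.

(** The substitution of q^k for q. *)
Definition fdil (k : nat) (f : fps) : fps :=
  Fps (fun n => if (k %| n)%N then f (n %/ k)%N else 0).

Lemma sum_multiples (V : nmodType) (k : nat) (F : nat -> V) (m : nat) : (0 < k)%N ->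
  \sum_(0 <= i < m.+1) F (k * i)%N = \sum_(0 <= i < (k * m).+1 | (k %| i)%N) F i.
Proof.
move=> k0; elim: m => [|m IH].
  by rewrite muln0 [RHS]big_mkcond !big_nat1 muln0 dvdn0.
rewrite big_nat_recr //= IH.
rewrite [RHS](big_cat_nat (n := (k * m).+1)) //=; last by nia.
congr (_ + _); have -> : (k * m.+1 = k * m + k)%N by lia.
rewrite big_mkcond big_nat_recr /=; last by lia.
rewrite dvdn_addr ?dvdn_mulr // dvdnn big1_seq ?add0r // => i.
rewrite mem_index_iota => /andP[i1 i2]; case: ifP => // /dvdnP[j ij].
move: i1 i2; rewrite ij addnC -mulnS (mulnC j) !ltn_mul2l k0 /=; lia.
Qed.

Lemma cf_fdil k (f : fps) n : fdil k f n = if (k %| n)%N then f (n %/ k)%N else 0.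
Proof. by []. Qed.
Section Dilation.
Variable k : nat.
Hypothesis k0 : (0 < k)%N.
Lemma cf_fdil_mul (f : fps) n : fdil k f (k * n)%N = f n.
Proof. by rewrite /= dvdn_mulr // mulKn. Qed.
Lemma cf_fdil0 (f : fps) n : ~~ (k %| n)%N -> fdil k f n = 0.
Proof. by move=> /negPf /= ->. Qed.

Lemma fdil_mul (f g : fps) : fdil k (f * g) = fdil k f * fdil k g.
Proof.
apply: fpsP => n; rewrite cfM.
case: (boolP (k %| n)%N) => [/dvdnP[m ->]|kn].
  rewrite mulnC cf_fdil_mul cfM.
  rewrite (eq_bigr (fun i : 'I_m.+1 => fdil k f (k * i)%N * fdil k g (k * m - k * i)%N)); last first.
    by move=> i _; rewrite -mulnBr !cf_fdil_mul.
  pose F i := fdil k f i * fdil k g (k * m - i)%N.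
  rewrite -(big_mkord predT (fun i => F (k * i)%N)) -(big_mkord predT F).
  rewrite [RHS](bigID (fun i => k %| i)%N) /= [X in _ = _ + X]big1 ?addr0; last first.
    by move=> i ki; rewrite /F cf_fdil0 // mul0r.
  exact: sum_multiples.
rewrite cf_fdil0 // big1 // => i _.
case: (boolP (k %| i)%N) => ki; last by rewrite cf_fdil0 // mul0r.
rewrite [fdil k g _]cf_fdil0 ?mulr0 //; apply: contra kn => h.
have -> : n = (i + (n - i))%N by have := ltn_ord i; lia.
by rewrite dvdn_add.
Qed.

Fact fdil_is_monoid_morphism : monoid_morphism (fdil k).
Proof.
split=> [|f g]; last exact: fdil_mul.
apply: fpsP => n /=; case: ifP => [/dvdnP[m ->]|h].
  by rewrite mulnK // muln_eq0 (gtn_eqF k0) orbF.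
by case: eqP h => [->|//]; rewrite dvdn0.
Qed.
End Dilation.

Lemma fdilD k (f g : fps) : fdil k (f + g) = fdil k f + fdil k g.
Proof. by apply: fpsP => n /=; case: ifP; rewrite ?addr0. Qed.
Lemma fdilN k (f : fps) : fdil k (- f) = - fdil k f.
Proof. by apply: fpsP => n /=; case: ifP; rewrite ?oppr0. Qed.
Lemma fdil1 k : (0 < k)%N -> fdil k 1 = 1.
Proof. by move=> k0; have [] := fdil_is_monoid_morphism k0. Qed.
Lemma fdilX k (f : fps) m : (0 < k)%N -> fdil k (f ^+ m) = fdil k f ^+ m.
Proof.
move=> k0; elim: m => [|m IH]; rewrite ?expr0 ?fdil1 //.
by rewrite !exprS fdil_mul // IH.
Qed.
Lemma fdilMn k (f : fps) m : fdil k (m%:R * f) = m%:R * fdil k f.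
Proof.
by apply: fpsP => n; rewrite cfMz_nat !cf_fdil; case: ifP; rewrite ?cfMz_nat ?mulr0.
Qed.
Lemma fdil_dil j k (f : fps) : (0 < j)%N -> (0 < k)%N -> fdil j (fdil k f) = fdil (j * k) f.
Proof.
move=> j0 k0; apply: fpsP => n /=.
have [/dvdnP[m ->]|jn] := boolP (j %| n)%N.
  by rewrite mulnK // (mulnC m) dvdn_pmul2l // divnMl.
by case: ifP => // h; case/negP: jn; apply: dvdn_trans h; rewrite dvdn_mulr.
Qed.
Lemma fdil_X k m : (0 < k)%N -> fdil k (X ^+ m) = X ^+ (k * m).
Proof.
move=> k0; apply: fpsP => n; rewrite cfXn /= cfXn.
have [/dvdnP[l ->]|kn] := boolP (k %| n)%N.
  by rewrite mulnK // mulnC eqn_pmul2l.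
by case: eqP => // nk; case/negP: kn; rewrite nk dvdn_mulr.
Qed.

(** The substitution of -q for q. *)
Definition fsgn (f : fps) : fps := Fps (fun n => (-1) ^+ n * f n).
Lemma cf_fsgn (f : fps) n : fsgn f n = (-1) ^+ n * f n. Proof. by []. Qed.
Lemma fsgnD (f g : fps) : fsgn (f + g) = fsgn f + fsgn g.
Proof. by apply: fpsP => n /=; rewrite mulrDr. Qed.
Lemma fsgnM (f g : fps) : fsgn (f * g) = fsgn f * fsgn g.
Proof.
apply: fpsP => n; rewrite /fsgn /= mulr_sumr; apply: eq_bigr => i _.
rewrite mulrACA -exprD subnKC //; by have := ltn_ord i.
Qed.
Lemma fsgnMn k (f : fps) : fsgn (k%:R * f) = k%:R * fsgn f.
Proof. by apply: fpsP => n; rewrite cfMz_nat !cf_fsgn cfMz_nat mulrCA. Qed.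
Lemma fsgn1 : fsgn 1 = 1.
Proof. by apply: fpsP => -[|n] /=; rewrite ?mul1r // mulr0. Qed.
Lemma fsgnX (f : fps) m : fsgn (f ^+ m) = fsgn f ^+ m.
Proof. by elim: m => [|m IH]; rewrite ?fsgn1 // !exprS fsgnM IH. Qed.
Lemma fsgn_X : fsgn X = - X.
Proof. by apply: fpsP => -[|[|n]] /=; rewrite coefX /= ?mulr1 ?mulr0 ?oppr0. Qed.
Lemma fsgn_dil k (f : fps) : (0 < k)%N -> fsgn (fdil k.*2 f) = fdil k.*2 f.
Proof.
move=> k0; apply: fpsP => n /=; case: ifP; rewrite ?mulr0 // => /dvdnP[m ->].
by rewrite -signr_odd oddM odd_double andbF mul1r.
Qed.

(** * Theta series *)

Definition irange (M : nat) : seq int := [seq i%:Z - M%:Z | i <- iota 0 (M.*2.+1)].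
Lemma mem_irange M x : (x \in irange M) = (`|x| <= M)%N.
Proof.
apply/mapP/idP => [[j]|xM].
  by rewrite mem_iota => /andP[_ i2] ->; lia.
exists (absz (x + M%:Z)); last by lia.
by rewrite mem_iota; lia.
Qed.
Lemma uniq_irange M : uniq (irange M).
Proof. by rewrite map_inj_uniq ?iota_uniq // => i j; lia. Qed.

(** Ramanujan's theta series: phi sums q^(n^2) over all integers n, psi sums q^(n(n+1)/2) over n >=
    0. Each coefficient is written as a finite count. *)
Definition phi : fps := Fps (fun n => (n == 0%N)%:R + 2 * (\sum_(1 <= u < n.+1) (u ^ 2 == n)%N%:R)).
Definition psi : fps := Fps (fun n => \sum_(0 <= u < n.+1) (u * u.+1 == 2 * n)%N%:R).

Lemma phi_irange M n : (n <= M)%N ->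
  phi n = \sum_(x <- irange M) (absz x ^ 2 == n)%N%:R.
Proof.
move=> nM.
have -> : \sum_(x <- irange M) (absz x ^ 2 == n)%N%:R =
   \sum_(i <- iota 0 M) (absz (i%:Z - M%:Z) ^ 2 == n)%N%:R + ((0 == n)%N%:R +
   \sum_(1 <= u < M.+1) (u ^ 2 == n)%N%:R) :> int.
  rewrite /irange big_map (_ : M.*2.+1 = M + M.+1)%N; last by lia.
  rewrite iotaD big_cat /= add0n; congr (_ + _).
  rewrite big_cons subrr absz0; congr (_ + _).
  rewrite -[iota M.+1 M]/(iota (1 + M) M) addnC iotaDl big_map.
  rewrite /index_iota subSS subn0; apply: eq_bigr => i _.
  by have -> : `|(M + i)%:Z - M%:Z|%N = i by lia.
have -> : \sum_(i <- iota 0 M) (absz (i%:Z - M%:Z) ^ 2 == n)%N%:R =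
   \sum_(1 <= u < M.+1) (u ^ 2 == n)%N%:R :> int.
  rewrite big_nat_rev /= /index_iota subSS subn0 big_seq [RHS](_ : _ = \sum_(i <- iota 0 M) (absz ((i%:Z - M%:Z) : int) ^ 2 == n)%N%:R).
    by rewrite -big_seq.
  rewrite -[1%N]/(1 + 0)%N iotaDl big_map big_seq [RHS]big_seq.
  apply: eq_bigr => i; rewrite mem_iota => /andP[_ iM].
  by have -> : (1 + M.+1 - (1 + i).+1 = `|i%:Z - M%:Z|)%N by lia.
have -> : \sum_(1 <= u < M.+1) (u ^ 2 == n)%N%:R = \sum_(1 <= u < n.+1) (u ^ 2 == n)%N%:R :> int.
  rewrite (big_cat_nat (n := n.+1)) //= [X in _ + X]big1_seq ?addr0 // => u.
  rewrite mem_index_iota => /andP[u1 u2]; case: eqP => // h; exfalso.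
  by move: h; rewrite expnS expn1; nia.
by rewrite /= (eq_sym 0%N); ring.
Qed.

Definition r2set (n : nat) : seq (int * int) :=
  [seq xy <- [seq (x, y) | x <- irange n, y <- irange n] | (absz xy.1 ^ 2 + absz xy.2 ^ 2 == n)%N].
Lemma mem_r2set n xy : (xy \in r2set n) = (absz xy.1 ^ 2 + absz xy.2 ^ 2 == n)%N.
Proof.
rewrite mem_filter; apply/andP/idP => [ []//|h]; split=> //.
case: xy h => x y /eqP h; move: h; rewrite [(x, y).1]/= [(x, y).2]/= => h.
apply: allpairs_f; rewrite mem_irange; move: h; rewrite !expnS !expn0; nia.
Qed.
Lemma uniq_r2set n : uniq (r2set n).
Proof.
apply: filter_uniq; apply: allpairs_uniq; rewrite ?uniq_irange //.
by move=> [x y] [x' y'].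
Qed.
Lemma phi2E n : (phi ^+ 2) n = (size (r2set n))%:R.
Proof.
rewrite expr2 cfM.
transitivity (\sum_(i < n.+1) \sum_(x <- irange n) \sum_(y <- irange n)
   (absz x ^ 2 == i)%N%:R * (absz y ^ 2 == n - i)%N%:R : int).
  apply: eq_bigr => i _; have iN := ltn_ord i.
  rewrite (@phi_irange n) // (@phi_irange n) ?leq_subr // mulr_suml.
  by apply: eq_bigr => x _; rewrite mulr_sumr.
rewrite exchange_big /=.
transitivity (\sum_(x <- irange n) \sum_(y <- irange n) (absz x ^ 2 + absz y ^ 2 == n)%N%:R : int).
  apply: eq_bigr => x _; rewrite exchange_big /=; apply: eq_bigr => y _.
  case: (leqP (absz x ^ 2) n) => xn.
    have h : (absz x ^ 2 < n.+1)%N by [].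
    rewrite (bigD1 (Ordinal h)) //= eqxx mul1r big1 ?addr0.
      by congr (_%:R); congr (nat_of_bool _); apply/eqP/eqP; lia.
    move=> i /negPf; rewrite -val_eqE /= eq_sym => ->; by rewrite mul0r.
  rewrite big1.
    by case: eqP => //; lia.
  by move=> i _; case: eqP => [h|]; rewrite ?mul0r //; have := ltn_ord i; lia.
rewrite /r2set size_filter -sum1_count natr_sum [RHS]big_mkcond big_allpairs /=.
by apply: eq_bigr => x _; apply: eq_bigr => y _; case: eqP.
Qed.

(** The map (x, y) -> (x + y, x - y) is a bijection from representations of n to those of 2n; it is
    onto because x^2 + y^2 even forces x and y to have the same parity. *)
Lemma r2_double n : size (r2set (2 * n)) = size (r2set n).
Proof.
rewrite -(size_map (fun xy : int * int => (xy.1 + xy.2, xy.1 - xy.2)) (r2set n)).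
have abs2 (x y : int) (k : nat) : (absz x ^ 2 + absz y ^ 2 == k)%N = (x * x + y * y == k%:Z).
  by rewrite !expnS !expn0 !muln1 -!abszM; apply/eqP/eqP; have := sqr_ge0 x; have := sqr_ge0 y;
     rewrite !expr2; lia.
apply/perm_size/uniq_perm; first exact: uniq_r2set.
  by rewrite map_inj_uniq ?uniq_r2set // => -[x y] [x' y'] /= [] h1 h2; congr (_, _); lia.
move=> [x y]; rewrite mem_r2set abs2 /=; apply/idP/mapP => [/eqP e|[[u v]]].
  have [u xu] : exists u, x + y = 2 * u.
    have par (z : int) : exists a, z = 2 * a \/ z = 2 * a + 1.
      by exists (z %/ 2)%Z; lia.
    have [[a xa] [b yb]] := (par x, par y); move: e.
    case: xa => ->; case: yb => -> e; [exists (a + b)|exfalso|exfalso|exists (a + b + 1)]; try lia.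
  exists (u, x - u); last by rewrite /=; congr (_, _); lia.
  rewrite mem_r2set abs2 /=; apply/eqP; have -> : u = x + y - u by lia.
  move: e; have -> : y = 2 * u - x by lia.
  by move=> e; lia.
by rewrite mem_r2set abs2 /= => /eqP h [-> ->]; apply/eqP; lia.
Qed.

Lemma phi2_double n : (phi ^+ 2) (2 * n)%N = (phi ^+ 2) n.
Proof. by rewrite !phi2E r2_double. Qed.

Lemma phi2_even : phi ^+ 2 + fsgn (phi ^+ 2) = 2%:R * fdil 2 (phi ^+ 2).
Proof.
apply: fpsP => n; rewrite cfD cf_fsgn cfMz_nat.
case: (boolP (2 %| n)%N) => [/dvdnP[m ->]|h].
  rewrite mulnC cf_fdil_mul // phi2_double mulnC muln2 -signr_odd odd_double; ring.
rewrite cf_fdil0 // -signr_odd; move: h; rewrite dvdn2 negbK => ->; ring.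
Qed.

Lemma sum_pred1 (P : nat -> bool) (l h k : nat) : (l <= k < h)%N -> P k ->
  (forall u, P u -> u = k) -> \sum_(l <= u < h) (P u)%:R = 1 :> int.
Proof.
move=> /andP[lk kh] Pk Pu; rewrite (big_cat_nat (n := k)) //=; last exact: ltnW.
rewrite [X in _ + X]big_ltn // Pk !big1_seq ?addr0 ?add0r // => u; rewrite mem_index_iota => /andP[u1 u2];
 by case: (boolP (P u)) => // /Pu uk; lia.
Qed.
Lemma sum_pred0 (P : nat -> bool) (l h : nat) :
  (forall u, ~~ P u) -> \sum_(l <= u < h) (P u)%:R = 0 :> int.
Proof. by move=> Pu; rewrite big1 // => u _; rewrite (negPf (Pu u)). Qed.

Lemma phi_sq k : (0 < k)%N -> phi (k ^ 2)%N = 2.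
Proof.
move=> k0; rewrite /= expn_eq0 (gtn_eqF k0) (@sum_pred1 _ _ _ k) ?eqxx //.
  by apply/andP; split; rewrite ?ltnS ?expnS ?expn0; nia.
by move=> u /eqP /eqP; rewrite eqn_exp2r // => /eqP.
Qed.
Lemma phi_nsq n : (forall k, (k ^ 2)%N <> n) -> phi n = 0.
Proof.
move=> h; rewrite /= sum_pred0; last by move=> u; apply/eqP.
by case: eqP => // n0; have := h 0%N; rewrite n0.
Qed.
Lemma psi_tri k n : (k * k.+1 = 2 * n)%N -> psi n = 1.
Proof.
move=> kn; rewrite /= (@sum_pred1 _ _ _ k) ?kn //.
  by apply/andP; split => //; nia.
move=> u /eqP; nia.
Qed.
Lemma psi_ntri n : (forall k, (k * k.+1 <> 2 * n)%N) -> psi n = 0.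
Proof. by move=> h; rewrite /= sum_pred0 // => u; apply/eqP. Qed.

(** Even squares are 4 l^2, odd squares are 8 (l(l+1)/2) + 1, and each nonzero square has two
    roots. *)
Lemma phi_dissect : phi = fdil 4 phi + 2%:R * (X * fdil 8 psi).
Proof.
apply: fpsP => n; rewrite cfD cfMz_nat -[X]expr1 cfXM cf_fdil.
have [[k kn]|h] := pselect (exists k, (k ^ 2)%N = n); last first.
  have nk k : (k ^ 2)%N <> n by move=> kn; apply: h; exists k.
  rewrite phi_nsq //.
  have -> : (if (4 %| n)%N then phi (n %/ 4)%N else 0) = 0.
    case: ifP => // /dvdnP[m nm]; rewrite phi_nsq // => k; rewrite nm mulnK // => km.
    by apply: (nk (2 * k)%N); rewrite nm -km !expnS !expn0; lia.
  rewrite cf_fdil; case: ltnP => n1; first by rewrite mulr0.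
  case: ifP; rewrite ?mulr0 // => /dvdnP[m nm]; rewrite psi_ntri ?mulr0 // => k.
  rewrite nm mulnK // => km; apply: (nk (2 * k + 1)%N).
  by rewrite !expnS !expn0; lia.
have [k0|k0] := posnP k.
  by subst; rewrite /= mulr0 addr0.
have [l kl] : exists l, (k = 2 * l \/ k = 2 * l + 1)%N by exists (k %/ 2)%N; lia.
case: kl => kl.
  have -> : n = (4 * l ^ 2)%N by rewrite -kn kl !expnS !expn0; lia.
  rewrite dvdn_mulr // mulKn // phi_sq; last by lia.
  have -> : (4 * l ^ 2 = (2 * l) ^ 2)%N by rewrite !expnS !expn0; lia.
  rewrite phi_sq; last by lia.
  case: ltnP => _; first by rewrite mulr0.
  rewrite cf_fdil0 ?mulr0 //; apply/negP => /dvdnP[m]; rewrite !expnS !expn0; lia.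
have e : (n = 8 * (l * l.+1 %/ 2) + 1)%N.
  have : (2 %| l * l.+1)%N by rewrite dvdn2 oddM /=; case: (odd l).
  by move=> /dvdnP[m lm]; rewrite lm mulnK // -kn kl !expnS !expn0; lia.
have -> : (if (4 %| n)%N then phi (n %/ 4)%N else 0) = 0.
  by case: ifP => //; rewrite e; lia.
rewrite -kn phi_sq // kn e ltnNge addn1 /= subn1 /= -[X in _ = _ + 2 * X]/(fdil 8 psi _) cf_fdil_mul //.
have ev : (2 %| l * l.+1)%N by rewrite dvdn2 oddM /=; case: (odd l).
by rewrite (@psi_tri l) // [in RHS]mulnC divnK.
Qed.

(** Insert [phi_dissect] into phi(q)^2 + phi(-q)^2 = 2 phi(q^2)^2 and compare the coefficients at
    the exponents 8n + 2: on each side a single term contributes there. *)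
Lemma fdil8_psi2 : psi ^+ 2 = phi * fdil 2 psi.
Proof.
have e := phi2_even; rewrite fsgnX in e; have d := phi_dissect.
have ds : fsgn phi = fdil 4 phi - 2%:R * (X * fdil 8 psi).
  rewrite {1}d fsgnD (@fsgn_dil 2) // fsgnMn fsgnM fsgn_X (@fsgn_dil 4) //; ring.
have d2 : fdil 2 phi = fdil 8 phi + 2%:R * (X ^+ 2 * fdil 16 psi).
  rewrite {1}d fdilD fdilMn fdil_mul // !fdil_dil // -[X]expr1 fdil_X //.
rewrite ds {1}d fdilX // d2 in e.
have {}e : fdil 4 (phi ^+ 2) + 4%:R * (X ^+ 2 * fdil 8 (psi ^+ 2)) =
   fdil 8 (phi ^+ 2) + 4%:R * (X ^+ 2 * fdil 8 (phi * fdil 2 psi)) + 4%:R * (X ^+ 4 * fdil 16 (psi ^+ 2)).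
  have e2 : 2%:R * (fdil 4 (phi ^+ 2) + 4%:R * (X ^+ 2 * fdil 8 (psi ^+ 2))) =
   2%:R * (fdil 8 (phi ^+ 2) + 4%:R * (X ^+ 2 * fdil 8 (phi * fdil 2 psi)) + 4%:R * (X ^+ 4 * fdil 16 (psi ^+ 2))).
    rewrite !fdilX // [fdil 8 (phi * _)]fdil_mul // fdil_dil // -[(8 * 2)%N]/16%N; 
    transitivity ((fdil 4 phi + 2%:R * (X * fdil 8 psi)) ^+ 2 + (fdil 4 phi - 2%:R * (X * fdil 8 psi)) ^+ 2).
      by ring.
    by rewrite e; ring.
  apply: fpsP => n; have := congr1 (fun f : fps => f n) e2; rewrite !cfMz_nat; lia.
apply: fpsP => n; have := congr1 (fun f : fps => f (8 * n + 2)%N) e.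
rewrite !cfD !cfMz_nat !cfXM !cf_fdil.
have -> : (4 %| 8 * n + 2)%N = false by lia.
have -> : (8 %| 8 * n + 2)%N = false by lia.
have -> : (8 * n + 2 < 2)%N = false by lia.
rewrite addnK dvdn_mulr // mulKn //; set u := (psi ^+ 2 : fps) n; set v := (phi * fdil 2 psi : fps) n.
case: ifP => [|h4]; first by lia.
have -> : (16 %| 8 * n + 2 - 4)%N = false by lia.
by lia.
Qed.

Lemma phi2_dissect : phi ^+ 2 = fdil 2 (phi ^+ 2) + 4%:R * (X * fdil 4 (psi ^+ 2)).
Proof.
have e := phi2_even; have d := phi_dissect.
have e2 : phi ^+ 2 - fsgn phi ^+ 2 = 8%:R * (X * fdil 4 (psi ^+ 2)).
  rewrite fdil8_psi2 fdil_mul // fdil_dil //.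
  rewrite {2}d fsgnD (@fsgn_dil 2) // fsgnMn fsgnM fsgn_X (@fsgn_dil 4) // {1}d; ring.
have {}e : 2%:R * phi ^+ 2 = 2%:R * (fdil 2 (phi ^+ 2) + 4%:R * (X * fdil 4 (psi ^+ 2))).
  rewrite fsgnX in e.
  transitivity ((phi ^+ 2 + fsgn phi ^+ 2) + (phi ^+ 2 - fsgn phi ^+ 2)); first by ring.
  by rewrite e e2; ring.
by apply: fpsP => n; have := congr1 (fun f : fps => f n) e; rewrite !cfMz_nat; lia.
Qed.

(** By the dissections, both sides equal phi(q^4)^2 - 4 q^2 psi(q^8)^2. *)
Lemma phi_sgn_mul : phi * fsgn phi = fdil 2 (fsgn phi ^+ 2).
Proof.
rewrite -fsgnX phi2_dissect fsgnD (@fsgn_dil 1) // fsgnMn fsgnM fsgn_X (@fsgn_dil 2) //.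
rewrite fdilD fdilMn fdil_mul // !fdil_dil // fdilN -[X]expr1 fdil_X //.
rewrite {2}phi_dissect fsgnD (@fsgn_dil 2) // fsgnMn fsgnM fsgn_X (@fsgn_dil 4) // {1}phi_dissect.
rewrite !fdilX //; ring.
Qed.

(** Jacobi's quartic identity, as a difference of squares: the factors are 2 phi(q^2)^2 and 8 q
    psi(q^4)^2, and phi(q^2) psi(q^4) = psi(q^2)^2. *)
Lemma phi4_sub : phi ^+ 4 - fsgn phi ^+ 4 = 16%:R * (X * fdil 2 psi ^+ 4).
Proof.
have h1 : phi ^+ 2 + fsgn phi ^+ 2 = 2%:R * fdil 2 (phi ^+ 2) by rewrite -fsgnX phi2_even.
have h2 : phi ^+ 2 - fsgn phi ^+ 2 = 8%:R * (X * fdil 4 (psi ^+ 2)).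
  rewrite -[fsgn phi ^+ 2]fsgnX; move: h1; rewrite -fsgnX => h1.
  rewrite -[fsgn _](addKr (phi ^+ 2)) h1.
  have -> : 8%:R * (X * fdil 4 (psi ^+ 2)) = 2%:R * (phi ^+ 2 - fdil 2 (phi ^+ 2)).
    by rewrite {1}phi2_dissect; ring.
  ring.
have -> : phi ^+ 4 - fsgn phi ^+ 4 = (phi ^+ 2 + fsgn phi ^+ 2) * (phi ^+ 2 - fsgn phi ^+ 2) by ring.
have e := congr1 (fdil 2) fdil8_psi2.
rewrite fdilX // [fdil 2 (phi * _)]fdil_mul // fdil_dil // -[(2 * 2)%N]/4%N in e.
rewrite h1 h2 !fdilX //.
transitivity (16%:R * (X * (fdil 2 phi * fdil 4 psi) ^+ 2)); first by ring.
by rewrite -e; ring.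
Qed.

(* serE and serD are the q-expansions of E4 and Delta. *)
Definition serA : fps := phi ^+ 2.
Definition serP : fps := fsgn phi ^+ 2.
Definition serW : fps := X * psi ^+ 8.
Definition serE : fps := 16%:R * serA ^+ 4 - 16%:R * (serA ^+ 2 * serP ^+ 2) + serP ^+ 4.
Definition serD : fps := serW * serP ^+ 8.

Lemma serW_AP : 16%:R * serW = serA ^+ 2 * (serA ^+ 2 - serP ^+ 2).
Proof.
have -> : serA ^+ 2 - serP ^+ 2 = phi ^+ 4 - fsgn phi ^+ 4 by rewrite /serA /serP; ring.
rewrite phi4_sub /serA /serW.
have -> : psi ^+ 8 = (psi ^+ 2) ^+ 4 by ring.
by rewrite fdil8_psi2; ring.
Qed.

Lemma serE_W : serE = 256%:R * serW + serP ^+ 4.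
Proof.
have -> : 256%:R * serW = 16%:R * (16%:R * serW) by ring.
by rewrite serW_AP /serE; ring.
Qed.

(** * The 2-adic closure of the ring generated by E4 and Delta *)

Definition cong (K : nat) (f g : fps) : Prop := exists h : fps, f = g + 2%:R ^+ K * h.

Lemma congP K f g : cong K f g <-> forall n, ((2 ^ K)%:Z %| f n - g n)%Z.
Proof.
have e (h : fps) n : (2%:R ^+ K * h) n = (2 ^ K)%:Z * h n.
  by rewrite -natrX cfMz_nat natz.
split=> [[h ->] n|H]; first by rewrite cfD e addrAC subrr add0r dvdz_mulr.
exists (Fps (fun n => ((f n - g n) %/ (2 ^ K)%:Z)%Z)); apply: fpsP => n.
by rewrite cfD e /= mulrC divzK // addrC subrK.
Qed.

Lemma cong_refl K f : cong K f f. Proof. by exists 0; rewrite mulr0 addr0. Qed.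
Lemma cong_sym K f g : cong K f g -> cong K g f.
Proof. by move=> [h ->]; exists (- h); ring. Qed.
Lemma cong_trans K f g h : cong K f g -> cong K g h -> cong K f h.
Proof. by move=> [u ->] [v ->]; exists (u + v); ring. Qed.
Lemma congD K f g f' g' : cong K f g -> cong K f' g' -> cong K (f + f') (g + g').
Proof. by move=> [u ->] [v ->]; exists (u + v); ring. Qed.
Lemma congN K f g : cong K f g -> cong K (- f) (- g).
Proof. by move=> [u ->]; exists (- u); ring. Qed.
Lemma congM K f g f' g' : cong K f g -> cong K f' g' -> cong K (f * f') (g * g').
Proof. by move=> [u ->] [v ->]; exists (u * g' + v * g + 2%:R ^+ K * u * v); ring. Qed.
Lemma congX K f g m : cong K f g -> cong K (f ^+ m) (g ^+ m).
Proof.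
by move=> h; elim: m => [|m IH]; [exact: cong_refl|rewrite !exprS; apply: congM].
Qed.
Lemma cong_le K L f g : (L <= K)%N -> cong K f g -> cong L f g.
Proof.
move=> LK [u ->]; exists (2%:R ^+ (K - L) * u); rewrite mulrA -exprD subnKC //.
Qed.
Lemma cong_sqr K f g : (0 < K)%N -> cong K f g -> cong K.+1 (f ^+ 2) (g ^+ 2).
Proof.
case: K => // K _ [u ->]; exists (g * u + 2%:R ^+ K * u ^+ 2).
by rewrite !exprS; ring.
Qed.
Lemma cong2M K f g : cong K f g -> cong K.+1 (2%:R * f) (2%:R * g).
Proof. by move=> [u ->]; exists u; rewrite exprS; ring. Qed.

Lemma cong_fdil k K f g : cong K f g -> cong K (fdil k f) (fdil k g).
Proof.
move=> /congP h; apply/congP => n; rewrite !cf_fdil; by case: ifP => // _; rewrite ?subrr ?dvdz0.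
Qed.

(** In the convolution the indices i and n - i give equal terms, which cancel modulo 2; only the
    middle term a^2 = a survives when n is even. *)
Lemma fps_sqr_mod2 f : cong 1 (f ^+ 2) (fdil 2 f).
Proof.
apply/congP => n; rewrite expr2 cfM -(big_mkord predT (fun i => f i * f (n - i)%N)).
have rev a b : (a <= b)%N -> (b <= n.+1)%N -> (a + b = n.+1)%N ->
   \sum_(0 <= i < a) f i * f (n - i)%N = \sum_(b <= i < n.+1) f i * f (n - i)%N.
  move=> ab bn abn; rewrite [RHS]big_nat_rev /=.
  have sh (G : nat -> int) : \sum_(b <= i < n.+1) G i = \sum_(0 <= i < n.+1 - b) G (i + b)%N.
    by rewrite -{1}[b]add0n big_addn.
  rewrite sh (_ : (n.+1 - b = a)%N); last by lia.
  rewrite big_nat [RHS]big_nat; apply: eq_bigr => i /andP[_ ia].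
  by rewrite mulrC; congr (f _ * f _); lia.
have [/dvdnP[m nm]|n2] := boolP (2 %| n)%N.
  rewrite (big_cat_nat (n := m)) //; last by lia.
  rewrite [X in _ + X - _]big_ltn; last by lia.
  rewrite -(rev m m.+1); try lia.
  rewrite nm mulnC cf_fdil_mul // mulnC.
  have -> : (m * 2 - m = m)%N by lia.
  set S := \sum_(_ <= _ < _) _; rewrite expn1.
  have : (2 %| f m * f m - f m)%Z.
    rewrite (_ : _ - f m = f m * (f m - 1)); last by ring.
    have [h|h] : (f m %% 2)%Z = 0 \/ (f m %% 2)%Z = 1 by lia.
    - by rewrite dvdz_mulr //; apply/dvdz_mod0P.
    - by rewrite dvdz_mull //; lia.
  by rewrite [X in S + X]/=; lia.
rewrite [fdil 2 f n]cf_fdil0 // subr0.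
have nm : (n = (n %/ 2).*2.+1)%N by lia.
rewrite (big_cat_nat (n := (n %/ 2).+1)) //; last by lia.
rewrite -(rev (n %/ 2).+1 (n %/ 2).+1); try lia.
rewrite expn1; set S := \sum_(_ <= _ < _) _; rewrite [X in (_ %| X)%Z]/=; lia.
Qed.

Lemma fsgn_mod2 f : cong 1 (fsgn f) f.
Proof.
apply/congP => n; rewrite cf_fsgn -signr_odd expn1; case: (odd n); rewrite ?expr1 ?expr0; set u := f n; lia.
Qed.

Section Closure.
Variable MM : fps -> Prop.
Hypothesis MM_int : forall c : int, MM c%:~R.
Hypothesis MM_add : forall f g, MM f -> MM g -> MM (f + g).
Hypothesis MM_mul : forall f g, MM f -> MM g -> MM (f * g).

(* The 2-adic closure of the ring MM localized at 2: every approximation of f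
   modulo 2^K comes from MM after multiplication by a power of 2. *)
Definition Rr (f : fps) := forall K, exists N g, MM g /\ cong (K + N) (2%:R ^+ N * f) g.

Lemma Rr_MM f : MM f -> Rr f.
Proof. by move=> h K; exists 0%N, f; split=> //; rewrite expr0 mul1r; apply: cong_refl. Qed.
Lemma Rr_int (c : int) : Rr c%:~R. Proof. exact: Rr_MM. Qed.
Lemma Rr_nat (n : nat) : Rr n%:R. Proof. exact: (Rr_int n). Qed.
Lemma Rr_mul f g : Rr f -> Rr g -> Rr (f * g).
Proof.
move=> hf hg K; have [N [f' [mf [u eu]]]] := hf K; have [N' [g' [mg [v ev]]]] := hg K.
exists (N + N')%N, (f' * g'); split; first exact: MM_mul.
exists (u * g + v * f - 2%:R ^+ K * u * v).
have -> : f' = 2%:R ^+ N * f - 2%:R ^+ (K + N) * u by rewrite eu; ring.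
have -> : g' = 2%:R ^+ N' * g - 2%:R ^+ (K + N') * v by rewrite ev; ring.
by rewrite !exprD; ring.
Qed.
Lemma Rr_add f g : Rr f -> Rr g -> Rr (f + g).
Proof.
move=> hf hg K; have [N [f' [mf [u eu]]]] := hf K; have [N' [g' [mg [v ev]]]] := hg K.
have m2 n : MM (2%:R ^+ n) by rewrite -natrX; apply: (MM_int (2 ^ n)%N).
exists (N + N')%N, (2%:R ^+ N' * f' + 2%:R ^+ N * g'); split.
  by apply: MM_add; apply: MM_mul.
exists (u + v).
have -> : f' = 2%:R ^+ N * f - 2%:R ^+ (K + N) * u by rewrite eu; ring.
have -> : g' = 2%:R ^+ N' * g - 2%:R ^+ (K + N') * v by rewrite ev; ring.
by rewrite !exprD; ring.
Qed.
Lemma Rr_opp f : Rr f -> Rr (- f).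
Proof. by move=> h; rewrite -mulN1r; apply: Rr_mul => //; exact: (Rr_int (-1)). Qed.
Lemma Rr_sub f g : Rr f -> Rr g -> Rr (f - g).
Proof. by move=> hf hg; apply: Rr_add => //; apply: Rr_opp. Qed.
Lemma Rr_exp f m : Rr f -> Rr (f ^+ m).
Proof.
by move=> h; elim: m => [|m IH]; [exact: (Rr_nat 1)|rewrite exprS; apply: Rr_mul].
Qed.
Lemma Rr_div f N : Rr (2%:R ^+ N * f) -> Rr f.
Proof.
move=> h K; have [M [g [mg [u eu]]]] := h (K + N)%N.
exists (M + N)%N, g; split=> //; exists u.
by rewrite exprD -mulrA eu; congr (_ + _ ^+ _ * _); lia.
Qed.
Lemma Rr_lim f : (forall K, exists g, Rr g /\ cong K f g) -> Rr f.
Proof.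
move=> h K; have [g [rg [u ->]]] := h K; have [N [m [mm [v ev]]]] := rg K.
exists N, m; split=> //; exists (u + v).
by rewrite mulrDr ev !exprD; ring.
Qed.
(** Iterating [G] from 0 gains one power of 2 per step and never leaves [Rr], so [z] is a 2-adic
    limit of elements of [Rr]. *)
Lemma Rr_fix (G : fps -> fps) z : z = G z -> (forall g, Rr g -> Rr (G g)) ->
  (forall K g g', cong K g g' -> cong K.+1 (G g) (G g')) -> Rr z.
Proof.
move=> ez RG cG; apply: Rr_lim; elim=> [|K [g [rg cg]]].
  by exists 0; split; [exact: (Rr_nat 0)|exists z; rewrite expr0; ring].
by exists (G g); split; [exact: RG|rewrite ez; apply: cG].
Qed.

(* a contraction z |-> y + 2 (u z + v z^2) *)
Lemma Rr_quad y u v z : Rr y -> Rr u -> Rr v -> z = y + 2%:R * (u * z + v * z ^+ 2) -> Rr z.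
Proof.
move=> ry ru rv ez; apply: (Rr_fix (G := fun z => y + 2%:R * (u * z + v * z ^+ 2))) => //.
  move=> g rg; apply: Rr_add => //; apply: Rr_mul; first exact: Rr_nat.
  by apply: Rr_add; apply: Rr_mul => //; apply: Rr_exp.
move=> K g g' h; apply: congD; first exact: cong_refl.
by apply: cong2M; apply: congD; apply: congM; rewrite ?expr2 //; try exact: cong_refl; apply: congM.
Qed.

Hypothesis MM_E : MM serE.
Hypothesis MM_D : MM serD.

Lemma phi_1D2 : exists th : fps, phi = 1 + 2%:R * th.
Proof.
exists (Fps (fun n => \sum_(1 <= u < n.+1) (u ^ 2 == n)%N%:R)); apply: fpsP => n.
by rewrite cfD cfMz_nat cf1.
Qed.

Ltac rr := repeat lazymatch goal with
  | |- Rr (_%:R) => apply: Rr_nat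
  | |- Rr (_ + - _) => apply: Rr_sub
  | |- Rr (_ + _) => apply: Rr_add
  | |- Rr (_ * _) => apply: Rr_mul
  | |- Rr (_ ^+ _) => apply: Rr_exp
  | |- Rr (- _) => apply: Rr_opp
  | |- Rr 1 => exact: (Rr_nat 1)
  | |- Rr 0 => exact: (Rr_nat 0)
  | h : Rr ?f |- Rr ?f => exact: h
  end.

Theorem Rr_target (V : fps) (c : nat) : V * fsgn phi = 1 -> ~~ odd c -> (0 < c)%N ->
  Rr (V * fdil 2 V ^+ c.-1).
Proof.
move=> Vinv oc c0; have [th eth] := phi_1D2.
set s := fsgn th; have es : fsgn phi = 1 + 2%:R * s by rewrite eth fsgnD fsgn1 fsgnMn.
(* Chosen so that P, P^2, P^4 become 1 + 4x, 1 + 8z, 1 + 16y: every squaring after the first gains a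
   factor 2. *)
pose x := s + s ^+ 2; pose z := x + 2%:R * x ^+ 2; pose y := z + 4%:R * z ^+ 2.
have eP : serP = 1 + 4%:R * x by rewrite /serP es /x; ring.
have eP2 : serP ^+ 2 = 1 + 8%:R * z by rewrite eP /z; ring.
have eP4 : serP ^+ 4 = 1 + 16%:R * y.
  have -> : serP ^+ 4 = (serP ^+ 2) ^+ 2 by ring.
  by rewrite eP2 /y; ring.
have eD : serD = serW * (serP ^+ 4) ^+ 2 by rewrite /serD; ring.
pose e := 128%:R * serW + 8%:R * y.
have eE : serE = 1 + 2%:R * e by rewrite serE_W eP4 /e; ring.
have rE : Rr serE := Rr_MM MM_E. have rD : Rr serD := Rr_MM MM_D.
have re : Rr e.
  apply: (@Rr_div _ 1); rewrite expr1 (_ : 2%:R * e = serE - 1); first by rr.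
  by rewrite eE; ring.
(* With Y = 8y = e - 128 w one has P^8 = (1 + 2Y)^2, hence Delta = w + 4 w (Y + Y^2), an equation
   for w with coefficients in the closure. *)
have rW : Rr serW.
  pose Y w := e - 128%:R * w.
  apply: (Rr_fix (G := fun w => serD - 2%:R * (2%:R * w * (Y w + Y w ^+ 2)))).
  - by rewrite eD eP4 /Y /e; ring.
  - by move=> g rg; rewrite /Y; rr.
  - move=> K g g' h; apply: congD; first exact: cong_refl.
    have cY : cong K (Y g) (Y g').
      by apply: congD; [exact: cong_refl|apply: congN; apply: congM => //; exact: cong_refl].
    apply: congN; apply: cong2M; apply: congM; first by apply: congM => //; exact: cong_refl.
    by apply: congD => //; apply: congX.
have ry : Rr y.
  have h : 2%:R ^+ 4 * y = serE - 2%:R ^+ 8 * serW - 1.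
    by rewrite serE_W eP4; ring.
  apply: (@Rr_div _ 4).
  rewrite h.
  by rr.
have rz : Rr z by apply: (@Rr_quad y 0 (- 2%:R)); rr; rewrite /y; ring.
have rx : Rr x by apply: (@Rr_quad z 0 (- 1)); rr; rewrite /z; ring.
have rP : Rr serP by rewrite eP; rr.
pose t := X * fdil 2 psi ^+ 4.
have eA2 : serA ^+ 2 = serP ^+ 2 + 16%:R * t.
  by rewrite /t -phi4_sub /serA /serP; ring.
(* Together with A^2 = P^2 + 16 t = 1 + 8z + 16t this gives w = t + 8 z t + 16 t^2, a contraction
   for t. *)
have ew : serW = serA ^+ 2 * t.
  have h : 16%:R * serW = 16%:R * (serA ^+ 2 * t).
    by rewrite serW_AP {2}eA2; ring.
  by apply: fpsP => n; have := congr1 (fun f : fps => f n) h; rewrite !cfMz_nat; lia.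
have rt : Rr t.
  apply: (@Rr_quad serW (- (4%:R * z)) (- 8%:R)); rr.
  by rewrite ew eA2 eP2; ring.
pose l := th + th ^+ 2.
have eA : serA = 1 + 4%:R * l by rewrite /serA eth /l; ring.
have rl : Rr l.
  have rm : Rr (l + 2%:R * l ^+ 2).
    apply: (@Rr_div _ 3); rewrite (_ : _ * _ = serP ^+ 2 + 16%:R * t - 1); first by rr.
    by rewrite -eA2 eA; ring.
  by apply: (@Rr_quad (l + 2%:R * l ^+ 2) 0 (- 1)); [exact: rm|rr|rr|ring].
have rA : Rr serA by rewrite eA; rr.
(* B = phi(-q^2)^2, and B^2 = A P. As B is 1 modulo 4, its square root step is again a
   contraction. *)
pose B := phi * fsgn phi.
pose x' := fdil 2 x.
have eB : B = 1 + 4%:R * x'.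
  rewrite /B phi_sgn_mul -[fsgn phi ^+ 2]/serP eP fdilD fdil1 // fdilMn //.
have rx' : Rr x'.
  have rm : Rr (x' + 2%:R * x' ^+ 2).
    apply: (@Rr_div _ 3); rewrite (_ : _ * _ = serA * serP - 1); first by rr.
    have -> : serA * serP = B ^+ 2 by rewrite /serA /serP /B; ring.
    by rewrite eB; ring.
  by apply: (@Rr_quad (x' + 2%:R * x' ^+ 2) 0 (- 1)); [exact: rm|rr|rr|ring].
have rB : Rr B by rewrite eB; rr.
(* Only b^2 = A B is known to lie in the closure, and b is just 1 modulo 2, so the class of L modulo
   2 must be found by other means. *)
pose b := phi * fdil 2 (fsgn phi).
have eb2 : b ^+ 2 = serA * B.
  by rewrite /b /B phi_sgn_mul fdilX // /serA; ring.
pose s' := fdil 2 s.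
have es' : fdil 2 (fsgn phi) = 1 + 2%:R * s' by rewrite es fdilD fdil1 // fdilMn.
pose L := th + s' + 2%:R * th * s'.
have eb : b = 1 + 2%:R * L by rewrite /b es' eth /L; ring.
(* Modulo 2, s' is th(q^2), that is th^2, so L agrees with th + th^2 = l. With L = l + 2v, the
   equation for b^2, once divided by 8, becomes a contraction in v. *)
have [v ev] : exists v, L = l + 2%:R * v.
  have : cong 1 s' (th ^+ 2).
    apply: (@cong_trans _ _ (fdil 2 th)); first by apply: cong_fdil; apply: fsgn_mod2.
    by apply: cong_sym; apply: fps_sqr_mod2.
  move=> [u eu]; exists (u + th * s'); rewrite /L {1}eu /l expr1; ring.
have rv : Rr v.
  have rf : Rr (v + 2%:R * l * v + 2%:R * v ^+ 2).
    apply: (@Rr_div _ 3); rewrite (_ : _ * _ = serA * B - 1 - 4%:R * l - 4%:R * l ^+ 2); first by rr.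
    by rewrite -eb2 eb ev; ring.
  by apply: (@Rr_quad (v + 2%:R * l * v + 2%:R * v ^+ 2) (- l) (- 1)); [exact: rf|rr|rr|ring].
have rb : Rr b by rewrite eb ev; rr.
pose U := fdil 2 V.
have U1 : U * fdil 2 (fsgn phi) = 1 by rewrite /U -fdil_mul // Vinv fdil1.
have IB : U ^+ 2 * B = 1.
  by rewrite /B phi_sgn_mul fdilX // -exprMn U1 expr1n.
have rI : Rr (U ^+ 2).
  apply: (@Rr_quad 1 (- (2%:R * x')) 0); rr.
  transitivity (U ^+ 2 * B - 4%:R * x' * U ^+ 2); first by rewrite eB; ring.
  by rewrite IB; ring.
have [d cd] : exists d, c = d.+1.*2.
  by exists (c./2.-1); rewrite prednK ?half_gt0; move: oc c0; lia.
(* As 1/phi(-q) = phi(q) U^2, the series is phi(q) U^(c+1) = b U^(c+2), and c + 2 = 2 (d + 2). *)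
have -> : V * fdil 2 V ^+ c.-1 = b * (U ^+ 2) ^+ d.+2.
  have ephi : phi = B * V by rewrite /B -mulrA [fsgn phi * V]mulrC Vinv mulr1.
  rewrite -/U -exprM /b {1}ephi cd.
  have -> : (d.+1.*2.-1 = d * 2 + 1)%N by lia.
  have -> : (2 * d.+2 = (d * 2 + 1) + 3)%N by lia.
  have -> : B = fdil 2 (fsgn phi) ^+ 2 by rewrite /B phi_sgn_mul fdilX.
  set p := fdil 2 (fsgn phi).
  transitivity ((U * p) ^+ 3 * (V * U ^+ (d * 2 + 1))); first by rewrite U1 expr1n mul1r.
  by rewrite (exprD _ _ 3) exprMn; set u := U ^+ (d * 2 + 1); ring.
by apply: Rr_mul; [exact: rb|apply: Rr_exp; exact: rI].
Qed.
End Closure.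

(** * Nilpotency of Hecke operators modulo 2 *)

(** The action of T_p in weight w on q-expansions, for p prime. *)
Definition hecke (p w : nat) (f : fps) : fps :=
  Fps (fun n => f (p * n)%N + (p ^ w.-1)%:Z * fdil p f n).
Definition basis (m j : nat) : fps := serE ^+ (3 * (m - j)) * serD ^+ j.
Definition goodp (p : nat) := [&& prime p, odd p & (p %% 8 != 1)%N].

(** The only input from modular forms. The arithmetic below takes it as a hypothesis; it is
    established analytically in [hecke_stableP]. *)
Definition hecke_stable := forall p m i, prime p -> odd p -> (i <= m)%N ->
  exists c : nat -> int, hecke p (12 * m) (basis m i) = \sum_(j < m.+1) (c j)%:~R * basis m j.

Lemma dvdzD (d m n : int) : (d %| m)%Z -> (d %| n)%Z -> (d %| m + n)%Z.
Proof. by move=> hm hn; rewrite rpredD. Qed.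
Lemma cf_hecke p w f n : hecke p w f n = f (p * n)%N + (p ^ w.-1)%:Z * fdil p f n.
Proof. by []. Qed.
Lemma fdilZ k (c : int) f : fdil k (c%:~R * f) = c%:~R * fdil k f.
Proof. by apply: fpsP => n; rewrite cfMz !cf_fdil; case: ifP; rewrite ?cfMz ?mulr0. Qed.
Lemma fdil0 k : fdil k 0 = 0.
Proof. by apply: fpsP => n; rewrite cf_fdil if_same. Qed.
Lemma heckeD p w f g : hecke p w (f + g) = hecke p w f + hecke p w g.
Proof. by apply: fpsP => n; rewrite cfD !cf_hecke fdilD !cfD; ring. Qed.
Lemma heckeZ p w (c : int) f : hecke p w (c%:~R * f) = c%:~R * hecke p w f.
Proof. by apply: fpsP => n; rewrite cfMz !cf_hecke fdilZ !cfMz; ring. Qed.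
Lemma hecke_sum p w (I : Type) (r : seq I) (F : I -> fps) :
  hecke p w (\sum_(i <- r) F i) = \sum_(i <- r) hecke p w (F i).
Proof.
elim: r => [|x r IH]; last by rewrite !big_cons heckeD IH.
by rewrite !big_nil; apply: fpsP => n; rewrite cf_hecke fdil0 !cf0 mulr0 addr0.
Qed.

(** The weight disappears modulo 2 because every power of the odd number p is odd. *)
Lemma cong_hecke p w w' f g : odd p -> cong 1 f g -> cong 1 (hecke p w f) (hecke p w' g).
Proof.
move=> op /congP h; apply/congP => n; move: h; rewrite expn1 => h.
have oddpw v : exists u, (p ^ v)%:Z = 1 + 2 * u.
  have : odd (p ^ v) by rewrite oddX op orbT.
  by set q := (p ^ v)%N => oq; exists (q %/ 2)%N%:Z; lia.
have [u eu] := oddpw w.-1; have [u' eu'] := oddpw w'.-1.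
rewrite !cf_hecke eu eu'; have h1 := h (p * n)%N.
have h2 : (2 %| fdil p f n - fdil p g n)%Z by rewrite !cf_fdil; case: ifP => // _; rewrite subrr.
move: h1 h2; set a := f _; set b := g _; set c := fdil p f n; set d := fdil p g n => h1 h2.
have -> : a + (1 + 2 * u) * c - (b + (1 + 2 * u') * d) = (a - b) + (c - d) + 2 * (u * c - u' * d) by ring.
by apply: dvdzD; [exact: dvdzD|exact: dvdz_mulr].
Qed.

(** A representative of Delta^j modulo 2 whose exponents all lie in the class of j modulo 8, exactly
    and not only modulo 2. *)
Definition Dmod (j : nat) : fps := X ^+ j * fdil 8 (psi ^+ j).

Lemma serP_mod2 : cong 1 serP 1.
Proof.
have [th eth] := phi_1D2.
exists (2%:R * (fsgn th + fsgn th ^+ 2)); rewrite /serP eth fsgnD fsgn1 fsgnMn; ring.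
Qed.
Lemma serE_mod2 : cong 1 serE 1.
Proof.
rewrite serE_W; apply: (@cong_trans _ _ (0 + 1 ^+ 4)); last by rewrite expr1n add0r; apply: cong_refl.
apply: congD; last exact: congX serP_mod2.
by exists (128%:R * serW); ring.
Qed.
Lemma psi8_mod2 : cong 1 (psi ^+ 8) (fdil 8 psi).
Proof.
have -> : psi ^+ 8 = ((psi ^+ 2) ^+ 2) ^+ 2 by ring.
apply: (@cong_trans _ _ ((fdil 2 psi ^+ 2) ^+ 2)); first by do 2!apply: congX; apply: fps_sqr_mod2.
apply: (@cong_trans _ _ (fdil 2 (fdil 2 psi) ^+ 2)); first by apply: congX; apply: fps_sqr_mod2.
apply: (cong_trans (fps_sqr_mod2 _)); rewrite !fdil_dil //; exact: cong_refl.
Qed.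
Lemma serD_mod2 j : cong 1 (serD ^+ j) (Dmod j).
Proof.
rewrite /Dmod fdilX // -exprMn; apply: congX.
rewrite /serD -[X in cong _ _ X]mulr1; apply: congM.
  by apply: congM; [exact: cong_refl|exact: psi8_mod2].
by rewrite -(expr1n _ 8); apply: congX serP_mod2.
Qed.
Lemma basis_mod2 m j : cong 1 (basis m j) (Dmod j).
Proof.
rewrite /basis -[Dmod j]mul1r; apply: congM; last exact: serD_mod2.
by rewrite -(expr1n _ (3 * (m - j))); apply: congX serE_mod2.
Qed.

Arguments Dmod : simpl never.
Arguments basis : simpl never.
Arguments hecke : simpl never.
Lemma Dmod_supp j n : (n %% 8 != j %% 8)%N -> Dmod j n = 0.
Proof.
move=> h; rewrite cfXM; case: ltnP => // jn; rewrite cf_fdil0 //.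
by apply: contra h => /dvdnP[k nk]; apply/eqP; lia.
Qed.
Lemma psiX0 j : (psi ^+ j : fps) 0%N = 1.
Proof.
elim: j => [|j IH]; first by rewrite expr0.
by rewrite exprS cfM big_ord_recl big_ord0 subn0 addr0 IH mulr1 (@psi_tri 0).
Qed.
Lemma Dmod_lead j : Dmod j j = 1.
Proof. by rewrite cfXM ltnn subnn cf_fdil dvdn0 psiX0. Qed.
Lemma Dmod_low j n : (n < j)%N -> Dmod j n = 0.
Proof. by rewrite cfXM => ->. Qed.

Lemma cf_comb (N : nat) (c : nat -> int) (F : nat -> fps) n :
  (\sum_(j < N) (c j)%:~R * F j) n = \sum_(j < N) c j * F j n.
Proof. by rewrite cf_sum; apply: eq_bigr => j _; rewrite cfMz. Qed.

Lemma cong_comb K (N : nat) (c : nat -> int) (F G : nat -> fps) : (forall j, cong K (F j) (G j)) ->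
  cong K (\sum_(j < N) (c j)%:~R * F j) (\sum_(j < N) (c j)%:~R * G j).
Proof.
move=> h; elim: N => [|N IH]; first by rewrite !big_ord0; apply: cong_refl.
by rewrite !big_ord_recr /=; apply: congD => //; apply: congM => //; apply: cong_refl.
Qed.

(** Triangularity inside one class modulo 8: at exponent j only the indices k <= j of the same class
    contribute, those below j have even coefficients by induction, and the leading coefficient of
    [Dmod j] is 1. *)
Lemma Dmod_indep (N : nat) (c : nat -> int) i : cong 1 (\sum_(j < N) (c j)%:~R * Dmod j) i ->
  forall r, (forall n, (n %% 8 = r)%N -> (2 %| i n)%Z) ->
  forall j, (j < N)%N -> (j %% 8 = r)%N -> (2 %| c j)%Z.
Proof.
move=> /congP h r hr; elim/ltn_ind => j IH jN jr.
have e : \sum_(k < N) c k * Dmod k j = c j + \sum_(k < N | k != Ordinal jN) c k * Dmod k j.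
  by rewrite -[in RHS](mulr1 (c j)) -{1}(Dmod_lead j); exact: (bigD1 (Ordinal jN)).
have := h j; rewrite expn1 cf_comb e.
have hs : (2 %| \sum_(k < N | k != Ordinal jN) c k * Dmod k j)%Z.
  apply: (big_ind (fun x => (2 %| x)%Z)) => [|x y hx hy|k kj].
  - exact: dvdz0.
  - exact: dvdzD.
  case: (ltngtP k j) => kj'; last 1 first.
  - by move: kj; rewrite -val_eqE /= kj' eqxx.
  - have [ejk|ejk] := eqVneq (j %% 8)%N (k %% 8)%N; last by rewrite Dmod_supp // mulr0 dvdz0.
    by rewrite dvdz_mulr // IH // -ejk.
  - by rewrite Dmod_low // mulr0 dvdz0.
by have := hr j jr; move: hs; set S := \sum_(_ < _ | _) _; lia.
Qed.

Definition Span2 t f := exists d : nat -> int, cong 1 f (\sum_(j < t) (d j)%:~R * Dmod j).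

Lemma Span2_cong t f g : cong 1 f g -> Span2 t g -> Span2 t f.
Proof. by move=> fg [d h]; exists d; apply: cong_trans h. Qed.
Lemma Span2_add t f g : Span2 t f -> Span2 t g -> Span2 t (f + g).
Proof.
move=> [d h] [d' h']; exists (fun j => d j + d' j); apply: (cong_trans (congD h h')).
rewrite -big_split /=; rewrite (eq_bigr (fun j : 'I_t => (d j + d' j)%:~R * Dmod j)); first exact: cong_refl.
by move=> j _; rewrite rmorphD /= mulrDl.
Qed.
Lemma Span2_Z t (c : int) f : Span2 t f -> Span2 t (c%:~R * f).
Proof.
move=> [d h]; exists (fun j => c * d j).
apply: (cong_trans (congM (cong_refl _ _) h)); rewrite mulr_sumr.
rewrite (eq_bigr (fun j : 'I_t => (c * d j)%:~R * Dmod j)); first exact: cong_refl.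
by move=> j _; rewrite rmorphM /= mulrA.
Qed.
Lemma Span2_0 t : Span2 t 0.
Proof.
exists (fun=> 0); rewrite big1 => [|j _]; first exact: cong_refl.
by rewrite mul0r.
Qed.
Lemma Span2_D t j : (j < t)%N -> Span2 t (Dmod j).
Proof.
move=> jt; exists (fun k => (k == j)%:Z); rewrite (bigD1 (Ordinal jt)) //= eqxx mul1r big1 ?addr0.
  exact: cong_refl.
by move=> k; rewrite -val_eqE /= => /negPf ->; rewrite mul0r.
Qed.

Lemma Dmod_sqr j : cong 1 (fdil 2 (Dmod j)) (Dmod (2 * j)).
Proof.
apply: (@cong_trans _ _ (Dmod j ^+ 2)); first by apply: cong_sym; apply: fps_sqr_mod2.
rewrite /Dmod exprMn -exprM mulnC -fdilX // -exprM mulnC; exact: cong_refl.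
Qed.

Lemma hecke_fdil2 p w f : odd p -> hecke p w (fdil 2 f) = fdil 2 (hecke p w f).
Proof.
move=> op; apply: fpsP => n; rewrite [RHS]cf_fdil !cf_hecke !cf_fdil.
have cop : coprime 2 p by rewrite coprime2n.
have p0 : (0 < p)%N by rewrite odd_gt0.
rewrite (Gauss_dvdr _ cop).
have [/dvdnP[k ->]|n2] := boolP (2 %| n)%N.
  rewrite mulnK // mulnA mulnK //; congr (_ + _ * _).
  rewrite Gauss_dvdl 1?coprime_sym //.
  case: (boolP (p %| k)%N) => // /dvdnP[l ->].
  by rewrite mulnAC !mulnK // dvdn_mull.
rewrite add0r; case: ifP => [/dvdnP[k nk]|]; last by rewrite mulr0.
rewrite nk mulnK //; case: ifP; rewrite ?mulr0 // => k2; move: n2.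
by rewrite nk dvdn_mulr.
Qed.

Lemma goodp_mod p i : goodp p -> odd i -> (p * i %% 8 != i %% 8)%N.
Proof.
move=> /and3P[_ op p8] oi; rewrite -modnMm.
have : (p %% 8 = 3 \/ p %% 8 = 5 \/ p %% 8 = 7)%N by lia.
have : (i %% 8 = 1 \/ i %% 8 = 3 \/ i %% 8 = 5 \/ i %% 8 = 7)%N by lia.
by case=> [->|[->|[->|->]]]; case=> [->|[->|->]].
Qed.
Section Nilpotent.
Hypothesis HS : hecke_stable.

(** For odd i, T_p moves exponents from the class of i to the class of p i, as p is its own inverse
    modulo 8; these classes differ, so the coefficient of Delta^i is even. For even i, Delta^i is
    Delta^(i/2) at q^2 modulo 2, and T_p commutes with that substitution. For i = 0 the value 1 +
    p^(w-1) is even. *)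
Lemma hecke_Dmod_lt p w i : goodp p -> Span2 i (hecke p w (Dmod i)).
Proof.
move=> gp; have /and3P[pp op p8] := gp; have p0 := prime_gt0 pp.
elim/ltn_ind: i w => i IH w.
have [i0|i0] := posnP i.
  exists (fun=> 0); rewrite i0 big_ord0.
  have -> : Dmod 0 = 1 by rewrite /Dmod !expr0 fdil1 // mul1r.
  apply: (@cong_trans _ _ (hecke p 1 1)); first exact: cong_hecke (cong_refl _ _).
  apply/congP => n; rewrite subr0 cf_hecke fdil1 // !cf1 muln_eq0.
  by rewrite (gtn_eqF p0) /=; case: eqP.
have [oi|ei] := boolP (odd i).
  have [c hc] := HS pp op (leqnn i).
  have h : cong 1 (\sum_(j < i.+1) (c j)%:~R * Dmod j) (hecke p w (Dmod i)).
    apply: (@cong_trans _ _ (\sum_(j < i.+1) (c j)%:~R * basis i j)).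
      by apply: cong_comb => j; apply: cong_sym; apply: basis_mod2.
    by rewrite -hc; apply: cong_hecke => //; apply: basis_mod2.
  have ci : (2 %| c i)%Z.
    apply: (Dmod_indep h (r := (i %% 8)%N)) => // n ni.
    rewrite cf_hecke Dmod_supp.
      rewrite cf_fdil; case: ifP => [/dvdnP[k nk]|]; last by rewrite mulr0 addr0 dvdz0.
      rewrite Dmod_supp ?mulr0 ?addr0 ?dvdz0 // nk mulnK //.
      apply/eqP => ki; have := goodp_mod gp oi.
      by rewrite -modnMmr -ki modnMmr mulnC -nk ni ki eqxx.
    by rewrite -modnMmr ni modnMmr goodp_mod.
  exists c; apply: (cong_trans (cong_sym h)); rewrite big_ord_recr /=.
  have /dvdzP[u ->] := ci.
  exists (u%:~R * Dmod i); rewrite rmorphM /=; ring.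
have ie : i = (2 * i./2)%N by lia.
have il : (i./2 < i)%N by lia.
have [d hd] := IH _ il w.
apply: (@Span2_cong _ _ (fdil 2 (\sum_(j < i./2) (d j)%:~R * Dmod j))).
  rewrite {1}ie; apply: (@cong_trans _ _ (hecke p w (fdil 2 (Dmod i./2)))).
    by apply: cong_hecke => //; apply: cong_sym; apply: Dmod_sqr.
  by rewrite hecke_fdil2 //; apply: cong_fdil.
have : (i./2 <= i./2)%N by [].
elim: {-2}i./2 => [|N IHN] Ni; first by rewrite big_ord0 fdil0; apply: Span2_0.
rewrite big_ord_recr /= fdilD; apply: Span2_add; first by apply: IHN; lia.
have -> : fdil 2 ((d N)%:~R * Dmod N) = (d N)%:~R * fdil 2 (Dmod N).
  exact: fdilZ.
by apply: Span2_Z; apply: Span2_cong (Dmod_sqr N) _; apply: Span2_D; lia.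
Qed.

(** Degree in Delta less than t modulo 2, with an actual integral expansion kept so that division by
    2 stays possible. For t = m + 1 there is no parity condition. *)
Definition Fil m t f := exists c : nat -> int, f = \sum_(j < m.+1) (c j)%:~R * basis m j /\
  (forall j, (t <= j <= m)%N -> (2 %| c j)%Z).

(** Independence modulo 2 transfers a degree bound known for the series modulo 2 to the chosen
    integral coefficients. *)
Lemma Fil_cong m t (c : nat -> int) : (t <= m.+1)%N -> Span2 t (\sum_(j < m.+1) (c j)%:~R * basis m j) ->
  Fil m t (\sum_(j < m.+1) (c j)%:~R * basis m j).
Proof.
move=> tm [d hd]; exists c; split=> // j /andP[tj jm].
pose c' k := c k - (if (k < t)%N then d k else 0).
have e : cong 1 (\sum_(k < m.+1) (c' k)%:~R * Dmod k) 0.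
  have -> : \sum_(k < m.+1) (c' k)%:~R * Dmod k =
     \sum_(k < m.+1) (c k)%:~R * Dmod k - \sum_(k < t) (d k)%:~R * Dmod k.
    have -> : \sum_(k < t) (d k)%:~R * Dmod k = \sum_(k < m.+1) (if (k < t)%N then (d k)%:~R * Dmod k else 0).
      by rewrite (big_ord_widen _ (fun k => (d k)%:~R * Dmod k) tm) -big_mkcond.
    rewrite -sumrB.
    apply: eq_bigr => k _; rewrite /c' rmorphB /= mulrBl; case: ifP => // _.
    by rewrite mul0r.
  rewrite -[X in cong _ _ X](subrr (\sum_(k < t) (d k)%:~R * Dmod k)).
  apply: congD; last exact: cong_refl.
  apply: cong_trans hd; apply: cong_comb => k; apply: cong_sym; exact: basis_mod2.
have := @Dmod_indep _ c' 0 e (j %% 8)%N _ j jm erefl.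
rewrite /c' ltnNge tj /= subr0; apply=> n _; exact: dvdz0.
Qed.

Lemma Fil_hecke p m t f : goodp p -> (t <= m)%N -> Fil m t.+1 f -> Fil m t (hecke p (12 * m) f).
Proof.
move=> gp tm [c [ef hc]]; have /and3P[pp op p8] := gp.
have [C hC] : exists C : nat -> nat -> int, forall i, (i <= m)%N ->
   hecke p (12 * m) (basis m i) = \sum_(j < m.+1) (C i j)%:~R * basis m j.
  have /choice[C hC] : forall i, exists ci : nat -> int, (i <= m)%N ->
     hecke p (12 * m) (basis m i) = \sum_(j < m.+1) (ci j)%:~R * basis m j.
    move=> i; have [im|im] := boolP (i <= m)%N; last by exists (fun=> 0).
    by have [ci h] := HS pp op im; exists ci.
  by exists C.
have e : hecke p (12 * m) f = \sum_(j < m.+1) (\sum_(i < m.+1) c i * C i j)%:~R * basis m j.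
  rewrite ef hecke_sum.
  transitivity (\sum_(i < m.+1) \sum_(j < m.+1) (c i)%:~R * ((C i j)%:~R * basis m j)).
    apply: eq_bigr => i _; rewrite heckeZ hC ?mulr_sumr //.
    by have := ltn_ord i; lia.
  rewrite exchange_big /=; apply: eq_bigr => j _.
  rewrite rmorph_sum mulr_suml; apply: eq_bigr => i _.
  by rewrite mulrA rmorphM.
rewrite e; apply: (@Fil_cong _ _ (fun j => \sum_(i < m.+1) c i * C i j)); first exact: leqW.
rewrite -e ef hecke_sum.
apply: (big_ind (Span2 t)) => [||i _]; [exact: Span2_0|exact: Span2_add|].
rewrite heckeZ; have im : (i <= m)%N by rewrite -ltnS.
have [ti|it] := ltnP t i.
  have /dvdzP[u ->] := hc i (introT andP (conj ti im)).
  apply: (@Span2_cong _ _ 0); last exact: Span2_0.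
  by exists (u%:~R * hecke p (12 * m) (basis m i)); rewrite rmorphM /=; ring.
apply: Span2_Z; apply: (@Span2_cong _ _ (hecke p (12 * m) (Dmod i))).
  by apply: cong_hecke => //; apply: basis_mod2.
have [d hd] := hecke_Dmod_lt (12 * m) i gp.
apply: Span2_cong hd _.
elim/big_ind: _ => [||j _]; [exact: Span2_0|exact: Span2_add|].
by apply: Span2_Z; apply: Span2_D; have := ltn_ord j; lia.
Qed.

Lemma Fil_half m f : Fil m 0 f -> exists g, Fil m m.+1 g /\ f = 2%:~R * g.
Proof.
move=> [c [ef hc]]; exists (\sum_(j < m.+1) ((c j) %/ 2)%Z%:~R * basis m j); split.
  by exists (fun j => (c j %/ 2)%Z); split=> // j /andP[]; lia.
rewrite ef mulr_sumr; apply: eq_bigr => j _; rewrite mulrA -rmorphM [2 * _]mulrC divzK //.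
by apply: hc; have := ltn_ord j; lia.
Qed.

(** * Products of Hecke operators and divisibility of coefficients *)

Definition heckes w (s : seq nat) f := foldr (fun p => hecke p w) f s.

Lemma heckesZ w s (c : int) f : heckes w s (c%:~R * f) = c%:~R * heckes w s f.
Proof. by elim: s => //= p s ->; rewrite heckeZ. Qed.

Lemma heckes_cat w s1 s2 f : heckes w (s1 ++ s2) f = heckes w s1 (heckes w s2 f).
Proof. exact: foldr_cat. Qed.

Lemma Fil_heckes m s f t : all goodp s -> (t + size s <= m.+1)%N ->
  Fil m (t + size s) f -> Fil m t (heckes (12 * m) s f).
Proof.
elim: s t => [|p s IH] t /=; first by rewrite addn0.
move=> /andP[gp gs]; rewrite addnS => ts h; apply: Fil_hecke => //; first by lia.
by apply: IH => //; rewrite addSn.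
Qed.

(** A block of m + 1 good primes brings the degree from m + 1 down to 0, so all coefficients are
    even and a factor 2 splits off; the quotient starts again from degree m + 1. *)
Lemma heckes_pow2 m K s f : all goodp s -> size s = (K * m.+1)%N -> Fil m m.+1 f ->
  exists g, Fil m m.+1 g /\ heckes (12 * m) s f = (2 ^ K)%:Z%:~R * g.
Proof.
elim: K s f => [|K IH] s f gs ss hf.
  by exists f; split=> //; move/size0nil: ss => ->; rewrite mul1r.
have st : size (take (K * m.+1) s) = (K * m.+1)%N by rewrite size_takel // ss; lia.
have sd : size (drop (K * m.+1) s) = m.+1 by rewrite size_drop ss; lia.
rewrite -(cat_take_drop (K * m.+1) s) heckes_cat.
move: gs; rewrite -{1}(cat_take_drop (K * m.+1) s) all_cat => /andP[g1 g2].
have /Fil_half[g [hg ->]] : Fil m 0 (heckes (12 * m) (drop (K * m.+1) s) f).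
  by apply: Fil_heckes; rewrite // sd.
have [h [hh e]] := IH _ _ g1 st hg.
exists h; split=> //; rewrite heckesZ e mulrA -rmorphM /=; congr (_%:~R * _).
by rewrite expnS PoszM.
Qed.

Definition exactd (p n : nat) := (p %| n)%N && ~~ (p ^ 2 %| n)%N.
Definition good (r n : nat) := exists s : seq nat,
  [/\ size s = r, uniq s, all goodp s & all (fun p => exactd p n) s].

(** Since p does not divide n, the second term of T_p vanishes at n, and each operator just
    multiplies the index by p. *)
Lemma heckes_coef w s f n : uniq s -> all goodp s -> all (fun p => ~~ (p %| n)%N) s ->
  heckes w s f n = f (n * \prod_(p <- s) p)%N.
Proof.
elim: s n => [|p s IH] n; first by rewrite big_nil muln1.
rewrite [uniq _]/= [all _ _]/= [all _ (_ :: _)]/= => /andP[ps us] /andP[gp gs] /andP[pn ns].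
rewrite [heckes _ _ _]/= cf_hecke cf_fdil0 // mulr0 addr0 IH //.
  by rewrite big_cons mulnA (mulnC p).
apply/allP => q qs; have /and3P[pq _ _] := allP gs q qs; have /and3P[pp _ _] := gp.
rewrite Euclid_dvdM // negb_or (allP ns q qs) andbT.
by rewrite dvdn_prime2 //; apply: contra ps => /eqP <-.
Qed.

Lemma good_factor r n : good r n -> exists s u, [/\ size s = r, uniq s, all goodp s,
  all (fun p => ~~ (p %| u)%N) s & n = (u * \prod_(p <- s) p)%N].
Proof.
move=> [s [ss us gs es]]; exists s.
suff [u [h1 h2]] : exists u, n = (u * \prod_(p <- s) p)%N /\ all (fun p => ~~ (p %| u)%N) s.
  by exists u.
elim: s n us gs es {ss} => [|p s IH] n /=; first by exists n; rewrite big_nil muln1.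
move=> /andP[ps us] /andP[gp gs] /andP[ep es].
have [u [nu hu]] := IH n us gs es.
have /and3P[pp _ _] := gp.
have cop : coprime p (\prod_(q <- s) q).
  rewrite big_seq; elim/big_ind: _ => [|x y hx hy|q qs]; first exact: coprimen1.
    by rewrite coprimeMr hx hy.
  have /and3P[pq _ _] := allP gs q qs.
  by rewrite prime_coprime // dvdn_prime2 //; apply: contra ps => /eqP ->.
have /andP[pn p2n] := ep.
have /dvdnP[v uv] : (p %| u)%N by rewrite -(Gauss_dvdl u cop) -nu.
exists v; split; first by rewrite nu uv big_cons mulnA.
apply/andP; split.
  apply: contra p2n => pv; rewrite nu uv dvdn_mulr // expnS expn1 dvdn_mul //.
apply/allP => q qs; have := allP hu q qs; apply: contra; rewrite uv => qv.
by rewrite dvdn_mulr.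
Qed.

Definition Lac (f : fps) := forall K, exists r, forall n, good r n -> ((2 ^ K)%:Z %| f n)%Z.

Lemma good_le r r' n : (r <= r')%N -> good r' n -> good r n.
Proof.
move=> rr' [s [ss us gs es]]; exists (take r s); split; first by rewrite size_takel ?ss.
- exact: take_uniq.
- by apply/allP => p /mem_take; move/allP: gs; apply.
- by apply/allP => p /mem_take; move/allP: es; apply.
Qed.

(** An index divisible exactly once by K(m + 1) good primes is u times their product with u prime to
    them, so its coefficient is the coefficient at u of the product of the T_p, a multiple of
    2^K. *)
Lemma Lac_basis m j : (j <= m)%N -> Lac (basis m j).
Proof.
move=> jm K; exists (K * m.+1)%N => n /good_factor[s [u [ss us gs hu ->]]].
rewrite -(@heckes_coef (12 * m)) //.
have hf : Fil m m.+1 (basis m j).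
  exists (fun k => (k == j)%:Z); split; last by move=> k; lia.
  rewrite (bigD1 (Ordinal (jm : (j < m.+1)%N))) //= eqxx mul1r big1 ?addr0 // => k.
  by rewrite -val_eqE /= => /negPf ->; rewrite mul0r.
have [g [_ ->]] := heckes_pow2 gs ss hf.
by rewrite cfMz dvdz_mulr.
Qed.

Lemma Lac_cong f : (forall K, exists g, Lac g /\ cong K f g) -> Lac f.
Proof.
move=> h K; have [g [lg /congP fg]] := h K; have [r hr] := lg K; exists r => n gn.
by rewrite -(subrK (g n) (f n)) dvdzD // hr.
Qed.
Lemma Lac_add f g : Lac f -> Lac g -> Lac (f + g).
Proof.
move=> hf hg K; have [r hr] := hf K; have [r' hr'] := hg K; exists (maxn r r') => n gn.
by rewrite cfD dvdzD //; [apply: hr|apply: hr']; apply: good_le gn; rewrite ?leq_maxl ?leq_maxr.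
Qed.
Lemma Lac_Z (c : int) f : Lac f -> Lac (c%:~R * f).
Proof.
by move=> hf K; have [r hr] := hf K; exists r => n gn; rewrite cfMz dvdz_mull // hr.
Qed.

Lemma serE_pow2 R : cong R.+1 (serE ^+ (2 ^ R)) 1.
Proof.
elim: R => [|R IH]; first exact: serE_mod2.
by rewrite expnS mulnC exprM -[1](expr1n fps 2); apply: cong_sqr.
Qed.

(** [basis] only contains powers of E4 with exponent divisible by 3. Modulo 2^K the exponent can be
    raised by any multiple of 2^K, because E4^(2^K) is 1 there. *)
Lemma Lac_mono i j : Lac (serE ^+ i * serD ^+ j).
Proof.
apply: Lac_cong => K.
(* Solvable because 2^K is invertible modulo 3. *)
have [s hs] : exists s : nat, ((i + 2 ^ K * s) %% 3 = 0)%N.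
  have : (2 ^ K %% 3 = 1 \/ 2 ^ K %% 3 = 2)%N.
    by elim: K => [|K IH]; [left|rewrite expnS; lia].
  case=> h.
    by exists ((3 - i %% 3))%N; rewrite -modnDm -(modnMml (2 ^ K)) h modnDm; lia.
  by exists (i %% 3)%N; rewrite -modnDm -(modnMml (2 ^ K)) h modnDm; lia.
exists (serE ^+ (i + 2 ^ K * s) * serD ^+ j); split.
  pose m := ((i + 2 ^ K * s) %/ 3 + j)%N.
  have -> : serE ^+ (i + 2 ^ K * s) * serD ^+ j = basis m j.
    by rewrite /basis; congr (_ ^+ _ * _); rewrite /m; lia.
  by apply: Lac_basis; rewrite /m leq_addl.
apply: congM; last exact: cong_refl.
rewrite exprD -[X in cong _ X _]mulr1; apply: congM; first exact: cong_refl.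
apply: cong_sym; rewrite exprM -[X in cong _ _ X](expr1n fps s); apply: congX.
exact: cong_le (serE_pow2 K).
Qed.

Definition MM (g : fps) := exists s : seq (int * (nat * nat)),
  g = \sum_(t <- s) t.1%:~R * (serE ^+ t.2.1 * serD ^+ t.2.2).
Lemma MM_int (c : int) : MM c%:~R.
Proof. by exists [:: (c, (0%N, 0%N))]; rewrite big_seq1 /= !mulr1. Qed.
Lemma MM_add f g : MM f -> MM g -> MM (f + g).
Proof. by move=> [s ->] [s' ->]; exists (s ++ s'); rewrite big_cat. Qed.
Lemma MM_mul f g : MM f -> MM g -> MM (f * g).
Proof.
move=> [s ->] [s' ->].
exists [seq (t.1 * u.1, ((t.2.1 + u.2.1)%N, (t.2.2 + u.2.2)%N)) | t <- s, u <- s'].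
rewrite big_allpairs_dep /= mulr_suml; apply: eq_bigr => t _.
rewrite mulr_sumr; apply: eq_bigr => u _.
by rewrite rmorphM /= !exprD; ring.
Qed.
Lemma MM_E : MM serE.
Proof. by exists [:: (1, (1%N, 0%N))]; rewrite big_seq1 /= mul1r mulr1. Qed.
Lemma MM_D : MM serD.
Proof. by exists [:: (1, (0%N, 1%N))]; rewrite big_seq1 /= !mul1r. Qed.
Lemma Lac_MM g : MM g -> Lac g.
Proof.
move=> [s ->]; elim: s => [|t s IH].
  by rewrite big_nil => K; exists 0%N => n _; exact: dvdz0.
by rewrite big_cons; apply: Lac_add => //; apply: Lac_Z; apply: Lac_mono.
Qed.

(** Dividing by 2^N costs only precision: use lacunarity of the approximation modulo 2^(K+N). *)
Lemma Lac_Rr f : Rr MM f -> Lac f.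
Proof.
move=> h K; have [N [g [mg /congP fg]]] := h K.
have [r hr] := Lac_MM mg (K + N); exists r => n gn.
have : ((2 ^ (K + N))%:Z %| (2%:R ^+ N * f) n)%Z.
  by rewrite -(subrK (g n) ((2%:R ^+ N * f) n)) dvdzD // hr.
by rewrite -natrX cfMz_nat natz addnC expnD PoszM dvdz_mul2l // gt_eqF // ltz_nat expn_gt0.
Qed.

Theorem Lac_target (V : fps) (c : nat) : V * fsgn phi = 1 -> ~~ odd c -> (0 < c)%N ->
  Lac (V * fdil 2 V ^+ c.-1).
Proof.
by move=> h1 h2 h3; apply: Lac_Rr; apply: Rr_target; [exact: MM_int|exact: MM_add|exact: MM_mul|exact: MM_E|exact: MM_D|..].
Qed.
End Nilpotent.

(** * Sieve *)

Definition gprimes (y z : nat) : seq nat := [seq p <- iota y.+1 (z - y) | goodp p].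
Lemma mem_gprimes y z p : (p \in gprimes y z) = [&& goodp p, (y < p)%N & (p <= z)%N].
Proof.
by rewrite mem_filter mem_iota; congr (_ && _); case: (ltnP y p) => //= yp; lia.
Qed.
Lemma uniq_gprimes y z : uniq (gprimes y z).
Proof. exact: filter_uniq (iota_uniq _ _). Qed.

Lemma prime_factors_mod8 n : (0 < n)%N -> (forall p, prime p -> (p %| n)%N -> (p %% 8 = 1)%N) ->
  (n %% 8 = 1)%N.
Proof.
elim/ltn_ind: n => n IH n0 h.
have [->|n1] := eqVneq n 1%N; first by [].
have pn : (pdiv n %| n)%N := pdiv_dvd n.
have pp : prime (pdiv n) by rewrite pdiv_prime //; lia.
move: (pdiv n) pn pp => d pn pp.
rewrite -(divnK pn) -modnMm (h _ pp pn) muln1 modn_mod.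
have pos : (0 < n %/ d)%N by rewrite divn_gt0 ?prime_gt0 // dvdn_leq.
apply: IH => // [|q pq qn]; first by rewrite ltn_Pdiv // prime_gt1.
by apply: h => //; rewrite -(divnK pn) dvdn_mulr.
Qed.

(** Otherwise all prime factors of the odd number n would be 1 modulo 8, and so would n. *)
Lemma good_factor3 n : (n %% 8 = 3)%N -> exists p, goodp p /\ (p %| n)%N.
Proof.
move=> n3; apply: contrapT => H.
have : (n %% 8 = 1)%N; last by lia.
apply: prime_factors_mod8; first by lia.
move=> p pp pn; apply/eqP; apply: contrapT => p1; apply: H; exists p; split=> //.
apply/and3P; split=> //; last exact/negP.
apply: contraTT pn => ep; apply/negP => /dvdnP[k nk].
have on : odd n by lia.
by move: on; rewrite nk oddM (negPf ep) andbF.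
Qed.

(** The solutions t form a single class modulo p, so t -> t / p is injective on them. *)
Lemma count_linear (p a b T : nat) : prime p -> ~~ (p %| a)%N ->
  (count (fun t => p %| a * t + b)%N (iota 0 T) <= T %/ p + 1)%N.
Proof.
move=> pp pa; have p0 := prime_gt0 pp.
rewrite -size_filter -(size_map (fun t => t %/ p)%N).
rewrite -(size_iota 0 (T %/ p + 1)).
apply: uniq_leq_size.
  rewrite map_inj_in_uniq ?filter_uniq ?iota_uniq // => t t'.
  rewrite !mem_filter => /andP[pt _] /andP[pt' _] e.
  wlog tt : t t' pt pt' e / (t <= t')%N.
    move=> H; case: (leqP t t') => h; first exact: H.
    by apply: esym; apply: H => //; exact: ltnW.
  have : (p %| t' - t)%N.
    have : (p %| a * (t' - t))%N.
      by rewrite mulnBr -(subnDr b) dvdn_sub.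
    by rewrite Euclid_dvdM // (negPf pa).
  move=> /dvdnP[k kt].
  have : (t' = t + k * p)%N by lia.
  move=> t'e; move: e; rewrite t'e addnC divnMDl // => e.
  by have -> : k = 0%N by lia.
move=> u /mapP[t]; rewrite mem_filter mem_iota add0n => /andP[_ tT] ->.
by rewrite mem_iota add0n addn1 ltnS leq_div2r // ltnW.
Qed.

Lemma count_le_sum (I : eqType) (s : seq I) (P : nat -> bool) (Q : I -> nat -> bool) T :
  (forall t, (t < T)%N -> P t -> exists i, i \in s /\ Q i t) ->
  (count P (iota 0 T) <= \sum_(i <- s) count (Q i) (iota 0 T))%N.
Proof.
move=> h.
have -> : (\sum_(i <- s) count (Q i) (iota 0 T) = \sum_(t <- iota 0 T) \sum_(i <- s) Q i t)%N.
  by rewrite exchange_big /=; apply: eq_bigr => i _; rewrite -sumn_count sumnE big_map.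
have -> : (count P (iota 0 T) = \sum_(t <- iota 0 T) P t)%N.
  by rewrite -sumn_count sumnE big_map.
rewrite big_seq [X in (_ <= X)%N]big_seq; apply: leq_sum => t; rewrite mem_iota add0n => /= tT.
case: (boolP (P t)) => // Pt; have [i [si Qi]] := h t tT Pt.
by rewrite (big_rem i) //= Qi leq_addr.
Qed.

Section Divergence.
Variable R : realType.
Definition Sg (y z : nat) : R := \sum_(p <- gprimes y z) p%:R^-1.

Lemma gprimes_cat y z w : (y <= z)%N -> (z <= w)%N -> gprimes y w = gprimes y z ++ gprimes z w.
Proof.
move=> yz zw; rewrite /gprimes -filter_cat.
have -> : (w - y = (z - y) + (w - z))%N by lia.
by rewrite iotaD; congr (seq.filter _ (_ ++ iota _ _)); lia.
Qed.
Lemma Sg_cat y z w : (y <= z)%N -> (z <= w)%N -> Sg y w = Sg y z + Sg z w.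
Proof. by move=> yz zw; rewrite /Sg (gprimes_cat yz zw) big_cat. Qed.
Lemma Sg_ge0 y z : 0 <= Sg y z.
Proof. by apply: sumr_ge0 => p _; rewrite invr_ge0 ler0n. Qed.
Lemma Sg0 y z : (z <= y)%N -> Sg y z = 0.
Proof. by move=> zy; rewrite /Sg /gprimes (_ : (z - y)%N = 0%N) ?big_nil //; lia. Qed.

Lemma Sg_iter (e : R) : 0 < e -> (forall y, exists z, e <= Sg y z) ->
  forall k y, exists z, (y <= z)%N /\ e *+ k <= Sg y z.
Proof.
move=> e0 h; elim=> [|k IH] y; first by exists y; rewrite mulr0n Sg_ge0.
have [z [yz hz]] := IH y; have [w hw] := h z.
have zw : (z <= w)%N.
  by case: (leqP z w) => // wz; move: hw; rewrite Sg0 ?(ltnW wz) // leNgt e0.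
by exists w; split; [exact: leq_trans zw|rewrite (Sg_cat yz zw) mulrSr lerD].
Qed.

Lemma Sg_unbounded (e : R) : 0 < e -> (forall y, exists z, e <= Sg y z) ->
  forall M y, exists z, (y <= z)%N /\ M <= Sg y z.
Proof.
move=> e0 h M y; have [z [yz hz]] := Sg_iter e0 h (Num.bound `|M / e|) y.
exists z; split=> //; apply: le_trans hz; rewrite -mulr_natr -ler_pdivrMl // mulrC.
by apply: le_trans (ler_norm _) _; by apply: ltW; apply: archi_boundP.
Qed.

Lemma size_gprimes_le y z : (size (gprimes y z))%:R <= z%:R * Sg y z.
Proof.
rewrite mulr_sumr -sum1_size natr_sum big_seq [leRHS]big_seq; apply: ler_sum => p.
rewrite mem_gprimes => /and3P[gp yp pz].
have p0 : 0 < p%:R :> R by rewrite ltr0n; lia.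
by rewrite ler_pdivlMr // mul1r ler_nat.
Qed.

(** An elementary substitute for Dirichlet's theorem. If the reciprocals of good primes beyond y
    summed to less than 1/8, the T numbers 8Qt + r, each 3 modulo 8 and prime to all primes up to y,
    would be too many: each has a good prime factor beyond y, and every such p divides at most T/p +
    1 of them. *)
Lemma Sg_block : forall y, exists z, 1 / 8 <= Sg y z.
Proof.
apply: contrapT => H.
have [y hy] : exists y, forall z, Sg y z < 1 / 8.
  apply: contrapT => H'; apply: H => y; apply: contrapT => H2; apply: H'; exists y => z.
  by rewrite ltNge; apply/negP => h; apply: H2; exists z.
(* The product of the odd numbers up to y, hence divisible by every odd prime up to y. *)
pose Q := (\prod_(i < uphalf y) (i.*2.+1))%N.
have oQ : odd Q.
  rewrite /Q; elim/big_ind: _ => [//|a b oa ob|i _]; first by rewrite oddM oa.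
  by rewrite /= odd_double.
have Q0 : (0 < Q)%N by rewrite odd_gt0.
(* A bounded sum has small tails. The bound 1/(128 Q) makes the number of good primes between M and
   Z = 16QT at most T/8. *)
have [M hM] : exists M, forall z, Sg M z < (128 * Q%:R)^-1.
  apply: contrapT => H'.
  have e0 : 0 < (128 * Q%:R : R)^-1 by rewrite invr_gt0 mulr_gt0 // ltr0n.
  have h : forall M, exists z, (128 * Q%:R)^-1 <= Sg M z.
    move=> M; apply: contrapT => H2; apply: H'; exists M => z.
    by rewrite ltNge; apply/negP => h; apply: H2; exists z.
  have [z [_ hz]] := Sg_unbounded e0 h (1 / 8) y.
  by have := hy z; rewrite ltNge hz.
have cop : coprime 8 Q by rewrite (coprimeXl 3 (n := Q) (m := 2)) // coprime2n.
pose r := (chinese 8 Q 3 1 %% (8 * Q))%N.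
have r8 : (r %% 8 = 3)%N.
  by rewrite /r modn_dvdm ?dvdn_mulr // chinese_modl.
have rQ : r = 1 %[mod Q].
  by rewrite /r modn_dvdm ?dvdn_mull // chinese_modr.
have rlt : (r < 8 * Q)%N by rewrite ltn_mod muln_gt0.
(* The count ends in T <= T/8 + M + T/8, which T = 2M + 2 contradicts. *)
pose T := (2 * M + 2)%N.
pose Z := (16 * Q * T)%N.
have key : (T <= \sum_(p <- gprimes y Z) count (fun t => p %| 8 * Q * t + r)%N (iota 0 T))%N.
  rewrite -{1}(size_iota 0 T) -{1}(count_predT (iota 0 T)).
  apply: count_le_sum => t tT _.
  have n8 : ((8 * Q * t + r) %% 8 = 3)%N by rewrite -mulnA mulnC modnMDl.
  have [p [gp pn]] := good_factor3 n8; exists p; split=> //.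
  rewrite mem_gprimes gp /=; apply/andP; split; last first.
    apply: leq_trans (dvdn_leq _ pn) _; first by lia.
    have h1 : (8 * Q * t <= 8 * Q * T)%N by exact: (leq_mul (leqnn _) (ltnW tT)).
    have h2 : (8 * Q <= 8 * Q * T)%N by apply: leq_pmulr; rewrite /T addn2.
    have -> : Z = (8 * Q * T + 8 * Q * T)%N by rewrite -mulnDl -mulnDl.
    exact: leq_add h1 (leq_trans (ltnW rlt) h2).
  rewrite ltnNge; apply/negP => py.
  have /and3P[pp op _] := gp.
  have pQ : (p %| Q)%N.
    have hp : (p./2 < uphalf y)%N by lia.
    rewrite /Q (bigD1 (Ordinal hp)) //= dvdn_mulr //.
    by rewrite (_ : p./2.*2.+1 = p) //; lia.
  have : (p %| 1)%N.
    have -> : (p %| 1)%N = (p %| r)%N.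
      by rewrite /dvdn -(modn_dvdm 1 pQ) -(modn_dvdm r pQ) rQ.
    by move: pn; rewrite dvdn_addr // -mulnA dvdn_mull // dvdn_mulr.
  by rewrite dvdn1 => /eqP p1; move: pp; rewrite p1.
have key2 : (T <= \sum_(p <- gprimes y Z) (T %/ p + 1))%N.
  apply: leq_trans key _; rewrite big_seq [leqRHS]big_seq; apply: leq_sum => p.
  rewrite mem_gprimes => /and3P[gp yp _]; have /and3P[pp op _] := gp.
  apply: count_linear => //; rewrite Euclid_dvdM // negb_or; apply/andP; split.
    rewrite (_ : 8 = 2 ^ 3)%N // Euclid_dvdX // andbT dvdn_prime2 //.
    by apply/eqP => p2; move: op; rewrite p2.
  apply/negP => pQ; have : (p <= y)%N; last by rewrite leqNgt yp.
  have : exists i : 'I_(uphalf y), (p %| i.*2.+1)%N.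
    move: pQ; rewrite /Q; elim/big_rec: _ => [|i a _ IH]; first by rewrite dvdn1 => /eqP p1; move: pp; rewrite p1.
    by rewrite Euclid_dvdM // => /orP[h|/IH//]; exists i.
  move=> [i pi]; have h1 := dvdn_leq (ltn0Sn _) pi; have h2 := ltn_ord i.
  by clear - h1 h2; lia.
have hTy : \sum_(p <- gprimes y Z) (T%:R / p%:R + 1) <= T%:R * Sg y Z + (size (gprimes y Z))%:R :> R.
  by rewrite big_split /= -mulr_sumr lerD2l -sum1_size natr_sum.
have cardle a b : (size (gprimes a b) <= b - a)%N.
  by rewrite size_filter; apply: leq_trans (count_size _ _) _; rewrite size_iota.
(* Primes up to M are counted trivially, those in (M, Z] through Z times the sum of their
   reciprocals. *)
have szle : (size (gprimes y Z))%:R <= M%:R + Z%:R * Sg M Z :> R.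
  have [ZM|MZ] := leqP Z M.
    rewrite Sg0 // mulr0 addr0 ler_nat; apply: leq_trans (cardle _ _) _; lia.
  have [yM|My] := leqP y M.
    rewrite (gprimes_cat yM (ltnW MZ)) size_cat natrD lerD ?size_gprimes_le // ler_nat.
    by apply: leq_trans (cardle _ _) _; lia.
  apply: le_trans (size_gprimes_le y Z) _.
  rewrite -[leLHS]add0r lerD // ?ler0n // ler_wpM2l ?ler0n //.
  have [yZ|Zy] := leqP y Z; last by rewrite Sg0 ?(ltnW Zy) // Sg_ge0.
  by rewrite (Sg_cat (ltnW My) yZ) lerDr Sg_ge0.
have T0 : 0 < T%:R :> R by rewrite ltr0n /T addn2.
have Q0R : 0 < Q%:R :> R by rewrite ltr0n.
have key3 : T%:R <= T%:R * Sg y Z + (M%:R + Z%:R * Sg M Z) :> R.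
  apply: le_trans (_ : (\sum_(p <- gprimes y Z) (T %/ p + 1))%:R <= _); first by rewrite ler_nat.
  apply: le_trans (_ : \sum_(p <- gprimes y Z) (T%:R / p%:R + 1) <= _); last first.
    by apply: le_trans hTy _; rewrite lerD2l.
  rewrite natr_sum big_seq [leRHS]big_seq; apply: ler_sum => p.
  rewrite mem_gprimes => /and3P[_ yp _]; rewrite natrD lerD2r.
  by rewrite ler_pdivlMr ?ltr0n; [rewrite -natrM ler_nat leq_divM|lia].
have h1 : T%:R * Sg y Z <= T%:R * (1 / 8) by rewrite ler_wpM2l ?ltW.
have h2 : Z%:R * Sg M Z <= T%:R * (1 / 8).
  apply: le_trans (_ : Z%:R * (128 * Q%:R)^-1 <= _); first by rewrite ler_wpM2l ?ler0n ?ltW.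
  rewrite /Z !natrM le_eqVlt; apply/orP; left; apply/eqP.
  by field; rewrite lt0r_neq0.
have h3 : T%:R = 2 * M%:R + 2 :> R by rewrite /T natrD natrM.
have M0 : 0 <= M%:R :> R by rewrite ler0n.
by move: key3 h1 h2 h3 M0; move: (T%:R * Sg y Z) (Z%:R * Sg M Z) (T%:R : R) (M%:R : R) => u v t m; lra.
Qed.
End Divergence.

(** * Density of the integers with few exact good prime divisors *)

Lemma count_iota_sum (P : pred nat) n : (count P (iota 0 n) = \sum_(i < n) P i)%N.
Proof. by rewrite -sumn_count sumnE big_map -(big_mkord predT (fun i => P i : nat)) /index_iota subn0. Qed.

Lemma crt_count (a b : nat) (P Q : pred nat) : coprime a b -> (0 < a)%N -> (0 < b)%N ->
  (count (fun n => P (n %% a) && Q (n %% b)) (iota 0 (a * b)) =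
   count P (iota 0 a) * count Q (iota 0 b))%N.
Proof.
move=> cab a0 b0; rewrite !count_iota_sum.
pose f (n : 'I_(a * b)) : 'I_a * 'I_b :=
  (Ordinal (ltn_pmod n a0), Ordinal (ltn_pmod n b0)).
have fi : injective f.
  move=> n m [/eqP e1 /eqP e2]; apply/val_inj/eqP.
  have : (n == m %[mod a * b])%N by rewrite chinese_remainder // e1 e2.
  by rewrite !modn_small.
have fb : bijective f by apply: inj_card_bij => //; rewrite card_prod !card_ord.
rewrite big_distrlr /= pair_big /= (reindex f); last exact: onW_bij.
by apply: eq_bigr => n _ /=; rewrite mulnb.
Qed.

Lemma count_iota_periodic (P : pred nat) N k : (forall n, P (n + N)%N = P n) ->
  (count P (iota 0 (k * N)) = k * count P (iota 0 N))%N.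
Proof.
move=> per; have perk j n : P (n + j * N)%N = P n.
  by elim: j => [|j IH]; [rewrite addn0|rewrite mulSnr addnA per].
elim: k => [|k IH]; first by [].
rewrite mulSnr iotaD count_cat IH mulSnr; congr (_ + _)%N.
rewrite add0n -[(k * N)%N]addn0 iotaDl count_map; apply: eq_count => n /=.
by rewrite addnC perk.
Qed.

Lemma count_iota_le (P : pred nat) N X : (0 < N)%N -> (forall n, P (n + N)%N = P n) ->
  (count P (iota 0 X) <= (X %/ N + 1) * count P (iota 0 N))%N.
Proof.
move=> N0 per; rewrite -count_iota_periodic //.
have XN : (X <= (X %/ N + 1) * N)%N by rewrite addn1 ltnW // ltn_ceil.
by rewrite -(subnKC XN) iotaD count_cat leq_addr.
Qed.

Definition noexact (B : seq nat) n := all (fun p => ~~ exactd p n) B.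
Definition sqprod (B : seq nat) := (\prod_(p <- B) p ^ 2)%N.

Lemma exactd_mod p n N : (p ^ 2 %| N)%N -> exactd p (n + N) = exactd p n.
Proof.
move=> h; rewrite /exactd !dvdn_addl //; apply: dvdn_trans h.
by rewrite expnS dvdn_mulr.
Qed.

Lemma noexact_mod B n N : (sqprod B %| N)%N -> noexact B (n + N) = noexact B n.
Proof.
move=> h; apply: eq_in_all => p pB; rewrite exactd_mod //; apply: dvdn_trans h.
by rewrite /sqprod (big_rem p) //= dvdn_mulr.
Qed.

Lemma sqprod_gt0 B : all prime B -> (0 < sqprod B)%N.
Proof.
by move=> /allP h; rewrite /sqprod big_seq prodn_cond_gt0 // => p /h /prime_gt0 p0; rewrite expn_gt0 p0.
Qed.

(** The multiples p k with 1 <= k <= p - 1 are divisible by p exactly once. *)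
Lemma count_noexact1 p : prime p -> (count (fun n => ~~ exactd p n) (iota 0 (p ^ 2)) <= p ^ 2 - (p - 1))%N.
Proof.
move=> pp; have p0 := prime_gt0 pp.
have := count_predC (exactd p) (iota 0 (p ^ 2)); rewrite size_iota.
suff h : (p - 1 <= count (exactd p) (iota 0 (p ^ 2)))%N.
  have -> : count (predC (exactd p)) (iota 0 (p ^ 2)) = count (fun n => ~~ exactd p n) (iota 0 (p ^ 2)) by [].
  by move: h; set u := count _ _; set v := count _ _; lia.
rewrite -size_filter -(size_iota 1 (p - 1)) -(size_map (fun k => p * k)%N).
apply: uniq_leq_size.
  rewrite map_inj_uniq ?iota_uniq // => i j /eqP; rewrite eqn_pmul2l // => /eqP //.
move=> n /mapP[k]; rewrite mem_iota => /andP[k1 k2] ->.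
rewrite mem_filter mem_iota /exactd dvdn_mulr //= add0n expnS expn1 ltn_pmul2l // dvdn_pmul2l //.
rewrite andbC; apply/andP; split; first by lia.
by rewrite gtnNdvd //; lia.
Qed.

Section Density.
Variable R : realType.

(** By the Chinese remainder theorem the conditions at distinct primes are independent, each with
    proportion at most 1 - (p-1)/p^2 <= 1/(1 + 1/(2p)); the product of the 1 + 1/(2p) is at least 1
    plus the sum of the 1/(2p). *)
Lemma count_noexact B : uniq B -> all prime B ->
  (count (noexact B) (iota 0 (sqprod B)))%:R * (1 + \sum_(p <- B) (2 * p%:R)^-1) <= (sqprod B)%:R :> R.
Proof.
elim: B => [|p B IH]; first by rewrite /sqprod !big_nil /= addr0 mulr1.
move=> /= /andP[pB uB] /andP[pp aB].
have p0 := prime_gt0 pp; have p1 := prime_gt1 pp.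
have cop : coprime (p ^ 2) (sqprod B).
  rewrite /sqprod big_seq; elim/big_ind: _ => [|x y hx hy|q qB]; first exact: coprimen1.
    by rewrite coprimeMr hx hy.
  rewrite coprimeXl // coprimeXr // prime_coprime //.
  have pq := allP aB q qB; rewrite dvdn_prime2 //.
  by apply: contra pB => /eqP ->.
have e : sqprod (p :: B) = (p ^ 2 * sqprod B)%N by rewrite /sqprod big_cons.
have s0 := sqprod_gt0 aB.
rewrite e.
have -> : count (noexact (p :: B)) (iota 0 (p ^ 2 * sqprod B)) =
  (count (fun n => ~~ exactd p n) (iota 0 (p ^ 2)) * count (noexact B) (iota 0 (sqprod B)))%N.
  rewrite -crt_count ?expn_gt0 ?p0 //; apply: eq_count => n /=; congr (~~ _ && _).
    by rewrite {1}(divn_eq n (p ^ 2)) addnC exactd_mod // dvdn_mull.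
  by rewrite {1}(divn_eq n (sqprod B)) addnC noexact_mod // dvdn_mull.
rewrite !natrM big_cons; set S := \sum_(_ <- _) _.
have S0 : 0 <= S by apply: sumr_ge0 => q _; rewrite invr_ge0 mulr_ge0 ?ler0n.
set c := count _ _; set d := count _ _.
have h1 : d%:R * (1 + S) <= (sqprod B)%:R := IH uB aB.
have h2 : c%:R * (1 + (2 * p%:R)^-1) <= (p ^ 2)%:R :> R.
  have hc : c%:R <= (p%:R : R) ^+ 2 - (p%:R - 1).
    have := count_noexact1 pp; rewrite -/c -(ler_nat R) natrB; last by rewrite expnS expn1; nia.
    by rewrite natrX natrB.
  have pR : 2 <= p%:R :> R by rewrite (ler_nat R 2 p).
  have pi : 0 < (2 * p%:R : R)^-1 by rewrite invr_gt0; lra.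
  apply: le_trans (_ : ((p%:R : R) ^+ 2 - (p%:R - 1)) * (1 + (2 * p%:R)^-1) <= _).
    by rewrite ler_wpM2r //; lra.
  rewrite natrX -subr_ge0.
  have -> : p%:R ^+ 2 - (p%:R ^+ 2 - (p%:R - 1)) * (1 + (2 * p%:R)^-1) =
     (p%:R ^+ 2 - p%:R - 1) * (2 * p%:R)^-1 :> R.
    by field; rewrite lt0r_neq0 // ltr0n.
  by apply: mulr_ge0; [nra|exact: ltW].
have c0 : 0 <= c%:R :> R by rewrite ler0n.
have d0 : 0 <= d%:R :> R by rewrite ler0n.
apply: le_trans (_ : c%:R * (1 + (2 * p%:R)^-1) * (d%:R * (1 + S)) <= _).
  have pi : 0 <= (2 * p%:R : R)^-1 by rewrite invr_ge0 mulr_ge0 ?ler0n.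
  rewrite -subr_ge0.
  have -> : c%:R * (1 + (2 * p%:R)^-1) * (d%:R * (1 + S)) - c%:R * d%:R * (1 + ((2 * p%:R)^-1 + S)) =
    c%:R * d%:R * ((2 * p%:R)^-1 * S) by ring.
  by rewrite !mulr_ge0.
apply: ler_pM; [| |by move: h2; rewrite natrX expr2|exact: h1]; apply: mulr_ge0 => //; apply: addr_ge0 => //;
  by rewrite invr_ge0 mulr_ge0 ?ler0n.
Qed.

(** The lower bound y lets the induction on r take its next prime below all the others, so that the
    primes stay distinct. *)
Definition goodn_gt (y r n : nat) := exists s : seq nat,
  [/\ size s = r, uniq s, all goodp s, all (fun p => exactd p n) s & all (fun p => y < p)%N s].

(** Induction on r: outside a set of density at most e/2, n is divisible exactly once by some good
    prime of (y, z], and outside another such set it has r further ones beyond z. *)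
Theorem density_good r y (e : R) : 0 < e -> exists C : R, forall X,
  (count (fun n => ~~ `[< goodn_gt y r n >]) (iota 0 X))%:R <= e * X%:R + C.
Proof.
elim: r y e => [|r IH] y e e0.
  exists 0 => X; rewrite addr0 (eq_count (a2 := pred0)) ?count_pred0 ?mulr_ge0 ?ler0n ?ltW // => n /=.
  by apply/negbTE; rewrite negbK; apply/asboolP; exists [::].
have he : 0 < (1 / 8 : R) by lra.
(* A sum of reciprocals at least 4/e makes 1 + sum 1/(2p) at least 2/e, so at most the proportion
   e/2 escapes all of [B]. *)
have [z [yz hz]] := Sg_unbounded he (Sg_block R) (4 / e) y.
pose B := gprimes y z.
have aB : all prime B by apply/allP => p; rewrite mem_gprimes => /andP[/and3P[]].
have e2 : 0 < e / 2 by lra.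
have [C hC] := IH z (e / 2) e2.
have N0 := sqprod_gt0 aB.
have cN : (count (noexact B) (iota 0 (sqprod B)))%:R <= e / 2 * (sqprod B)%:R :> R.
  have h := count_noexact (uniq_gprimes y z) aB.
  have S2 : \sum_(p <- B) (2 * p%:R)^-1 = Sg R y z / 2.
    rewrite /Sg mulr_suml; apply: eq_bigr => p _; by rewrite invfM mulrC.
  rewrite S2 -/B in h.
  have d0 : 0 <= (count (noexact B) (iota 0 (sqprod B)))%:R :> R by rewrite ler0n.
  have h' : (count (noexact B) (iota 0 (sqprod B)))%:R * (2 / e) <= (sqprod B)%:R :> R.
    apply: le_trans h; rewrite ler_wpM2l //.
    have -> : 2 / e = 4 / e / 2 by field; rewrite lt0r_neq0.
    lra.
  have -> : (count (noexact B) (iota 0 (sqprod B)))%:R =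
    e / 2 * ((count (noexact B) (iota 0 (sqprod B)))%:R * (2 / e)) :> R.
    by field; rewrite lt0r_neq0.
  by rewrite ler_wpM2l // divr_ge0 // ltW.
exists (C + (sqprod B)%:R * (e / 2)) => X.
apply: le_trans (_ : (count (noexact B) (iota 0 X) + count (fun n => ~~ `[< goodn_gt z r n >]) (iota 0 X))%:R <= _).
  rewrite ler_nat -count_predUI; apply: leq_trans (leq_addr _ _).
  apply: sub_count => n /= ng; case: (boolP (noexact B n)) => //=.
  rewrite -has_predC => /hasP[p pB /= /negPn ep]; apply: contra ng => /asboolP[s [ss us gs es ys]].
  apply/asboolP; exists (p :: s); rewrite /= ss; move: pB; rewrite mem_gprimes => /and3P[gp yp pz].
  split=> //.
  - by rewrite us andbT; apply/negP => ps; have := allP ys p ps; rewrite ltnNge pz.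
  - by rewrite gp.
  - by rewrite ep.
  - rewrite yp; apply/allP => q qs; have := allP ys q qs; exact: leq_ltn_trans.
rewrite natrD.
have h1 : (count (noexact B) (iota 0 X))%:R <= e / 2 * X%:R + (sqprod B)%:R * (e / 2).
  apply: le_trans (_ : ((X %/ sqprod B + 1) * count (noexact B) (iota 0 (sqprod B)))%:R <= _).
    by rewrite ler_nat; apply: count_iota_le => // n; apply: noexact_mod.
  rewrite natrM.
  apply: le_trans (_ : (X %/ sqprod B + 1)%:R * (e / 2 * (sqprod B)%:R) <= _).
    by rewrite ler_wpM2l.
  rewrite natrD mulrDl mul1r [(sqprod B)%:R * _]mulrC lerD2r mulrCA.
  by apply: ler_wpM2l; [exact: ltW|rewrite -natrM ler_nat leq_divM].
have h2 := hC X.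
have -> : e * X%:R + (C + (sqprod B)%:R * (e / 2)) = (e / 2 * X%:R + (sqprod B)%:R * (e / 2)) + (e / 2 * X%:R + C) by field.
exact: lerD.
Qed.
End Density.

(** * Gauss's identity and the generating function *)

Section GaussFinite.
Variables (A : comNzRingType) (q : A).
Let term n s := (-1) ^+ s * q ^+ (s * n.+1) * (\prod_(s.+1 <= j < n.+1) (1 - q ^+ j)) *
  \prod_(0 <= j < s) (1 + q ^+ j).

(** A finite form of Gauss's identity. On the right the term s = 0 is the product of the 1 - q^j,
    and all the others are divisible by q^(n+1). *)
Lemma gauss_finite n :
  (1 + 2%:R * \sum_(1 <= s < n.+1) (-1) ^+ s * q ^+ (s ^ 2)) * \prod_(1 <= j < n.+1) (1 + q ^+ j) =
  \sum_(0 <= s < n.+1) term n s.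
Proof.
elim: n => [|n IH].
  by rewrite !big_nat1 /term !big_geq // mul0n !expr0 !mulr1 mulr0 addr0.
(* The term of level n + 1 is 1 + q^(n+1) times that of level n plus a difference in s, which
   telescopes; the case s = n is the boundary and is corrected separately. *)
have step s : (s <= n)%N -> term n.+1 s = (1 + q ^+ n.+1) * term n s +
    ((1 - q ^+ s.+1) * term n s.+1 - (1 - q ^+ s) * term n s) *+ (s < n) +
    (- (1 - q ^+ s) * term n s - q ^+ n.+1 * (1 + q ^+ s) * term n s) *+ (s == n).
  move=> sn; rewrite /term.
  rewrite [in LHS]big_nat_recr //= mulnS [in LHS]exprD.
  set Q := \prod_(s.+1 <= j < n.+1) _; set M := \prod_(0 <= j < s) _.
  have [->|sn'] := eqVneq s n.
    by rewrite ltnn mulr0n mulr1n !exprSr; ring.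
  have sn2 : (s < n)%N by rewrite ltn_neqAle sn'.
  rewrite sn2 mulr1n mulr0n addr0 [in RHS](big_nat_recr s) //= -/M.
  have -> : Q = (1 - q ^+ s.+1) * \prod_(s.+2 <= j < n.+1) (1 - q ^+ j) by rewrite /Q big_ltn.
  rewrite mulSn exprD !exprS; ring.
rewrite [in RHS]big_nat_recr //=.
under [in RHS]eq_big_nat => s /andP[_ sn] do rewrite (step s sn).
rewrite !big_split /= -mulr_sumr -IH.
have -> : \sum_(0 <= s < n.+1) ((1 - q ^+ s.+1) * term n s.+1 - (1 - q ^+ s) * term n s) *+ (s < n)
   = (1 - q ^+ n) * term n n.
  rewrite big_nat_recr //= ltnn mulr0n addr0.
  rewrite (eq_big_nat _ _ (F2 := fun s => (1 - q ^+ s.+1) * term n s.+1 - (1 - q ^+ s) * term n s)); last first.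
    by move=> s /andP[_ ->].
  by rewrite telescope_sumr // expr0 subrr mul0r subr0.
have -> : \sum_(0 <= s < n.+1) (- (1 - q ^+ s) * term n s - q ^+ n.+1 * (1 + q ^+ s) * term n s) *+ (s == n)
   = - (1 - q ^+ n) * term n n - q ^+ n.+1 * (1 + q ^+ n) * term n n.
  rewrite big_nat_recr //= eqxx mulr1n big_nat big1 ?add0r // => s /andP[_ sn].
  by rewrite (ltn_eqF sn) mulr0n.
rewrite big_nat_recr //= [\prod_(1 <= j < n.+2) _]big_nat_recr //=.
set S := \sum_(_ <= _ < _) _; set P := \prod_(1 <= j < n.+1) _.
have eP : \prod_(0 <= j < n.+1) (1 + q ^+ j) = 2%:R * P by rewrite big_ltn // expr0.
rewrite /term [\prod_(n.+1 <= _ < n.+1) _]big_geq // [\prod_(n.+2 <= _ < n.+2) _]big_geq // !mulr1 eP.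
have eP' : (1 + q ^+ n) * \prod_(0 <= j < n) (1 + q ^+ j) = 2%:R * P.
  by rewrite -eP [RHS]big_nat_recr //= mulrC.
have -> : (n.+1 ^ 2 = n * n.+1 + n.+1)%N by rewrite expnS expn1; lia.
have -> : (n.+1 * n.+2 = n * n.+1 + n.+1 + n.+1)%N by lia.
rewrite !exprD [(-1) ^+ n.+1]exprS.
set x := q ^+ n.+1; set y := q ^+ (n * n.+1); set e := (-1) ^+ n; set M := \prod_(0 <= j < n) _.
transitivity ((1 + x) * ((1 + 2%:R * S) * P) - e * y * x * (2%:R * P) - e * y * x * x * (2%:R * P)); first by ring.
by rewrite -{1}eP' -/M; ring.
Qed.
End GaussFinite.

Definition tcong N (f g : fps) := forall i, (i <= N)%N -> f i = g i.
Lemma tcong_sym N f g : tcong N f g -> tcong N g f. Proof. by move=> h i iN; rewrite h. Qed.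
Lemma tcong_trans N f g h : tcong N f g -> tcong N g h -> tcong N f h.
Proof. by move=> h1 h2 i iN; rewrite h1 // h2. Qed.
Lemma tcongM N f g f' g' : tcong N f g -> tcong N f' g' -> tcong N (f * f') (g * g').
Proof.
move=> h h' i iN; rewrite !cfM; apply: eq_bigr => j _; have := ltn_ord j => ji.
by rewrite h ?h' //; lia.
Qed.
Lemma tcongD N f g f' g' : tcong N f g -> tcong N f' g' -> tcong N (f + f') (g + g').
Proof. by move=> h h' i iN; rewrite !cfD h ?h'. Qed.
Lemma tcongX N f g m : tcong N f g -> tcong N (f ^+ m) (g ^+ m).
Proof. by move=> h; elim: m => [|m IH] //; rewrite !exprS; apply: tcongM. Qed.
Lemma tcong_X N k f : (N < k)%N -> tcong N (X ^+ k * f) 0.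
Proof. by move=> Nk i iN; rewrite cfXM (leq_ltn_trans iN Nk) cf0. Qed.
Lemma tcong_dil N k f g : tcong N f g -> tcong N (fdil k f) (fdil k g).
Proof.
move=> h i iN; rewrite !cf_fdil; case: ifP => // _; apply: h.
exact: leq_trans (leq_div _ _) iN.
Qed.
Lemma tcong_eq f g : (forall N, tcong N f g) -> f = g.
Proof. by move=> h; apply: fpsP => n; apply: (h n). Qed.
Lemma tcongM1 N f g : tcong N f 1 -> tcong N g 1 -> tcong N (f * g) 1.
Proof. by move=> hf hg; have := tcongM hf hg; rewrite mulr1. Qed.

Lemma fps_inv (f : fps) : f 0%N = 1 -> exists g, g * f = 1.
Proof.
move=> f0; pose u := 1 - f.
have u0 : u 0%N = 0 by rewrite cfB cf1 f0.
have uk k N : (N < k)%N -> tcong N (u ^+ k) 0.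
  elim: k N => // k IH N Nk i iN; rewrite exprS cfM big1 // => j _.
  have [->|j0] := posnP j; first by rewrite u0 mul0r.
  have ji := ltn_ord j; by rewrite (IH (N - j)%N) ?cf0 ?mulr0 //; lia.
pose g := Fps (fun n => (\sum_(k < n.+1) u ^+ k) n).
have gN N : tcong N g (\sum_(k < N.+1) u ^+ k).
  move=> i iN; rewrite /= !cf_sum.
  rewrite -(big_mkord predT (fun k => (u ^+ k) i)) -(big_mkord predT (fun k => (u ^+ k) i)).
  rewrite [RHS](big_cat_nat (n := i.+1)) //= [X in _ = _ + X]big_nat [X in _ = _ + X]big1 ?addr0 // => k /andP[ik _].
  by rewrite (uk k i).
exists g; apply: tcong_eq => N.
apply: (@tcong_trans _ _ ((\sum_(k < N.+1) u ^+ k) * f)); first exact: tcongM.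
have -> : (\sum_(k < N.+1) u ^+ k) * f = 1 - u ^+ N.+1.
  have e := subrX1 u N.+1.
  transitivity (- ((u - 1) * \sum_(i < N.+1) u ^+ i)); first by rewrite /u; ring.
  by rewrite -e opprB.
move=> i iN; rewrite cfB (uk N.+1 N) //; rewrite cf0 subr0 //.
Qed.

Definition F k N := fpoly (f_trunc k N).
Definition G k N := fpoly (finv_trunc k N).

Lemma F_E k N : F k N = \prod_(1 <= j < N.+1) (1 - X ^+ (k * j)).
Proof.
by rewrite /F /f_trunc rmorph_prod; apply: eq_bigr => j _; rewrite rmorphB rmorph1 rmorphXn.
Qed.
Lemma G_E k N : G k N = \prod_(1 <= j < N.+1) \sum_(0 <= i < N.+1) X ^+ (k * j * i).
Proof.
rewrite /G /finv_trunc rmorph_prod; apply: eq_bigr => j _; rewrite rmorph_sum.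
by apply: eq_bigr => i _; rewrite rmorphXn.
Qed.
Lemma FG k N : (0 < k)%N -> tcong N (F k N * G k N) 1.
Proof.
move=> k0; rewrite F_E G_E -big_split /= !big_nat.
have h : forall r : seq nat, tcong N (\prod_(j <- r | (1 <= j < N.+1)%N) ((1 - X ^+ (k * j)) * \sum_(0 <= i < N.+1) X ^+ (k * j * i))) 1.
  elim=> [|j r IH]; first by rewrite big_nil.
  rewrite big_cons; case: ifP => // /andP[j1 _]; apply: tcongM1 => //.
  have -> : \sum_(0 <= i < N.+1) X ^+ (k * j * i) = \sum_(i < N.+1) (X ^+ (k * j)) ^+ i.
    by rewrite big_mkord; apply: eq_bigr => i _; rewrite -exprM.
  rewrite -opprB mulNr -subrX1 opprB -exprM => i iN.
  rewrite cfB cfXn (_ : (i == _) = false) ?subr0 //.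
  by apply/eqP => ie; move: iN; rewrite ie; nia.
exact: h.
Qed.
Lemma fdil_prod k (I : Type) (r : seq I) (H : I -> fps) : (0 < k)%N ->
  fdil k (\prod_(i <- r) H i) = \prod_(i <- r) fdil k (H i).
Proof.
by move=> k0; elim: r => [|i r IH]; rewrite ?big_nil ?fdil1 // !big_cons fdil_mul // IH.
Qed.
Lemma fdil_sum k (I : Type) (r : seq I) (H : I -> fps) :
  fdil k (\sum_(i <- r) H i) = \sum_(i <- r) fdil k (H i).
Proof.
elim: r => [|i r IH]; last by rewrite !big_cons fdilD IH.
by rewrite !big_nil; apply: fpsP => n; rewrite cf_fdil if_same.
Qed.
Lemma F_dil k N : fdil 2 (F k N) = F (2 * k) N.
Proof.
rewrite !F_E fdil_prod //; apply: eq_bigr => j _.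
by rewrite fdilD fdilN fdil1 // fdil_X // mulnA.
Qed.
Lemma G_dil k N : fdil 2 (G k N) = G (2 * k) N.
Proof.
rewrite !G_E fdil_prod //; apply: eq_bigr => j _.
by rewrite fdil_sum; apply: eq_bigr => i _; rewrite fdil_X // !mulnA.
Qed.

Lemma gauss_trunc N : tcong N (fsgn phi * F 2 N) (F 1 N ^+ 2).
Proof.
pose M := \prod_(1 <= j < N.+1) (1 + X ^+ j).
have F2 : F 2 N = F 1 N * M.
  rewrite !F_E /M -big_split /=; apply: eq_bigr => j _.
  by rewrite mul1n mul2n -addnn exprD; ring.
have e : tcong N (fsgn phi) (1 + 2%:R * \sum_(1 <= s < N.+1) (-1) ^+ s * X ^+ (s ^ 2)).
  move=> i iN; rewrite cf_fsgn cfD cfMz_nat cf1 cf_sum.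
  have -> : \sum_(1 <= s < N.+1) ((-1) ^+ s * X ^+ (s ^ 2) : fps) i = (-1) ^+ i * \sum_(1 <= s < N.+1) (s ^ 2 == i)%N%:R :> int.
    rewrite mulr_sumr; apply: eq_bigr => s _.
    have -> : (-1) ^+ s * X ^+ (s ^ 2) = ((-1) ^+ s)%:~R * X ^+ (s ^ 2) :> fps.
      by rewrite rmorphXn rmorphN1.
    rewrite cfMz cfXn eq_sym; case: eqP => [<-|]; rewrite ?mulr0 //.
    by rewrite !mulr1 -signr_odd -[in RHS]signr_odd oddX.
  have -> : \sum_(1 <= s < N.+1) (s ^ 2 == i)%N%:R = \sum_(1 <= s < i.+1) (s ^ 2 == i)%N%:R :> int.
    rewrite (big_cat_nat (n := i.+1)) //= [X in _ + X]big1_seq ?addr0 // => u.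
    rewrite mem_index_iota => /andP[u1 u2]; case: eqP => // h; exfalso.
    by move: h; rewrite expnS expn1; nia.
  rewrite /= mulrDr; congr (_ + _); last by rewrite mulrCA.
  by case: i iN => [|i] _; rewrite ?expr0 ?mulr1 //= mulr0.
rewrite F2 mulrCA expr2; apply: tcongM => //.
apply: (@tcong_trans _ _ ((1 + 2%:R * \sum_(1 <= s < N.+1) (-1) ^+ s * X ^+ (s ^ 2)) * M)); first exact: tcongM.
rewrite /M gauss_finite big_ltn //= F_E expr0 mul0n expr0 !mul1r [\prod_(0 <= _ < 0) _]big_geq // mulr1.
rewrite (eq_bigr (fun j => 1 - X ^+ (1 * j))); last by move=> j _; rewrite mul1n.
rewrite -[X in tcong _ _ X]addr0; apply: tcongD => //.
move=> i iN; rewrite cf_sum big_nat big1 // => s /andP[s1 _].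
rewrite (_ : (-1) ^+ s * X ^+ (s * N.+1) * _ * _ = X ^+ (s * N.+1) * ((-1) ^+ s * \prod_(s.+1 <= j < N.+1) (1 - X ^+ j) * \prod_(0 <= j < s) (1 + X ^+ j))); last by ring.
by rewrite (tcong_X _ _ iN) //; nia.
Qed.

Lemma V_exists : exists V, V * fsgn phi = 1.
Proof. by apply: fps_inv; rewrite cf_fsgn mul1r /= big_geq // mulr0 addr0. Qed.

(** 1/phi(-q) = f_2/f_1^2 by Gauss's identity, read on truncations. *)
Lemma V_trunc V N : V * fsgn phi = 1 -> tcong N V (F 2 N * G 1 N ^+ 2).
Proof.
move=> hV; have g := @gauss_trunc N; have fg := @FG 1 N isT.
have h1 : tcong N (F 2 N) (V * F 1 N ^+ 2).
  by rewrite -[F 2 N]mul1r -hV -mulrA; apply: tcongM.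
apply: tcong_sym; apply: (@tcong_trans _ _ (V * F 1 N ^+ 2 * G 1 N ^+ 2)); first exact: tcongM.
rewrite -mulrA -exprMn -[X in tcong _ _ X]mulr1; apply: tcongM => //.
by rewrite -(expr1n _ 2); apply: tcongX.
Qed.

(** The quotient f_4^(c-1)/(f_1^2 f_2^(2c-3)) regroups as (f_2/f_1^2)(f_4/f_2^2)^(c-1), and the
    second factor is the first one at q^2. *)
Theorem abarE V c n : V * fsgn phi = 1 -> (2 <= c)%N -> abar c n = (V * fdil 2 V ^+ c.-1) n.
Proof.
move=> hV c2; rewrite /abar.
have -> : c%:Z - 1 = Posz c.-1 by lia.
have -> : - (2 * c%:Z - 3) = Negz (2 * c - 4)%N by lia.
rewrite -[-2]/(Negz 1) /fpow_trunc.
have -> : (2 * c - 4).+1 = (2 * c - 3)%N by lia.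
transitivity ((F 4 n ^+ c.-1 * G 1 n ^+ 2 * G 2 n ^+ (2 * c - 3)) n).
  by rewrite /F /G -!rmorphXn -!rmorphM.
apply: (tcong_sym (N := n)); last exact: leqnn.
have h1 := @V_trunc V n hV.
have h2 : tcong n (fdil 2 V) (F 4 n * G 2 n ^+ 2).
  rewrite -[G 2 n]/(G (2 * 1) n) -[F 4 n]/(F (2 * 2) n) -F_dil -G_dil -fdilX // -fdil_mul //.
  exact: tcong_dil.
apply: (@tcong_trans _ _ ((F 2 n * G 1 n ^+ 2) * (F 4 n * G 2 n ^+ 2) ^+ c.-1)).
  by apply: tcongM => //; apply: tcongX.
have -> : (F 2 n * G 1 n ^+ 2) * (F 4 n * G 2 n ^+ 2) ^+ c.-1 =
   (F 2 n * G 2 n) * (F 4 n ^+ c.-1 * G 1 n ^+ 2 * G 2 n ^+ (2 * c - 3)).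
  rewrite exprMn -exprM (_ : (2 * c.-1 = (2 * c - 3).+1)%N) ?exprS; [ring|lia].
by rewrite -[X in tcong _ _ X]mul1r; apply: tcongM => //; apply: FG.
Qed.

(** * Complex exponential and infinite sums *)

Section Cplx.
Variable R : realType.
Notation C := (R[i]).
(** The modulus as an element of R, so that estimates are real inequalities. *)
Definition nrm (z : C) : R := Normc.normc z.

Lemma nrmM (x y : C) : nrm (x * y) = nrm x * nrm y. Proof. exact: Normc.normcM. Qed.
Lemma nrmD (x y : C) : nrm (x + y) <= nrm x + nrm y. Proof. exact: le_normcD. Qed.
Lemma nrmN (x : C) : nrm (- x) = nrm x. Proof. exact: normcN. Qed.
Lemma nrmB (x y : C) : nrm (x - y) <= nrm x + nrm y.
Proof. by apply: le_trans (nrmD _ _) _; rewrite nrmN. Qed.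
Lemma nrm0 : nrm 0 = 0. Proof. exact: Normc.normc0. Qed.
Lemma nrm1 : nrm 1 = 1. Proof. exact: Normc.normc1. Qed.
Lemma nrm_eq0 (x : C) : nrm x = 0 -> x = 0. Proof. exact: Normc.eq0_normc. Qed.
Lemma nrm_ge0 (x : C) : 0 <= nrm x.
Proof. by case: x => a b; rewrite /nrm /= sqrtr_ge0. Qed.
Lemma nrmX (x : C) n : nrm (x ^+ n) = nrm x ^+ n.
Proof. by elim: n => [|n IH]; rewrite ?expr0 ?nrm1 // !exprS nrmM IH. Qed.
Lemma nrmV (x : C) : nrm x^-1 = (nrm x)^-1. Proof. exact: Normc.normcV. Qed.
Lemma nrm_sub (x y : C) : nrm (x - y) = nrm (y - x).
Proof. by rewrite -nrmN opprB. Qed.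
Lemma nrm_real (x : R) : nrm x%:C%C = `|x|.
Proof. by rewrite /nrm /= expr0n /= addr0 sqrtr_sqr. Qed.
Lemma nrm_int (n : int) : nrm n%:~R = `|n|%:~R.
Proof.
have -> : n%:~R = (n%:~R : R)%:C%C :> C by rewrite rmorph_int.
by rewrite nrm_real -intr_norm.
Qed.
Lemma nrm_nat (n : nat) : nrm n%:R = n%:R.
Proof. by rewrite -[n%:R]/(n%:Z%:~R) nrm_int. Qed.
Lemma nrm_sum (I : Type) (r : seq I) (P : pred I) (F : I -> C) :
  nrm (\sum_(i <- r | P i) F i) <= \sum_(i <- r | P i) nrm (F i).
Proof.
elim/big_rec2: _ => [|i y x _ h]; first by rewrite nrm0.
by apply: le_trans (nrmD _ _) _; rewrite lerD2l.
Qed.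
Lemma nrm_Re (z : C) : `|complex.Re z| <= nrm z.
Proof.
case: z => a b; rewrite /nrm /= -sqrtr_sqr ler_sqrt ?lerDl ?sqr_ge0 //.
by rewrite addr_ge0 ?sqr_ge0.
Qed.
Lemma nrm_Im (z : C) : `|complex.Im z| <= nrm z.
Proof.
case: z => a b; rewrite /nrm /= -sqrtr_sqr ler_sqrt ?lerDr ?sqr_ge0 //.
by rewrite addr_ge0 ?sqr_ge0.
Qed.
Lemma nrm_le_ReIm (z : C) : nrm z <= `|complex.Re z| + `|complex.Im z|.
Proof.
rewrite -ler_sqr ?nnegrE ?nrm_ge0 ?addr_ge0 //.
rewrite {1}/nrm; case: z => a b; rewrite [Normc.normc _]/= [complex.Re _]/= [complex.Im _]/=.
rewrite sqr_sqrtr ?addr_ge0 ?sqr_ge0 // sqrrD !real_normK ?num_real // -addrA lerD2l lerDr.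
by rewrite mulrn_wge0 // mulr_ge0.
Qed.
Lemma nrm_sqr (z : C) : nrm z ^+ 2 = complex.Re z ^+ 2 + complex.Im z ^+ 2.
Proof. by case: z => a b; rewrite /nrm /= sqr_sqrtr // addr_ge0 ?sqr_ge0. Qed.

Definition cexp (z : C) : C :=
  Complex (expR (complex.Re z) * cos (complex.Im z)) (expR (complex.Re z) * sin (complex.Im z)).

Lemma cexpD z w : cexp (z + w) = cexp z * cexp w.
Proof.
case: z => a b; case: w => c d; rewrite /cexp /= expRD cosD sinD; simpc.
by congr (Complex _ _); ring.
Qed.
Lemma cexp0 : cexp 0 = 1.
Proof. by rewrite /cexp /= expR0 cos0 sin0 mul1r mulr0. Qed.
Lemma nrm_cexp z : nrm (cexp z) = expR (complex.Re z).
Proof.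
rewrite /nrm /cexp /= !exprMn -mulrDr cos2Dsin2 mulr1 sqrtr_sqr.
by rewrite ger0_norm // expR_ge0.
Qed.
Lemma cexp_neq0 z : cexp z != 0.
Proof.
by apply/eqP => h; have := nrm_cexp z; rewrite h nrm0 => /esym/eqP; rewrite expR_eq0.
Qed.
Lemma cexpN z : cexp (- z) = (cexp z)^-1.
Proof. by apply: (mulIf (cexp_neq0 z)); rewrite mulVf ?cexp_neq0 // -cexpD addNr cexp0. Qed.
Lemma cexpX z n : cexp (n%:R * z) = cexp z ^+ n.
Proof.
by elim: n => [|n IH]; rewrite ?mul0r ?cexp0 // -natr1 mulrDl mul1r cexpD IH exprSr.
Qed.
Lemma cexp_2pi (k : int) : cexp (Complex 0 (2 * pi * k%:~R)) = 1.
Proof.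
have h (n : nat) : cexp (Complex 0 (2 * pi * n%:R)) = 1.
  have -> : Complex 0 (2 * pi * n%:R) = n%:R * Complex 0 (2 * pi) :> C.
    have -> : n%:R = (n%:R : R)%:C%C :> C by rewrite rmorph_nat.
    by simpc; congr (Complex _ _); ring.
  rewrite cexpX /cexp /= expR0 !mul1r mulr_natl cos2pi sin2pi.
  by rewrite -[Complex 1 0]/(1 : C) expr1n.
case: k => n; first exact: h.
have -> : Complex 0 (2 * pi * (Negz n)%:~R) = - Complex 0 (2 * pi * n.+1%:R) :> C.
  by rewrite NegzE rmorphN mulrN; congr (Complex _ _); rewrite oppr0.
by rewrite cexpN h invr1.
Qed.

Lemma sin_cos_mvt (y : R) : exists c, `|c| <= `|y| /\ sin y = cos c * y.
Proof.
wlog y0 : y / 0 <= y.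
  move=> H; have [y0|y0] := leP 0 y; first exact: H.
  have [c [h1 h2]] := H (- y) ltac:(lra).
  by exists c; rewrite normrN in h1; split=> //; rewrite sinN mulrN in h2; apply: oppr_inj.
have [->|yn0] := eqVneq y 0; first by exists 0; rewrite sin0 mulr0.
have yp : 0 < y by rewrite lt_neqAle eq_sym yn0.
have [c cy] := @MVT R (@sin R) (@cos R) 0 y yp
  (fun x _ => is_derive_sin x) (continuous_subspaceT (@continuous_sin R)).
rewrite sin0 !subr0 => e; exists c; split=> //.
by move: cy; rewrite in_itv /= => /andP[c0 c1]; rewrite !ger0_norm ?ltW.
Qed.
Lemma sin_abs (y : R) : `|sin y| <= `|y|.
Proof.
have [c [_ ->]] := sin_cos_mvt y; rewrite normrM -[leRHS]mul1r.
by rewrite ler_wpM2r // cos_max.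
Qed.
Lemma cos_sub1 (y : R) : `|cos y - 1| <= y ^+ 2.
Proof.
have [->|y0] := eqVneq y 0; first by rewrite cos0 subrr normr0 expr0n.
have -> : cos y - 1 = - (sin (y / 2) ^+ 2 *+ 2).
  have {1}-> : y = (y / 2) *+ 2 by rewrite -mulr_natr divfK // pnatr_eq0.
  by rewrite cos_mulr2n cos2sin2; ring.
rewrite normrN normrMn normrX -[leRHS]real_normK ?num_real // -[leLHS]mulr_natl.
have h := sin_abs (y / 2); rewrite normrM [`|2^-1|]ger0_norm // in h.
have h0 := normr_ge0 (sin (y / 2)); have h1 := normr_ge0 y.
move: h h0 h1; set u := `|sin _|; set v := `|y|; clearbody u v => h h0 h1.
have e : u ^+ 2 <= (v * 2^-1) ^+ 2 by rewrite ler_pXn2r ?nnegrE //; lra.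
have E : (v * 2^-1) ^+ 2 = v ^+ 2 / 4 by field.
by have := sqr_ge0 v; rewrite E in e; lra.
Qed.
Lemma sin_sub (y : R) : `|sin y - y| <= y ^+ 2 * `|y|.
Proof.
have [c [hc ->]] := sin_cos_mvt y.
rewrite -{2}[y]mul1r -mulrBl normrM ler_wpM2r //; apply: le_trans (cos_sub1 c) _.
by rewrite -(real_normK (num_real c)) -(real_normK (num_real y)) ler_pXn2r ?nnegrE.
Qed.

Lemma expR_sub1 (x : R) : `|expR x - 1| <= `|x| * expR `|x|.
Proof.
have [x0|x0] := leP 0 x.
  rewrite !ger0_norm ?subr_ge0 -?expR0 ?ler_expR //.
  have := expR_ge1Dx (- x); rewrite expRN => h.
  have e0 := expR_gt0 x.
  have : (1 - x) * expR x <= 1 by rewrite -ler_pdivlMr // mul1r.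
  by rewrite expR0; lra.
have h := expR_ge1Dx x; have h1 : expR x <= 1 by rewrite -expR0 ler_expR ltW.
have h2 : 1 <= expR `|x| by rewrite -[leLHS]expR0 ler_expR.
rewrite ler0_norm ?subr_le0 //; rewrite (ltr0_norm x0) in h2 *; nra.
Qed.
Lemma expR_sub1x (x : R) : `|expR x - 1 - x| <= x ^+ 2 * expR `|x|.
Proof.
have h := expR_ge1Dx x; rewrite ger0_norm; last by lra.
have h' := expR_sub1 x; have e0 := expR_gt0 x.
have hN := expR_ge1Dx (- x); rewrite expRN in hN.
have k : (1 - x) * expR x <= 1 by rewrite -ler_pdivlMr // mul1r.
have k1 : expR x - 1 <= x * expR x by lra.
have k2 : expR x - 1 - x <= x * (expR x - 1) by lra.
apply: le_trans k2 _; apply: le_trans (ler_norm _) _; rewrite normrM -(real_normK (num_real x)) expr2 -mulrA.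
by rewrite ler_wpM2l.
Qed.

(** The real part splits as (e^x - 1 - x) + e^x (cos y - 1), the imaginary part as (e^x - 1) sin y +
    (sin y - y); each of the four pieces is at most r^2 e^r. *)
Lemma cexp_sub1z z : nrm (cexp z - 1 - z) <= 5 * nrm z ^+ 2 * expR (nrm z) .
Proof.
apply: le_trans (nrm_le_ReIm _) _.
have hx := nrm_Re z; have hy := nrm_Im z; have r0 := nrm_ge0 z.
rewrite /cexp; case: z hx hy r0 => x y; set r := nrm _ => hx hy r0.
rewrite [complex.Re _]/= [complex.Im _]/=; rewrite [complex.Re _]/= in hx; rewrite [complex.Im _]/= in hy.
have eE : expR `|x| <= expR r by rewrite ler_expR.
have e1 : 1 + r <= expR r by apply: expR_ge1Dx.
have ex : expR x <= expR r by rewrite ler_expR (le_trans (ler_norm x)).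
have ex0 := expR_gt0 x.
have x2 : x ^+ 2 <= r ^+ 2 by rewrite -(real_normK (num_real x)) ler_pXn2r ?nnegrE.
have y2 : y ^+ 2 <= r ^+ 2 by rewrite -(real_normK (num_real y)) ler_pXn2r ?nnegrE.
have s2 := sqr_ge0 y.
have re : `|expR x * cos y - 1 - x| <= 2 * (r ^+ 2 * expR r).
  have -> : expR x * cos y - 1 - x = (expR x - 1 - x) + expR x * (cos y - 1) by ring.
  apply: le_trans (ler_normD _ _) _; rewrite mulr_natl mulr2n lerD //.
    by apply: le_trans (expR_sub1x x) _; rewrite ler_pM ?sqr_ge0 ?expR_ge0.
  rewrite normrM (gtr0_norm ex0) mulrC ler_pM ?(ltW ex0) //.
  by apply: le_trans (cos_sub1 y) y2.
have im : `|expR x * sin y - 0 - y| <= 2 * (r ^+ 2 * expR r).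
  have -> : expR x * sin y - 0 - y = (expR x - 1) * sin y + (sin y - y) by ring.
  apply: le_trans (ler_normD _ _) _; rewrite mulr_natl mulr2n lerD //.
    rewrite normrM expr2 -mulrA [r * expR r]mulrC mulrA ler_pM //.
      apply: le_trans (expR_sub1 x) _; by rewrite ler_pM // expR_ge0.
    exact: le_trans (sin_abs y) hy.
  apply: le_trans (sin_sub y) _; rewrite ler_pM ?sqr_ge0 //.
  by apply: le_trans hy _; lra.
have p0 : 0 <= r ^+ 2 * expR r by rewrite mulr_ge0 ?sqr_ge0 ?expR_ge0.
have -> : 5 * r ^+ 2 * expR r = 5 * (r ^+ 2 * expR r) by ring.
by move: re im p0; rewrite ?subr0; lra.
Qed.
End Cplx.

Section Sums.
Variable R : realType.
Notation C := (R[i]).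
Implicit Types (a b : nat -> C) (s t : C) (r K e : R).

Definition hasum a s := forall e, 0 < e ->
  exists N, forall n, (N <= n)%N -> nrm (\sum_(i < n) a i - s) <= e.

Lemma nrm_eps s : (forall e, 0 < e -> nrm s <= e) -> s = 0.
Proof.
move=> h; apply: nrm_eq0; apply/eqP; rewrite eq_le nrm_ge0 andbT.
by apply/ler_addgt0Pr => e e0; rewrite add0r h.
Qed.

Lemma hasum_uniq a s t : hasum a s -> hasum a t -> s = t.
Proof.
move=> hs ht; apply/eqP; rewrite -subr_eq0; apply/eqP; apply: nrm_eps => e e0.
have e2 : 0 < e / 2 by rewrite divr_gt0.
have [N hN] := hs _ e2; have [M hM] := ht _ e2.
have := hN (N + M)%N (leq_addr _ _); have := hM (N + M)%N (leq_addl _ _).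
set S := \sum_(i < _) _ => h1 h2.
have -> : s - t = (S - t) - (S - s) by ring.
by apply: le_trans (nrmB _ _) _; lra.
Qed.

Lemma hasumD a b s t : hasum a s -> hasum b t -> hasum (fun n => a n + b n) (s + t).
Proof.
move=> hs ht e e0; have e2 : 0 < e / 2 by rewrite divr_gt0.
have [N hN] := hs _ e2; have [M hM] := ht _ e2; exists (N + M)%N => n hn.
have h1 := hN n (leq_trans (leq_addr _ _) hn); have h2 := hM n (leq_trans (leq_addl _ _) hn).
rewrite big_split /= opprD addrACA; apply: le_trans (nrmD _ _) _; lra.
Qed.

Lemma hasumZl a s c : hasum a s -> hasum (fun n => c * a n) (c * s).
Proof.
move=> hs e e0; have n0 := nrm_ge0 c.
have e2 : 0 < e / (1 + nrm c) by rewrite divr_gt0 // ltr_pwDl.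
have [N hN] := hs _ e2; exists N => n /hN h.
rewrite -mulr_sumr -mulrBr nrmM; apply: le_trans (ler_wpM2l n0 h) _.
rewrite mulrCA ler_piMr // ?(ltW e0) // ler_pdivrMr ?ltr_pwDl // mul1r; lra.
Qed.

Lemma hasum_le a s r : hasum a s -> (forall n, nrm (\sum_(i < n) a i) <= r) -> nrm s <= r.
Proof.
move=> hs h; apply/ler_addgt0Pr => e e0; have [N hN] := hs _ e0.
have -> : s = \sum_(i < N) a i - (\sum_(i < N) a i - s) by ring.
by apply: le_trans (nrmB _ _) _; rewrite lerD // hN.
Qed.

Lemma geo_sum_le r n : 0 <= r < 1 -> \sum_(i < n) r ^+ i <= (1 - r)^-1.
Proof.
move=> /andP[r0 r1]; have d : 0 < 1 - r by rewrite subr_gt0.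
rewrite -[leRHS]div1r ler_pdivlMr // mulrC -opprB mulNr -subrX1 opprB.
by rewrite gerBl exprn_ge0.
Qed.

Lemma geo_bound a r K n : 0 <= r < 1 -> (forall i, nrm (a i) <= K * r ^+ i) ->
  nrm (\sum_(i < n) a i) <= K / (1 - r).
Proof.
move=> hr h; have K0 : 0 <= K by have := le_trans (nrm_ge0 _) (h 0%N); rewrite mulr1.
apply: le_trans (nrm_sum _ _ _) _; apply: (@le_trans _ _ (\sum_(i < n) K * r ^+ i)); first exact: ler_sum.
by rewrite -mulr_sumr ler_wpM2l // geo_sum_le.
Qed.

Lemma rsum_ex (b : nat -> R) r K : 0 <= r < 1 -> (forall i, `|b i| <= K * r ^+ i) ->
  exists s : R, forall e, 0 < e -> exists N, forall n, (N <= n)%N -> `|\sum_(i < n) b i - s| <= e.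
Proof.
move=> /andP[r0 r1] h.
have c1 : cvgn (series (geometric K r)).
  by apply: is_cvg_geometric_series; rewrite ger0_norm.
have c2 : cvgn [normed series b].
  apply: (series_le_cvg _ _ _ c1) => n //=.
  by apply: le_trans (normr_ge0 _) (h n).
have c3 := normed_cvg c2.
exists (limn (series b)) => e e0.
have /cvgrPdist_le/(_ e e0) [N _ hN] := c3.
exists N => n Nn; have := hN n Nn.
by rewrite distrC /series /= big_mkord.
Qed.

Lemma ReD (z w : C) : complex.Re (z + w) = complex.Re z + complex.Re w.
Proof. by case: z w => ? ? [? ?]. Qed.
Lemma ImD (z w : C) : complex.Im (z + w) = complex.Im z + complex.Im w.
Proof. by case: z w => ? ? [? ?]. Qed.
Lemma ReN (z : C) : complex.Re (- z) = - complex.Re z.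
Proof. by case: z. Qed.
Lemma ImN (z : C) : complex.Im (- z) = - complex.Im z.
Proof. by case: z. Qed.
Lemma Re_sum n (F : nat -> C) : complex.Re (\sum_(i < n) F i) = \sum_(i < n) complex.Re (F i).
Proof. by elim: n => [|n IH]; rewrite ?big_ord0 // !big_ord_recr /= -IH ReD. Qed.
Lemma Im_sum n (F : nat -> C) : complex.Im (\sum_(i < n) F i) = \sum_(i < n) complex.Im (F i).
Proof. by elim: n => [|n IH]; rewrite ?big_ord0 // !big_ord_recr /= -IH ImD. Qed.

Lemma hasum_geo a r K : 0 <= r < 1 -> (forall i, nrm (a i) <= K * r ^+ i) ->
  exists s, hasum a s.
Proof.
move=> hr h.
have [x hx] := @rsum_ex (fun i => complex.Re (a i)) r K hr (fun i => le_trans (nrm_Re _) (h i)).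
have [y hy] := @rsum_ex (fun i => complex.Im (a i)) r K hr (fun i => le_trans (nrm_Im _) (h i)).
exists (Complex x y) => e e0; have e2 : 0 < e / 2 by rewrite divr_gt0.
have [N hN] := hx _ e2; have [M hM] := hy _ e2; exists (N + M)%N => n hn.
have h1 := hN n (leq_trans (leq_addr _ _) hn); have h2 := hM n (leq_trans (leq_addl _ _) hn).
apply: le_trans (nrm_le_ReIm _) _; rewrite ReD ImD ReN ImN Re_sum Im_sum /=; lra.
Qed.

(** The two ends go to infinity independently, so that shifting the index or grouping it into blocks
    is immediate. *)
Definition hasumZ (a : int -> C) s := forall e, 0 < e ->
  exists M, forall m n, (M <= m)%N -> (M <= n)%N ->
  nrm (\sum_(i < m + n) a (i%:Z - m%:Z) - s) <= e.

Lemma sumZ_split (a : int -> C) m n : \sum_(i < m + n) a (i%:Z - m%:Z) =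
  \sum_(i < n) a i%:Z + \sum_(i < m) a (Negz i).
Proof.
rewrite big_split_ord [LHS]addrC; congr (_ + _).
  by apply: eq_bigr => i _; congr a; rewrite /=; lia.
rewrite (reindex_inj rev_ord_inj) /=; apply: eq_bigr => i _; congr a.
by rewrite NegzE; have := ltn_ord i; lia.
Qed.

Lemma hasumZ_nat a1 a2 s t (a : int -> C) : (forall n, a1 n = a n%:Z) -> (forall n, a2 n = a (Negz n)) ->
  hasum a1 s -> hasum a2 t -> hasumZ a (s + t).
Proof.
move=> e1 e2 h1 h2 e e0; have e20 : 0 < e / 2 by rewrite divr_gt0.
have [N hN] := h1 _ e20; have [M hM] := h2 _ e20; exists (N + M)%N => m n hm hn.
have := hN n (leq_trans (leq_addr _ _) hn); have := hM m (leq_trans (leq_addl _ _) hm).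
rewrite sumZ_split (eq_bigr (fun i : 'I_m => a (Negz i))) // (eq_bigr (fun i : 'I_n => a i%:Z)) // => k1 k2.
by rewrite opprD addrACA; apply: le_trans (nrmD _ _) _; lra.
Qed.

Lemma hasumZ_uniq (a : int -> C) s t : hasumZ a s -> hasumZ a t -> s = t.
Proof.
move=> hs ht; apply/eqP; rewrite -subr_eq0; apply/eqP; apply: nrm_eps => e e0.
have e2 : 0 < e / 2 by rewrite divr_gt0.
have [N hN] := hs _ e2; have [M hM] := ht _ e2.
have := hN (N + M)%N (N + M)%N (leq_addr _ _) (leq_addr _ _).
have := hM (N + M)%N (N + M)%N (leq_addl _ _) (leq_addl _ _).
set S := \sum_(i < _) _ => h1 h2.
have -> : s - t = (S - t) - (S - s) by ring.
by apply: le_trans (nrmB _ _) _; lra.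
Qed.

Lemma hasumZD (a b : int -> C) s t : hasumZ a s -> hasumZ b t -> hasumZ (fun n => a n + b n) (s + t).
Proof.
move=> hs ht e e0; have e2 : 0 < e / 2 by rewrite divr_gt0.
have [N hN] := hs _ e2; have [M hM] := ht _ e2; exists (N + M)%N => m n hm hn.
have h1 := hN m n (leq_trans (leq_addr _ _) hm) (leq_trans (leq_addr _ _) hn).
have h2 := hM m n (leq_trans (leq_addl _ _) hm) (leq_trans (leq_addl _ _) hn).
rewrite big_split /= opprD addrACA; apply: le_trans (nrmD _ _) _; lra.
Qed.

Lemma hasumZZl (a : int -> C) s c : hasumZ a s -> hasumZ (fun n => c * a n) (c * s).
Proof.
move=> hs e e0; have n0 := nrm_ge0 c.
have e2 : 0 < e / (1 + nrm c) by rewrite divr_gt0 // ltr_pwDl.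
have [N hN] := hs _ e2; exists N => m n hm hn; have h := hN m n hm hn.
rewrite -mulr_sumr -mulrBr nrmM; apply: le_trans (ler_wpM2l n0 h) _.
rewrite mulrCA ler_piMr // ?(ltW e0) // ler_pdivrMr ?ltr_pwDl // mul1r; lra.
Qed.

Lemma hasumZ_ext (a b : int -> C) s : hasumZ a s -> (forall n, a n = b n) -> hasumZ b s.
Proof. by move=> h e; have -> // : b = a by apply/funext => n; rewrite e. Qed.

Lemma hasumZ_shift (a : int -> C) s (k : nat) : hasumZ a s -> hasumZ (fun n => a (n + k%:Z)) s.
Proof.
move=> hs e e0; have [M hM] := hs _ e0; exists (M + k)%N => m n hm hn.
have := hM (m - k)%N (n + k)%N; rewrite (_ : (m - k + (n + k) = m + n)%N); last by lia.
rewrite (eq_bigr (fun i : 'I_(m + n) => a (i%:Z - m%:Z + k%:Z))); last first.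
  by move=> i _; congr a; lia.
by apply; lia.
Qed.

Lemma hasumZ_group (a : int -> C) s (N : nat) : (0 < N)%N -> hasumZ a s ->
  hasumZ (fun n => \sum_(l < N) a (n * N%:Z + l%:Z)) s.
Proof.
move=> N0 hs e e0; have [M hM] := hs _ e0; exists M => m n hm hn.
have := hM (m * N)%N (n * N)%N; rewrite -mulnDl.
have -> : \sum_(i < (m + n) * N) a (i%:Z - (m * N)%:Z) =
  \sum_(i < m + n) \sum_(l < N) a ((i%:Z - m%:Z) * N%:Z + l%:Z).
  elim: (m + n)%N => [|p IH]; first by rewrite mul0n !big_ord0.
  rewrite mulSn addnC big_split_ord IH big_ord_recr; congr (_ + _).
  by apply: eq_bigr => l _; congr a; rewrite /=; lia.
by apply; nia.
Qed.

Lemma hasumZ_geo (a : int -> C) r K : 0 <= r < 1 -> (forall k : int, nrm (a k) <= K * r ^+ `|k|%N) ->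
  exists2 s, hasumZ a s & nrm s <= 2 * (K / (1 - r)).
Proof.
move=> hr h.
have h1 (n : nat) : nrm (a n%:Z) <= K * r ^+ n by exact: (h n%:Z).
have h2 (n : nat) : nrm (a (Negz n)) <= K * r ^+ n.
  apply: le_trans (h (Negz n)) _; have K0 : 0 <= K by have := le_trans (nrm_ge0 _) (h1 0%N); rewrite mulr1.
  have /andP[r0 r1] := hr; rewrite ler_wpM2l // NegzE abszN exprS ler_piMl ?exprn_ge0 // ltW //.
have [s hs] := hasum_geo hr h1; have [t ht] := hasum_geo hr h2.
exists (s + t); first exact: hasumZ_nat hs ht.
have b1 := hasum_le hs (fun n => geo_bound n hr h1).
have b2 := hasum_le ht (fun n => geo_bound n hr h2).
by apply: le_trans (nrmD _ _) _; lra.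
Qed.

Definition zsum (a : int -> C) : C := xget 0 [set s | hasumZ a s]%classic.
Lemma zsumE (a : int -> C) s : hasumZ a s -> zsum a = s.
Proof.
move=> h; have := xgetI 0 (h : [set s | hasumZ a s]%classic s).
by move/hasumZ_uniq; apply.
Qed.
Definition tsum (a : nat -> C) : C := xget 0 [set s | hasum a s]%classic.
Lemma tsumE (a : nat -> C) s : hasum a s -> tsum a = s.
Proof.
move=> h; have := xgetI 0 (h : [set s | hasum a s]%classic s).
by move/hasum_uniq; apply.
Qed.
End Sums.

(** * Theta inversion by Riemann sums *)

Section Gauss.
Variable R : realType.
Notation C := (R[i]).
Implicit Types (y z d v w : C) (t r e : R).

Definition cpi : C := (pi : R)%:C%C.
Definition gauss y : C := cexp (- (cpi * y ^+ 2)).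
Lemma nrm_cpi : nrm cpi = pi.
Proof. by rewrite nrm_real ger0_norm // pi_ge0. Qed.
Lemma gaussD y d : gauss (y + d) = gauss y * cexp (- (cpi * (2 * y * d + d ^+ 2))).
Proof. by rewrite /gauss -cexpD; congr cexp; ring. Qed.
Lemma Re_scale r z : complex.Re (r%:C%C * z) = r * complex.Re z.
Proof. by case: z => a b /=; rewrite mul0r subr0. Qed.
Lemma nrm_gauss y : nrm (gauss y) = expR (- (pi * complex.Re (y ^+ 2))).
Proof. by rewrite nrm_cexp ReN Re_scale. Qed.

(** Completing squares in Re (a t + b)^2 >= c t^2 - 2AB|t| - B^2. The constants depend on c, A, B
    only, hence serve along a whole path of Gaussians. *)
Lemma gauss_decay (c A B : R) : 0 < c -> 0 <= A -> 0 <= B -> exists k L : R, 0 < k /\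
  forall (a b : C) t, c <= complex.Re (a ^+ 2) -> nrm a <= A -> nrm b <= B ->
  nrm (gauss (a * t%:C%C + b)) <= expR (L - k * (1 + `|t|) ^+ 2).
Proof.
move=> c0 A0 B0; have p0 : 0 < pi :> R by exact: pi_gt0.
exists (pi * c / 4), (pi * (c / 2 + 2 * (A * B) ^+ 2 / c + B ^+ 2)); split.
  by rewrite divr_gt0 // mulr_gt0.
move=> a b t hc ha hb; rewrite nrm_gauss ler_expR.
have -> : pi * (c / 2 + 2 * (A * B) ^+ 2 / c + B ^+ 2) - pi * c / 4 * (1 + `|t|) ^+ 2
  = - (pi * (c / 4 * (1 + `|t|) ^+ 2 - (c / 2 + 2 * (A * B) ^+ 2 / c + B ^+ 2))) :> R by ring.
rewrite lerN2 ler_pM2l //.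
have -> : (a * t%:C%C + b) ^+ 2 = (t ^+ 2)%:C%C * a ^+ 2 + (2 * t)%:C%C * (a * b) + b ^+ 2.
  by rewrite rmorphXn rmorphM rmorph_nat; ring.
rewrite !ReD !Re_scale.
have e1 : c * t ^+ 2 <= t ^+ 2 * complex.Re (a ^+ 2).
  by rewrite mulrC ler_wpM2l // sqr_ge0.
have e2 : - (B ^+ 2) <= complex.Re (b ^+ 2).
  have : nrm (b ^+ 2) <= B ^+ 2 by rewrite nrmX ler_pXn2r ?nnegrE ?nrm_ge0.
  by have := nrm_Re (b ^+ 2); rewrite ler_norml => /andP[h _]; lra.
have e3 : - (2 * `|t| * (A * B)) <= 2 * t * complex.Re (a * b).
  have h : nrm (a * b) <= A * B by rewrite nrmM ler_pM ?nrm_ge0.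
  have : `|2 * t * complex.Re (a * b)| <= 2 * `|t| * (A * B).
    rewrite !normrM normr_nat ler_pM // ?mulr_ge0 //; exact: le_trans (nrm_Re _) h.
  by rewrite ler_norml => /andP[].
have e4 : 2 * `|t| * (A * B) <= c / 2 * `|t| ^+ 2 + 2 * (A * B) ^+ 2 / c.
  have : 0 <= (c * `|t| - 2 * (A * B)) ^+ 2 / (2 * c).
    by rewrite mulr_ge0 ?sqr_ge0 // invr_ge0 mulr_ge0 // ltW.
  have -> : (c * `|t| - 2 * (A * B)) ^+ 2 / (2 * c)
    = c / 2 * `|t| ^+ 2 + 2 * (A * B) ^+ 2 / c - 2 * `|t| * (A * B).
    by field; rewrite gt_eqF.
  by rewrite subr_ge0.
have e5 : c * (1 + `|t|) ^+ 2 <= c * (2 + 2 * `|t| ^+ 2).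
  by rewrite ler_pM2l //; have := sqr_ge0 (1 - `|t|); lra.
have e6 : `|t| ^+ 2 = t ^+ 2 by rewrite real_normK ?num_real.
rewrite e6 in e4 e5.
move: e1 e2 e3 e4 e5; clear.
set u := t ^+ 2 * _; set u2 := complex.Re (b ^+ 2); set u3 := _ * complex.Re (a * b).
set u4 := 2 * `|t| * _; set u5 := 2 * (A * B) ^+ 2 / c; set u6 := (1 + `|t|) ^+ 2; set u7 := t ^+ 2.
move=> *; clearbody u u2 u3 u4 u5 u6 u7; lra.
Qed.

Lemma exp_sq_lin (k x : R) : 0 < k -> - (k * x ^+ 2) <= 1 / k - 2 * x.
Proof.
move=> k0; have : 0 <= (k * x - 1) ^+ 2 / k by rewrite mulr_ge0 ?sqr_ge0 // invr_ge0 ltW.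
have -> : (k * x - 1) ^+ 2 / k = k * x ^+ 2 - 2 * x + 1 / k by field; rewrite gt_eqF.
lra.
Qed.

Lemma gauss_bound (c A B : R) : 0 < c -> 0 <= A -> 0 <= B -> exists2 K : R, 0 <= K &
  forall (a b : C) t, c <= complex.Re (a ^+ 2) -> nrm a <= A -> nrm b <= B ->
  nrm (gauss (a * t%:C%C + b)) <= K * expR (- (2 * `|t|)).
Proof.
move=> c0 A0 B0; have [k [L [k0 h]]] := gauss_decay c0 A0 B0.
exists (expR (L + 1 / k)); first exact: expR_ge0.
move=> a b t h1 h2 h3; apply: le_trans (h a b t h1 h2 h3) _.
by rewrite -expRD ler_expR; have := exp_sq_lin (1 + `|t|) k0; lra.
Qed.

Lemma sq_le_exp (k x : R) : 0 < k -> 0 <= x -> x ^+ 2 <= (8 / k) ^+ 2 * expR (k * x / 4).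
Proof.
move=> k0 x0; pose u := k * x / 8.
have u0 : 0 <= u by rewrite divr_ge0 ?mulr_ge0 ?(ltW k0).
have -> : k * x / 4 = u + u by rewrite /u; field.
have -> : x = 8 / k * u by rewrite /u; field; rewrite gt_eqF.
rewrite expRD -[expR _ * expR _]expr2 exprMn ler_wpM2l ?sqr_ge0 //.
by rewrite ler_pXn2r ?nnegrE ?expR_ge0 //; have := expR_ge1Dx u; lra.
Qed.

(** First-order Taylor expansion of the Gaussian with an error O(e^2) that stays summable in t. The
    increment may grow linearly in t, as happens when the Gaussian is rotated. *)
Lemma gauss_step (c A B D : R) : 0 < c -> 0 <= A -> 0 <= B -> 0 <= D ->
  exists K e0 : R, [/\ 0 <= K, 0 < e0 & 
  forall (a b d : C) t e, c <= complex.Re (a ^+ 2) -> nrm a <= A -> nrm b <= B ->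
  0 <= e <= e0 -> nrm d <= e * D * (1 + `|t|) ->
  nrm (gauss (a * t%:C%C + b + d) -
       gauss (a * t%:C%C + b) * (1 - 2 * cpi * (a * t%:C%C + b) * d))
  <= K * e ^+ 2 * expR (- (2 * `|t|))].
Proof.
move=> c0 A0 B0 D0; have [k [L [k0 h]]] := gauss_decay c0 A0 B0.
have p0 : 0 < pi :> R by exact: pi_gt0.
pose Z : R := pi * (2 * (A + B) * D + D ^+ 2).
have Z0 : 0 <= Z by rewrite /Z mulr_ge0 ?(ltW p0) // addr_ge0 ?sqr_ge0 // !mulr_ge0 ?addr_ge0.
pose M : R := 5 * Z ^+ 2 + pi * D ^+ 2.
have M0 : 0 <= M by apply: addr_ge0; apply: mulr_ge0; rewrite ?sqr_ge0 ?(ltW p0).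
(* For such e the exponent of the perturbation is at most (k/4) T^2. Of the decay k T^2, one quarter
   pays for it, another for the factor T^4, and the remaining half leaves e^(-2|t|). *)
exists (expR (L + 2 / k) * M * (8 / k) ^+ 2), (Num.min 1 (k / 4 / (1 + Z))); split.
- by apply: mulr_ge0; [apply: mulr_ge0 => //; apply: expR_ge0 | apply: sqr_ge0].
- by rewrite lt_min ltr01 divr_gt0 // ?divr_gt0 // ltr_pwDl.
move=> a b d t e h1 h2 h3 /andP[e0]; rewrite le_min => /andP[e1 e2] hd.
have eZ : e * Z <= k / 4.
  move: e2; rewrite ler_pdivlMr ?ltr_pwDl // mulrDr mulr1; lra.
have := h a b t h1 h2 h3.
set y := a * t%:C%C + b; set T := 1 + `|t|.
have T1 : 1 <= T by rewrite lerDl.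
have hy : nrm y <= (A + B) * T.
  apply: le_trans (nrmD _ _) _; rewrite nrmM nrm_real mulrDl lerD //.
    by rewrite ler_pM ?nrm_ge0 // /T lerDr.
  by apply: le_trans h3 _; rewrite ler_peMr.
rewrite [gauss (y + d)]gaussD; set g := gauss y; move=> hg.
set z := - (cpi * _).
have -> : g * cexp z - g * (1 - 2 * cpi * y * d) = g * ((cexp z - 1 - z) - cpi * d ^+ 2).
  by rewrite /z; ring.
have hd2 : nrm (d ^+ 2) <= e ^+ 2 * D ^+ 2 * T ^+ 2.
  by rewrite nrmX -!exprMn ler_pXn2r ?nnegrE ?nrm_ge0 // !mulr_ge0 // (le_trans _ T1).
have hz : nrm z <= e * Z * T ^+ 2.
  rewrite /z nrmN nrmM nrm_cpi /Z [e * (pi * _)]mulrCA -[leRHS]mulrA ler_pM2l //.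
  have -> : e * (2 * (A + B) * D + D ^+ 2) * T ^+ 2 = e * (2 * (A + B) * D) * T ^+ 2 + e * D ^+ 2 * T ^+ 2 by ring.
  apply: le_trans (nrmD _ _) _; apply: lerD.
    rewrite nrmM nrmM nrm_nat.
    have : nrm y * nrm d <= (A + B) * T * (e * D * T) by rewrite ler_pM ?nrm_ge0.
    have -> : e * (2 * (A + B) * D) * T ^+ 2 = 2 * ((A + B) * T * (e * D * T)) by ring.
    by move=> H; rewrite -mulrA ler_pM2l.
  apply: le_trans hd2 _; rewrite ler_wpM2r ?sqr_ge0 // ler_wpM2r ?sqr_ge0 //.
  by rewrite expr2 ler_piMr.
have T20 : 0 <= T ^+ 2 by exact: sqr_ge0.
have hz2 : nrm z <= k / 4 * T ^+ 2 by apply: le_trans hz _; rewrite ler_wpM2r.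
have b1 : nrm (cexp z - 1 - z) <= 5 * (e * Z * T ^+ 2) ^+ 2 * expR (k / 4 * T ^+ 2).
  apply: le_trans (cexp_sub1z z) _; rewrite ler_pM ?expR_ge0 ?ler_expR //.
    by rewrite mulr_ge0 // sqr_ge0.
  by rewrite ler_pM2l // ler_pXn2r ?nnegrE ?nrm_ge0 //; do 2?[apply: mulr_ge0 => //]; rewrite ?sqr_ge0.
have b2 : nrm (cpi * d ^+ 2) <= pi * D ^+ 2 * e ^+ 2 * T ^+ 4 * expR (k / 4 * T ^+ 2).
  have E1 : 1 <= expR (k / 4 * T ^+ 2) by rewrite -[leLHS]expR0 ler_expR mulr_ge0 // divr_ge0 // ltW.
  rewrite nrmM nrm_cpi; apply: (@le_trans _ _ (pi * D ^+ 2 * e ^+ 2 * T ^+ 2)).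
    have -> : pi * D ^+ 2 * e ^+ 2 * T ^+ 2 = pi * (e ^+ 2 * D ^+ 2 * T ^+ 2) by ring.
    by rewrite ler_pM2l.
  rewrite -[leRHS]mulrA ler_wpM2l //.
    by apply: mulr_ge0; [apply: mulr_ge0; rewrite ?(ltW p0) | ]; rewrite ?sqr_ge0.
  by rewrite -[leLHS]mulr1 ler_pM // ler_weXn2l.
have b3 : nrm (cexp z - 1 - z - cpi * d ^+ 2) <= M * e ^+ 2 * (T ^+ 2) ^+ 2 * expR (k / 4 * T ^+ 2).
  apply: le_trans (nrmB _ _) _.
  have -> : M * e ^+ 2 * (T ^+ 2) ^+ 2 * expR (k / 4 * T ^+ 2) =
    5 * (e * Z * T ^+ 2) ^+ 2 * expR (k / 4 * T ^+ 2) + pi * D ^+ 2 * e ^+ 2 * T ^+ 4 * expR (k / 4 * T ^+ 2).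
    by rewrite /M; ring.
  exact: lerD.
rewrite nrmM; apply: le_trans (ler_pM (nrm_ge0 _) (nrm_ge0 _) hg b3) _.
have b4 := sq_le_exp k0 T20.
have E0 := expR_ge0 (k / 4 * T ^+ 2).
have b5 : M * e ^+ 2 * (T ^+ 2) ^+ 2 * expR (k / 4 * T ^+ 2) <=
   M * e ^+ 2 * ((8 / k) ^+ 2 * expR (k * T ^+ 2 / 4)) * expR (k / 4 * T ^+ 2).
  by rewrite ler_wpM2r // ler_wpM2l // mulr_ge0 // sqr_ge0.
apply: le_trans (ler_wpM2l (expR_ge0 _) b5) _.
have -> : expR (L - k * T ^+ 2) * (M * e ^+ 2 * ((8 / k) ^+ 2 * expR (k * T ^+ 2 / 4)) * expR (k / 4 * T ^+ 2))
  = M * (8 / k) ^+ 2 * e ^+ 2 * (expR (L - k * T ^+ 2) * expR (k * T ^+ 2 / 4) * expR (k / 4 * T ^+ 2)) by ring.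
have -> : expR (L + 2 / k) * M * (8 / k) ^+ 2 * e ^+ 2 * expR (- (2 * `|t|))
  = M * (8 / k) ^+ 2 * e ^+ 2 * (expR (L + 2 / k) * expR (- (2 * `|t|))) by ring.
rewrite ler_wpM2l //; first by rewrite !mulr_ge0 // ?sqr_ge0 // ?invr_ge0 ltW.
rewrite -!expRD ler_expR.
have k20 : 0 < k / 2 by rewrite divr_gt0.
have := exp_sq_lin T k20; have -> : 1 / (k / 2) = 2 / k by field; rewrite gt_eqF.
have tT : `|t| = T - 1 by rewrite /T; ring.
rewrite tT; clear; lra.
Qed.
End Gauss.

(** * Riemann sums and their comparison by telescoping *)

Section Riemann.
Variable R : realType.
Notation C := (R[i]).
Implicit Types (F G : int -> C) (K : R).

Definition rt (N : nat) (n : int) : R := n%:~R / N%:R.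
Definition dec (N : nat) (n : int) : R := expR (- `|rt N n|).

Lemma decE N n : (0 < N)%N -> dec N n = expR (- N%:R^-1) ^+ `|n|%N.
Proof.
move=> N0; rewrite /dec /rt -expRM_natl; congr expR.
by rewrite normrM normfV normr_nat -intr_norm -abszE mulrN mulr_natl.
Qed.

(** The ratio e^(-1/N) is at most 1 - 1/(2N), so each half of the geometric majorant sums to at most
    2N. *)
Lemma riem N K F : (0 < N)%N -> (forall n, nrm (F n) <= K * dec N n) ->
  exists2 s, hasumZ F s & nrm s <= 4 * N%:R * K.
Proof.
move=> N0 h; have NR : 0 < N%:R :> R by rewrite ltr0n.
have NR1 : 1 <= N%:R :> R by rewrite ler1n.
have K0 : 0 <= K.
  have := le_trans (nrm_ge0 _) (h 0).
  by rewrite /dec /rt mul0r normr0 oppr0 expR0 mulr1.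
pose r : R := expR (- N%:R^-1).
have r0 : 0 <= r by exact: expR_ge0.
have hr : r <= 1 - 1 / (2 * N%:R).
  rewrite /r expRN; have e1 := expR_ge1Dx (N%:R^-1 : R).
  have i0 : 0 < N%:R^-1 :> R by rewrite invr_gt0.
  have i1 : N%:R^-1 <= 1 :> R by rewrite invf_le1.
  rewrite -[leLHS]div1r ler_pdivrMr ?expR_gt0 //.
  have -> : 1 / (2 * N%:R) = N%:R^-1 / 2 :> R by field; rewrite gt_eqF.
  move: e1 i0 i1; set x := N%:R^-1; set y := expR x; clearbody x y; clear => *; nra.
have d0 : 0 < 1 / (2 * N%:R) :> R by rewrite divr_gt0 // mulr_gt0.
have hr1 : 0 <= r < 1 by rewrite r0 /=; lra.
have h' k : nrm (F k) <= K * r ^+ `|k|%N by rewrite -decE.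
have [s hs b] := hasumZ_geo hr1 h'; exists s => //; apply: le_trans b _.
have -> : 4 * N%:R * K = 2 * (K * (2 * N%:R)) by ring.
rewrite ler_pM2l // ler_wpM2l // -[leRHS]invrK lef_pV2 ?posrE ?invr_gt0 ?mulr_gt0 //; last by lra.
by rewrite -div1r; lra.
Qed.

(** The differences H(n+1) - H(n) sum to zero over all integers, so one step in j changes the sum by
    at most 4N times B/N^2; there are N steps, and the sums are weighted by 1/N. *)
Lemma tele N (G H : nat -> int -> C) (B K : R) (S0 SN : C) : (0 < N)%N ->
  (forall j n, (j <= N)%N -> nrm (G j n) <= K * dec N n) ->
  (forall j n, (j <= N)%N -> nrm (H j n) <= K * dec N n) ->
  (forall j n, (j < N)%N -> nrm (G j.+1 n - G j n - (H j (n + 1) - H j n)) <= B / N%:R ^+ 2 * dec N n) ->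
  hasumZ (G 0%N) S0 -> hasumZ (G N) SN ->
  nrm (N%:R^-1 * SN - N%:R^-1 * S0) <= 4 * B / N%:R.
Proof.
move=> N0 hG hH hE h0 hN; have NR : 0 < N%:R :> R by rewrite ltr0n.
have B0 : 0 <= B / N%:R ^+ 2.
  by have := le_trans (nrm_ge0 _) (hE 0%N 0 N0); rewrite /dec pmulr_lge0 // expR_gt0.
pose s j := zsum (G j).
have sj j : (j <= N)%N -> hasumZ (G j) (s j).
  by move=> jN; have [t ht _] := riem N0 (fun n => hG j n jN); rewrite /s (zsumE ht).
have step j : (j < N)%N -> nrm (s j.+1 - s j) <= 4 * B / N%:R.
  move=> jN; have [t ht _] := riem N0 (fun n => hH j n (ltnW jN)).
  have h1 := hasumZD (sj _ jN) (hasumZZl (-1) (sj _ (ltnW jN))).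
  have h2 := hasumZD (hasumZ_shift 1 ht) (hasumZZl (-1) ht).
  have h3 := hasumZD h1 (hasumZZl (-1) h2).
  have [t' ht' hb] := riem N0 (fun n => hE j n jN).
  have e : t' = s j.+1 - s j.
    apply: (hasumZ_uniq ht').
    have -> : s j.+1 - s j = s j.+1 + -1 * s j + -1 * (t + -1 * t) by ring.
    by apply: (hasumZ_ext h3) => n; ring.
  rewrite -e; apply: le_trans hb _.
  by rewrite le_eqVlt; apply/orP; left; apply/eqP; field; rewrite gt_eqF.
have tot j : (j <= N)%N -> nrm (s j - s 0%N) <= j%:R * (4 * B / N%:R).
  elim: j => [|j IH] jN; first by rewrite subrr nrm0 mul0r.
  have -> : s j.+1 - s 0%N = (s j.+1 - s j) + (s j - s 0%N) by ring.
  apply: le_trans (nrmD _ _) _; rewrite -natr1 mulrDl mul1r addrC lerD ?step //.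
  exact: IH (ltnW jN).
have := tot N (leqnn N).
rewrite -mulrBr nrmM nrmV nrm_nat.
rewrite -(hasumZ_uniq h0 (sj _ (leq0n _))) -(hasumZ_uniq hN (sj _ (leqnn _))) => h.
by rewrite mulrC ler_pdivrMr // mulrC.
Qed.
End Riemann.

Section Poisson.
Variable R : realType.
Notation C := (R[i]).
Local Notation "x %:c" := (x%:C%C : C) (at level 2, format "x %:c").
Implicit Types (v w : C) (N : nat) (n : int).

Lemma exp2_dec N n : expR (- (2 * `|rt R N n|)) <= dec R N n.
Proof. by rewrite ler_expR lerN2 ler_peMl // ler1n. Qed.
Lemma exp2_dec1 N n : (1 + `|rt R N n|) * expR (- (2 * `|rt R N n|)) <= dec R N n.
Proof.
rewrite /dec; set t := `|_|; have -> : - (2 * t) = - t + - t by ring.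
rewrite expRD mulrA ler_piMl ?expR_ge0 // expRN ler_pdivrMr ?expR_gt0 // mul1r.
exact: expR_ge1Dx.
Qed.
Lemma exp2_dec2 N n : (1 + `|rt R N n|) ^+ 2 * expR (- (2 * `|rt R N n|)) <= 4 * dec R N n.
Proof.
rewrite /dec; set t := `|_|; have -> : - (2 * t) = - t - t / 2 - t / 2 by field.
have e := expR_ge1Dx (t / 2); have e0 := expR_gt0 (t / 2).
rewrite !expRD !expRN; set E := expR (t / 2) in e e0 *.
have -> : (1 + t) ^+ 2 * ((expR t)^-1 / E / E) = ((1 + t) / E) ^+ 2 * (expR t)^-1.
  by field; rewrite !gt_eqF ?expR_gt0.
rewrite ler_wpM2r ?invr_ge0 ?expR_ge0 //.
have t0 : 0 <= t by exact: normr_ge0.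
have -> : 4 = 2 ^+ 2 :> R by ring.
have d0 : 0 <= (1 + t) / E by rewrite divr_ge0 ?(ltW e0) // addr_ge0.
rewrite ler_pXn2r ?nnegrE // ler_pdivrMr //; lra.
Qed.
Lemma rtS N n : (0 < N)%N -> rt R N (n + 1) = rt R N n + N%:R^-1.
Proof. by move=> N0; rewrite /rt intrD mulrDl div1r. Qed.

(** The v with Re v > 0 and Re v^2 > 0: the image of the upper half-plane under the principal root
    of -i tau. It is convex, so [seg] joins 1 to v inside it. *)
Definition cone v := `|complex.Im v| < complex.Re v.
Definition seg v (u : R) : C := 1 + u%:c * (v - 1).
Lemma Re_sqr (z : C) : complex.Re (z ^+ 2) = complex.Re z ^+ 2 - complex.Im z ^+ 2.
Proof. by case: z => x y; rewrite !expr2. Qed.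
Lemma Re_seg v u : complex.Re (seg v u) = 1 + u * (complex.Re v - 1).
Proof. by rewrite /seg ReD Re_scale ReD ReN. Qed.
Lemma Im_scale (r : R) (z : C) : complex.Im (r%:c * z) = r * complex.Im z.
Proof. by case: z => a b /=; rewrite mul0r addr0. Qed.
Lemma Im_seg v u : complex.Im (seg v u) = u * complex.Im v.
Proof. by rewrite /seg ImD Im_scale ImD ImN /= subr0 add0r. Qed.
Lemma cone_seg v : cone v -> exists2 c : R, 0 < c & forall u : R, 0 <= u <= 1 -> c <= complex.Re (seg v u ^+ 2).
Proof.
rewrite /cone; set x := complex.Re v; set y := complex.Im v => hxy.
(* Re of the square factors as below, and both factors are interpolations from 1 that stay above
   this minimum. *)
exists (Num.min 1 (x - `|y|) ^+ 2).
  by rewrite exprn_gt0 // lt_min ltr01 subr_gt0.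
move=> u /andP[u0 u1].
have -> : complex.Re (seg v u ^+ 2) =
   (1 - u + u * (x - `|y|)) * (1 - u + u * (x + `|y|)).
  have yy : `|y| ^+ 2 = y ^+ 2 by rewrite real_normK ?num_real.
  have -> : (1 - u + u * (x - `|y|)) * (1 - u + u * (x + `|y|)) = (1 - u + u * x) ^+ 2 - u ^+ 2 * `|y| ^+ 2 by ring.
  by rewrite yy Re_sqr Re_seg Im_seg -/x -/y; ring.
have m1 : Num.min 1 (x - `|y|) <= 1 by rewrite ge_min lexx.
have m2 : Num.min 1 (x - `|y|) <= x - `|y| by rewrite ge_min lexx orbT.
have m0 : 0 <= Num.min 1 (x - `|y|) by rewrite le_min ler01 subr_ge0 ltW.
have y0 := normr_ge0 y.
move: m1 m2 m0; set m := Num.min _ _; set z := `|y| in y0 *; clearbody m z => m1 m2 m0.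
have k : m <= 1 - u + u * (x - z).
  have := ler_wpM2l u0 m2; have : 0 <= (1 - u) * (1 - m) by rewrite mulr_ge0 ?subr_ge0.
  lra.
have k2 : u * (x - z) <= u * (x + z) by rewrite ler_wpM2l //; lra.
by rewrite expr2; apply: ler_pM => //; lra.
Qed.

Lemma cone_sq v : cone v -> 0 < complex.Re (v ^+ 2).
Proof.
move=> /cone_seg[c c0 /(_ 1)]; rewrite ler01 lexx => /(_ isT).
by rewrite /seg mul1r addrCA subrr addr0; apply: lt_le_trans.
Qed.
Lemma cone1 : cone 1. Proof. by rewrite /cone /= normr0 ltr01. Qed.

Definition gsamp v w N n : C := gauss (v * (rt R N n)%:c + w).

Lemma gsamp_bound v (B : R) : cone v -> 0 <= B -> exists2 K : R, 0 <= K &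
  forall w N n, nrm w <= B -> nrm (gsamp v w N n) <= K * dec R N n.
Proof.
move=> cv B0; have [K K0 h] := gauss_bound (cone_sq cv) (nrm_ge0 v) B0.
exists K => // w N n wB; apply: le_trans (h v w _ (lexx _) (lexx _) wB) _.
by rewrite ler_wpM2l // exp2_dec.
Qed.

(** Riemann sums of step 1/N for the integrals of gauss(v t) and gauss(v t + w); the integrals
    themselves never appear. *)
Definition cN v N : C := N%:R^-1 * zsum (gsamp v 0 N).
Definition gN v w N : C := N%:R^-1 * zsum (gsamp v w N).

Lemma natinv_small (e : R) : 0 < e -> exists N0 : nat, forall N, (N0 < N)%N -> N%:R^-1 <= e :> R.
Proof.
move=> e0; exists (Num.truncn e^-1) => N hN.
have NR : 0 < N%:R :> R by rewrite ltr0n; lia.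
rewrite -[leRHS]invrK lef_pV2 ?posrE ?invr_gt0 //.
have /ltW := truncnS_gt e^-1; move/le_trans; apply.
by rewrite ler_nat.
Qed.

(* The derivative of gauss (v t + u v w) in u is w times its derivative in t, so
   that moving u by 1/N changes the Riemann sum by a telescoping sum over t. *)
Lemma gN_shift v w : cone v -> exists B N0, forall N, (N0 < N)%N ->
  nrm (gN v (v * w) N - cN v N) <= B / N%:R.
Proof.
move=> cv; set B := nrm (v * w).
have B0 : 0 <= B by exact: nrm_ge0.
set D := nrm v * (1 + nrm w).
have D0 : 0 <= D by rewrite mulr_ge0 ?addr_ge0 ?nrm_ge0.
have [K [e0 [K0 e00 hst]]] := gauss_step (cone_sq cv) (nrm_ge0 v) B0 D0.
have [K' K'0 hb] := gsamp_bound cv B0.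
have [N0 hN0] := natinv_small e00.
exists (4 * (K * (1 + nrm w))), N0 => N hN; have Np : (0 < N)%N by lia.
have NR : 0 < N%:R :> R by rewrite ltr0n.
pose b j : C := (j%:R / N%:R : R)%:c * (v * w).
have bB j : (j <= N)%N -> nrm (b j) <= B.
  move=> jN; rewrite /b nrmM nrm_real ger0_norm ?divr_ge0 //.
  by rewrite ler_piMl // ler_pdivrMr // mul1r ler_nat.
have hw := nrm_ge0 w.
pose G j n := gsamp v (b j) N n.
have hs0 : hasumZ (G 0%N) (zsum (gsamp v 0 N)).
  have [s hs _] := riem Np (fun n => hb _ N n (bB 0%N isT)).
  have -> : G 0%N = gsamp v 0 N by apply/funext => n; rewrite /G /b mul0r mul0r.
  by rewrite /G /b !mul0r in hs; rewrite (zsumE hs).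
have hsN : hasumZ (G N) (zsum (gsamp v (v * w) N)).
  have [s hs _] := riem Np (fun n => hb _ N n (bB N (leqnn N))).
  have e : b N = v * w by rewrite /b divff ?gt_eqF // mul1r.
  by rewrite /G e; rewrite e in hs; rewrite (zsumE hs).
have hG j n : (j <= N)%N -> nrm (G j n) <= K' * (1 + nrm w) * dec R N n.
  move=> jN; apply: le_trans (hb _ N n (bB j jN)) _.
  by rewrite ler_wpM2r ?expR_ge0 // ler_peMr // lerDl.
have hH j n : (j <= N)%N -> nrm (w * G j n) <= K' * (1 + nrm w) * dec R N n.
  move=> jN; rewrite nrmM mulrC.
  have := hb _ N n (bB j jN); rewrite -/(G j n) => hg.
  apply: (@le_trans _ _ (K' * dec R N n * nrm w)); first by rewrite ler_wpM2r.
  have := mulr_ge0 K'0 (expR_ge0 (- `|rt R N n|)); rewrite -/(dec R N n); lra.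
have hE j n : (j < N)%N -> nrm (G j.+1 n - G j n - (w * G j (n + 1) - w * G j n)) <=
    K * (1 + nrm w) / N%:R ^+ 2 * dec R N n.
  move=> jN; have ein : 0 <= (N%:R^-1 : R) <= e0 by apply/andP; split; [rewrite invr_ge0 ltW | exact: hN0].
  pose i : C := (N%:R^-1 : R)%:c.
  have ni : nrm i = N%:R^-1 by rewrite nrm_real ger0_norm // invr_ge0 ltW.
  set t := rt R N n; set y := v * t%:c + b j.
  have t0 : 1 <= 1 + `|t| by rewrite lerDl.
  have Ni0 : 0 <= N%:R^-1 :> R by rewrite invr_ge0 ltW.
  have v0 := nrm_ge0 v.
  have bd (d : C) : nrm d <= N%:R^-1 * (nrm v * (1 + nrm w)) -> nrm d <= N%:R^-1 * D * (1 + `|t|).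
    move=> h; apply: le_trans h _; rewrite -/D ler_peMr // mulr_ge0 //.
  have E1 := hst v (b j) (i * (v * w)) t N%:R^-1 (lexx _) (lexx _) (bB j (ltnW jN)) ein.
  have E2 := hst v (b j) (i * v) t N%:R^-1 (lexx _) (lexx _) (bB j (ltnW jN)) ein.
  have {}E1 := E1 ltac:(apply: bd; rewrite !nrmM ni ler_wpM2l // ler_wpM2l //; lra).
  have {}E2 := E2 ltac:(apply: bd; rewrite !nrmM ni ler_wpM2l // ler_peMr //; lra).
  rewrite -/y in E1 E2.
  have -> : G j.+1 n = gauss (y + i * (v * w)).
    rewrite /G /gsamp /y /b -/t; congr gauss; rewrite -natr1 mulrDl div1r rmorphD -/i; ring.
  have -> : G j (n + 1) = gauss (y + i * v).
    by rewrite /G /gsamp /y rtS // -/t rmorphD -/i; congr gauss; ring.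
  rewrite -[G j n]/(gauss y).
  set g1 := gauss (y + _) in E1 *; set g2 := gauss (y + _) in E2 *; set g := gauss y in E1 E2 *.
  have -> : g1 - g - (w * g2 - w * g) = (g1 - g * (1 - 2 * cpi R * y * (i * (v * w))))
     - w * (g2 - g * (1 - 2 * cpi R * y * (i * v))) by ring.
  apply: le_trans (nrmB _ _) _; rewrite nrmM.
  have E3 := exp2_dec N n; rewrite -/t in E3.
  have p0 : 0 <= K * N%:R^-1 ^+ 2 by rewrite mulr_ge0 // sqr_ge0.
  have E4 := ler_wpM2l p0 E3.
  have E5 := ler_wpM2l hw (le_trans E2 E4); have E6 := le_trans E1 E4.
  have -> : K * (1 + nrm w) / N%:R ^+ 2 * dec R N n = K * N%:R^-1 ^+ 2 * dec R N n +
     nrm w * (K * N%:R^-1 ^+ 2 * dec R N n) by field; rewrite gt_eqF.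
  exact: lerD.
have := tele Np hG hH hE hs0 hsN.
by rewrite /gN /cN.
Qed.

Lemma nrm_seg v (u : R) : 0 <= u <= 1 -> nrm (seg v u) <= 1 + nrm (v - 1).
Proof.
move=> /andP[u0 u1]; apply: le_trans (nrmD _ _) _; rewrite nrm1 lerD2l nrmM nrm_real ger0_norm //.
by rewrite ler_piMl ?nrm_ge0.
Qed.

(* With s = 1 + u (v - 1), the derivative of s gauss (s t) in u is that of
   (v - 1) t gauss (s t) in t: again each step in u telescopes over t. *)
Lemma cN_scale v : cone v -> exists B N0, forall N, (N0 < N)%N ->
  nrm (v * cN v N - cN 1 N) <= B / N%:R.
Proof.
move=> cv; have [c c0 hc] := cone_seg cv.
set V := nrm (v - 1); have V0 : 0 <= V := nrm_ge0 _.
pose A := 1 + V; have A0 : 0 <= A by rewrite addr_ge0.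
pose D := A + V; have D0 : 0 <= D by rewrite addr_ge0.
have [K [e0 [K0 e00 hst]]] := gauss_step c0 A0 (lexx 0) D0.
have [K' K'0 hb] := gauss_bound c0 A0 (lexx 0).
have [N0 hN0] := natinv_small e00.
have p0 : 0 <= pi :> R by exact: pi_ge0.
pose B := K * (A + V) + K * V + K' * (2 * pi * A * V * (A + V) * 4).
exists (4 * B), N0 => N hN; have Np : (0 < N)%N by lia.
have NR : 0 < N%:R :> R by rewrite ltr0n.
have Ni0 : 0 <= N%:R^-1 :> R by rewrite invr_ge0 ltW.
have Ni1 : N%:R^-1 <= 1 :> R by rewrite invf_le1 // ler1n.
pose a j : C := seg v (j%:R / N%:R).
have j01 j : (j <= N)%N -> 0 <= (j%:R / N%:R : R) <= 1.
  by move=> jN; rewrite divr_ge0 ?(ltW NR) //= ler_pdivrMr // mul1r ler_nat.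
have aA j : (j <= N)%N -> nrm (a j) <= A by move=> jN; apply: nrm_seg (j01 j jN).
pose G j n : C := a j * gauss (a j * (rt R N n)%:c).
pose H j n : C := (v - 1) * (rt R N n)%:c * gauss (a j * (rt R N n)%:c).
have hgb j n : (j <= N)%N -> nrm (gauss (a j * (rt R N n)%:c)) <= K' * expR (- (2 * `|rt R N n|)).
  move=> jN; have := hb (a j) 0 (rt R N n) (hc _ (j01 j jN)) (aA j jN) ltac:(by rewrite nrm0).
  by rewrite addr0.
have hG j n : (j <= N)%N -> nrm (G j n) <= K' * (A + V) * dec R N n.
  move=> jN; rewrite nrmM; apply: le_trans (ler_pM (nrm_ge0 _) (nrm_ge0 _) (aA j jN) (hgb j n jN)) _.
  rewrite mulrCA -mulrA ler_wpM2l // ler_pM ?expR_ge0 ?exp2_dec //.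
  by rewrite lerDl.
have hH j n : (j <= N)%N -> nrm (H j n) <= K' * (A + V) * dec R N n.
  move=> jN; rewrite nrmM nrmM nrm_real -/V.
  have h := ler_wpM2l (mulr_ge0 V0 (normr_ge0 (rt R N n))) (hgb j n jN).
  apply: le_trans h _; rewrite mulrCA -mulrA ler_wpM2l //.
  have e := expR_ge0 (- (2 * `|rt R N n|)).
  rewrite -mulrA ler_pM //; rewrite ?lerDr // ?mulr_ge0 //.
  apply: le_trans (exp2_dec1 N n); rewrite ler_wpM2r // lerDr //.
have hs0 : hasumZ (G 0%N) (zsum (gsamp 1 0 N)).
  have [s hs _] := riem Np (fun n => hG 0%N n isT).
  have e : gsamp 1 0 N = G 0%N.
    by apply/funext => n; rewrite /G /gsamp /a /seg mul0r mul0r !addr0 !mul1r.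
  by rewrite e (zsumE hs).
have hsN : hasumZ (G N) (v * zsum (gsamp v 0 N)).
  have aN : a N = v by rewrite /a divff ?gt_eqF // /seg mul1r addrCA subrr addr0.
  have [K2 _ hb2] := gsamp_bound cv (lexx 0).
  have [s hs _] := riem Np (fun n => hb2 0 N n ltac:(by rewrite nrm0)).
  rewrite (zsumE hs); apply: hasumZ_ext (hasumZZl v hs) _ => n.
  by rewrite /G aN /gsamp addr0.
have hE j n : (j < N)%N -> nrm (G j.+1 n - G j n - (H j (n + 1) - H j n)) <=
    B / N%:R ^+ 2 * dec R N n.
  move=> jN; have ein : 0 <= (N%:R^-1 : R) <= e0 by rewrite Ni0 /= hN0.
  pose i : C := (N%:R^-1 : R)%:c.
  have ni : nrm i = N%:R^-1 by rewrite nrm_real ger0_norm.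
  have T0 : 1 <= 1 + `|rt R N n| by rewrite lerDl.
  have D2 := exp2_dec2 N n; have D1 := exp2_dec1 N n; have D3 := exp2_dec N n.
  have gb := hgb j n (ltnW jN).
  set t := rt R N n in T0 D1 D2 D3 gb *; set y := a j * t%:c.
  have tt : `|t| <= 1 + `|t| by rewrite lerDr.
  have t0 : 0 <= `|t| by exact: normr_ge0.
  have E1 := hst (a j) 0 (i * (v - 1) * t%:c) t N%:R^-1 (hc _ (j01 j (ltnW jN))) (aA j (ltnW jN)) ltac:(by rewrite nrm0) ein.
  have E2 := hst (a j) 0 (i * a j) t N%:R^-1 (hc _ (j01 j (ltnW jN))) (aA j (ltnW jN)) ltac:(by rewrite nrm0) ein.
  have bd (d : C) (x z : R) : 0 <= x <= D -> z <= 1 + `|t| -> nrm d <= N%:R^-1 * x * z -> nrm d <= N%:R^-1 * D * (1 + `|t|).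
    move=> /andP[x0 xD] h1 h2; apply: le_trans h2 _.
    apply: (@le_trans _ _ (N%:R^-1 * x * (1 + `|t|))); first by rewrite ler_wpM2l // mulr_ge0.
    by rewrite ler_wpM2r ?(le_trans ler01) // ler_wpM2l.
  have {}E1 := E1 ltac:(apply: (bd _ V `|t|); [by rewrite V0 lerDr | by [] | by rewrite !nrmM ni nrm_real]).
  have {}E2 := E2 ltac:(apply: (bd _ A 1); [by rewrite A0 lerDl | by [] | by rewrite nrmM ni mulr1 ler_wpM2l // aA // ltnW]).
  rewrite addr0 -/y in E1 E2.
  have aS : a j.+1 = a j + i * (v - 1).
    by rewrite /a /seg -natr1 mulrDl div1r rmorphD -/i; ring.
  have -> : G j.+1 n = (a j + i * (v - 1)) * gauss (y + i * (v - 1) * t%:c).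
    by rewrite /G -/t aS; congr (_ * gauss _); rewrite /y; ring.
  have -> : H j (n + 1) = (v - 1) * (t%:c + i) * gauss (y + i * a j).
    by rewrite /H rtS // -/t rmorphD -/i; congr (_ * gauss _); rewrite /y; ring.
  rewrite -[G j n]/(a j * gauss y) -[H j n]/((v - 1) * t%:c * gauss y).
  set g1 := gauss (y + _) in E1 *; set g2 := gauss (y + _) in E2 *; set g := gauss y in E1 E2 gb *.
  (* After inserting both Taylor expansions the terms of order 1/N cancel; two remainders of
     [gauss_step] and an explicit term with i^2 are left. *)
  have -> : (a j + i * (v - 1)) * g1 - a j * g - ((v - 1) * (t%:c + i) * g2 - (v - 1) * t%:c * g) =
    (a j + i * (v - 1)) * (g1 - g * (1 - 2 * cpi R * y * (i * (v - 1) * t%:c))) -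
    (v - 1) * (t%:c + i) * (g2 - g * (1 - 2 * cpi R * y * (i * a j))) +
    g * (2 * cpi R * a j * t%:c * i ^+ 2 * (v - 1) * (a j - (v - 1) * t%:c)).
    by rewrite /y; ring.
  set x1 := g1 - _ in E1 *; set x2 := g2 - _ in E2 *.
  set I2 := N%:R^-1 ^+ 2 : R in E1 E2; have I0 : 0 <= I2 by exact: sqr_ge0.
  set q := expR _ in D1 D2 D3 E1 E2 gb; have q0 : 0 <= q by exact: expR_ge0.
  have aa := aA j (ltnW jN).
  have b1 : nrm ((a j + i * (v - 1)) * x1) <= K * (A + V) * I2 * dec R N n.
    have h : nrm (a j + i * (v - 1)) <= A + V.
      apply: le_trans (nrmD _ _) _; rewrite lerD // nrmM ni -/V ler_piMl //.
    rewrite nrmM; apply: le_trans (ler_pM (nrm_ge0 _) (nrm_ge0 _) h E1) _.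
    have -> : (A + V) * (K * I2 * q) = K * (A + V) * I2 * q by ring.
    by rewrite ler_wpM2l // !mulr_ge0.
  have b2 : nrm ((v - 1) * (t%:c + i) * x2) <= K * V * I2 * dec R N n.
    have h : nrm (t%:c + i) <= 1 + `|t|.
      by apply: le_trans (nrmD _ _) _; rewrite nrm_real ni addrC lerD2r.
    rewrite nrmM nrmM -/V; apply: le_trans (ler_pM _ (nrm_ge0 _) (ler_wpM2l V0 h) E2) _.
      by rewrite mulr_ge0 ?nrm_ge0.
    have -> : V * (1 + `|t|) * (K * I2 * q) = K * V * I2 * ((1 + `|t|) * q) by ring.
    by rewrite ler_wpM2l // !mulr_ge0.
  have b3 : nrm (g * (2 * cpi R * a j * t%:c * i ^+ 2 * (v - 1) * (a j - (v - 1) * t%:c))) <=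
     K' * (2 * pi * A * V * (A + V) * 4) * I2 * dec R N n.
    have h : nrm (a j - (v - 1) * t%:c) <= (A + V) * (1 + `|t|).
      apply: le_trans (nrmB _ _) _; rewrite [leRHS]mulrDl lerD //.
        by apply: le_trans aa _; rewrite ler_peMr.
      by rewrite nrmM nrm_real -/V ler_wpM2l.
    rewrite nrmM; have h2 : nrm (2 * cpi R * a j * t%:c * i ^+ 2 * (v - 1) * (a j - (v - 1) * t%:c))
      <= 2 * pi * A * (1 + `|t|) * I2 * V * ((A + V) * (1 + `|t|)).
      rewrite nrmM ler_pM ?nrm_ge0 // nrmM -/V ler_wpM2r // nrmM nrmX ni -/I2 ler_wpM2r //.
      rewrite nrmM nrm_real ler_pM ?nrm_ge0 // nrmM nrmM nrm_cpi nrm_nat ler_wpM2l // mulr_ge0 //.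
    apply: le_trans (ler_pM (nrm_ge0 _) (nrm_ge0 _) gb h2) _.
    have -> : K' * q * (2 * pi * A * (1 + `|t|) * I2 * V * ((A + V) * (1 + `|t|))) =
      K' * (2 * pi * A * V * (A + V)) * I2 * ((1 + `|t|) ^+ 2 * q) by ring.
    have -> : K' * (2 * pi * A * V * (A + V) * 4) * I2 * dec R N n =
      K' * (2 * pi * A * V * (A + V)) * I2 * (4 * dec R N n) by ring.
    by rewrite ler_wpM2l // !mulr_ge0 // addr_ge0.
  apply: le_trans (nrmD _ _) _.
  have -> : B / N%:R ^+ 2 * dec R N n = K * (A + V) * I2 * dec R N n + K * V * I2 * dec R N n
     + K' * (2 * pi * A * V * (A + V) * 4) * I2 * dec R N n.
    by rewrite /B /I2; field; rewrite gt_eqF.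
  by apply: lerD => //; apply: le_trans (nrmB _ _) _; apply: lerD.
have := tele Np hG hH hE hs0 hsN.
by rewrite /cN mulrCA.
Qed.
End Poisson.

(** * Additive characters and finite Fourier analysis *)

Section Fourier.
Variable R : realType.
Notation C := (R[i]).
Local Notation "x %:c" := (x%:C%C : C) (at level 2, format "x %:c").
Implicit Types (v w z : C) (N : nat) (n m : int).

(** Up to 4/5 the cubic error bound for the sine suffices; beyond, the sine is nondecreasing and
    already above 1/4, while x/8 stays below it. *)
Lemma sin_ge8 (x : R) : 0 <= x <= pi / 2 -> x / 8 <= sin x.
Proof.
move=> /andP[x0 xp].
have small (y : R) : 0 <= y <= 4 / 5 -> 9 / 25 * y <= sin y.
  move=> /andP[y0 y1]; have := sin_sub y; rewrite ler_norml => /andP[h _].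
  rewrite (ger0_norm y0) in h.
  have y2 : y ^+ 2 <= (4 / 5) ^+ 2 by rewrite ler_pXn2r ?nnegrE //; lra.
  have := ler_wpM2r y0 y2; lra.
have [xs|xl] := leP x (4 / 5).
  by have := small x; rewrite x0 xs => /(_ isT); lra.
have s1 := small (4 / 5) ltac:(lra).
have [c cy] := @MVT R (@sin R) (@cos R) (4 / 5) x xl
  (fun x _ => is_derive_sin x) (continuous_subspaceT (@continuous_sin R)).
have c0 : 0 <= cos c.
  move: cy; rewrite in_itv /= => /andP[c0 c1]; apply: cos_ge0_pihalf.
  by apply/andP; split; have := pi_ge0 R; lra.
move=> e; have : 0 <= cos c * (x - 4 / 5) by rewrite mulr_ge0 //; lra.
have := pihalf_lt2 R; lra.
Qed.

Definition Ci : C := Complex 0 1.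
Lemma Ci2 : Ci ^+ 2 = -1. Proof. by rewrite /Ci expr2; simpc. Qed.
Definition ee z : C := cexp (2 * cpi R * Ci * z).
Lemma eeD z w : ee (z + w) = ee z * ee w. Proof. by rewrite /ee mulrDr cexpD. Qed.
Lemma ee0 : ee 0 = 1. Proof. by rewrite /ee mulr0 cexp0. Qed.
Lemma eeN z : ee (- z) = (ee z)^-1. Proof. by rewrite /ee mulrN cexpN. Qed.
Lemma ee_neq0 z : ee z != 0. Proof. exact: cexp_neq0. Qed.
Lemma eeX z k : ee (k%:R * z) = ee z ^+ k.
Proof. by rewrite /ee mulrCA cexpX. Qed.
Lemma ee_real (r : R) : ee r%:c = Complex (cos (2 * pi * r)) (sin (2 * pi * r)).
Proof.
rewrite /ee; have -> : 2 * cpi R * Ci * r%:c = Complex 0 (2 * pi * r).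
  have -> : 2 = (2 : R)%:c by rewrite rmorph_nat.
  by rewrite /cpi /Ci; simpc; congr Complex; ring.
by rewrite /cexp /= expR0 !mul1r.
Qed.
Lemma ee_int n : ee n%:~R = 1.
Proof.
have -> : n%:~R = (n%:~R : R)%:c by rewrite rmorph_int.
by rewrite ee_real -(cexp_2pi R n) /cexp /= expR0 !mul1r.
Qed.
Lemma nrm_ee z : nrm (ee z) = expR (- (2 * pi * complex.Im z)).
Proof.
rewrite /ee nrm_cexp; congr expR; case: z => a b /=; ring.
Qed.
Lemma nrm_ee_real (r : R) : nrm (ee r%:c) = 1.
Proof. by rewrite nrm_ee /= mulr0 oppr0 expR0. Qed.

Lemma sin_pi_lb (r : R) : `|r| <= 1 / 2 -> r ^+ 2 / 16 <= sin (pi * r) ^+ 2.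
Proof.
wlog r0 : r / 0 <= r.
  move=> H; have [r0|r0] := leP 0 r; first exact: H.
  by move=> h; have := H (- r); rewrite normrN mulrN sinN !sqrrN; apply => //; lra.
rewrite ger0_norm // => r1; have p0 := pi_ge2 R; have pp := pi_gt0 R.
have hh : 0 <= pi * r <= pi / 2.
  by rewrite mulr_ge0 ?(ltW pp) //= ler_pM2l //; lra.
have h := sin_ge8 hh.
have -> : r ^+ 2 / 16 = (r / 4) ^+ 2 by field.
have pr : 2 * r <= pi * r by rewrite ler_wpM2r.
have h2 : r / 4 <= sin (pi * r) by apply: le_trans h; lra.
have r4 : 0 <= r / 4 by rewrite divr_ge0.
by rewrite ler_pXn2r ?nnegrE // (le_trans r4).
Qed.

(** The modulus is 4 sin^2(pi r). *)
Lemma ee_second (r : R) : `|r| <= 1 / 2 -> r ^+ 2 / 4 <= nrm (ee r%:c + ee (- r)%:c - 2).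
Proof.
move=> hr; have h := sin_pi_lb hr; apply: le_trans (nrm_Re _).
rewrite !ee_real mulrN cosN !(ReD, ReN) /=.
have -> : 2 * pi * r = (pi * r) *+ 2 by ring.
rewrite cos_mulr2n cos2sin2.
set s := sin _ in h *.
have -> : (1 - s ^+ 2) *+ 2 - 1 + ((1 - s ^+ 2) *+ 2 - 1) - (1 + 1) = - (4 * s ^+ 2) by ring.
have s0 := sqr_ge0 s; rewrite normrN ger0_norm; lra.
Qed.

Lemma ee_neq1 (r : R) : 0 < `|r| < 1 -> ee r%:c != 1.
Proof.
have main (x : R) : 0 < x < 1 -> ee x%:c != 1.
  move=> /andP[x0 x1]; rewrite ee_real; apply/eqP => /(congr1 (@complex.Re R)) /=.
  have -> : 2 * pi * x = (pi * x) *+ 2 by ring.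
  rewrite cos_mulr2n cos2sin2 => h.
  have s0 : 0 < sin (pi * x).
    by rewrite sin_gt0_pi // mulr_gt0 ?pi_gt0 //= -[ltRHS]mulr1 ltr_pM2l ?pi_gt0.
  have := exprn_gt0 2 s0; rewrite -[_ *+ 2]mulr_natl in h; lra.
have [r0|r0] := leP 0 r; first by rewrite ger0_norm //; apply: main.
rewrite ltr0_norm // => /main; apply: contra => /eqP h.
by rewrite rmorphN eeN h invr1.
Qed.

Lemma ee_geosum (N : nat) n : (`|n| < N)%N -> n != 0 ->
  \sum_(k < N) ee (k%:R * (rt R N n)%:c) = 0.
Proof.
move=> nN n0; have N0 : (0 < N)%N by lia.
have NR : 0 < N%:R :> R by rewrite ltr0n.
have x1 : ee (rt R N n)%:c != 1.
  apply: ee_neq1; rewrite /rt normrM normfV normr_nat -intr_norm.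
  rewrite divr_gt0 ?ltr0z ?normr_gt0 // ltr_pdivrMr // mul1r.
  by rewrite -abszE -[N%:R]/(N%:Z%:~R) ltr_int; lia.
have xN : ee (rt R N n)%:c ^+ N = 1.
  rewrite -eeX; transitivity (ee n%:~R : C); last exact: ee_int.
  congr ee.
  have -> : N%:R = (N%:R : R)%:c by rewrite rmorph_nat.
  by rewrite -rmorphM /rt mulrC divfK ?gt_eqF // rmorph_int.
rewrite (eq_bigr (fun k : 'I_N => ee (rt R N n)%:c ^+ k)); last by move=> k _; rewrite eeX.
have := subrX1 (ee (rt R N n)%:c) N; rewrite xN subrr => /esym/eqP.
by rewrite mulf_eq0 subr_eq0 (negPf x1) => /eqP.
Qed.

Lemma hasumZ_pred (a : int -> C) s : hasumZ a s -> hasumZ (fun n => a (n - 1)) s.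
Proof.
move=> hs e e0; have [M hM] := hs _ e0; exists M.+1 => m n hm hn.
have := hM m.+1 n.-1; rewrite (_ : (m.+1 + n.-1 = m + n)%N); last by lia.
rewrite (eq_bigr (fun i : 'I_(m + n) => a (i%:Z - m%:Z - 1))); last first.
  by move=> i _; congr a; lia.
by apply; lia.
Qed.

Lemma hasumZ_sum (I : Type) (r : seq I) (a : I -> int -> C) (s : I -> C) :
  (forall i, hasumZ (a i) (s i)) -> hasumZ (fun n => \sum_(i <- r) a i n) (\sum_(i <- r) s i).
Proof.
move=> h; elim: r => [|i r IH].
  rewrite big_nil => e e0; exists 0%N => m n _ _; rewrite subr0 big1 ?nrm0 ?(ltW e0) // => k _.
  by rewrite big_nil.
rewrite big_cons; apply: hasumZ_ext (hasumZD (h i) IH) _ => n; by rewrite big_cons.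
Qed.
End Fourier.

Section Poisson.
Variable R : realType.
Notation C := (R[i]).
Local Notation "x %:c" := (x%:C%C : C) (at level 2, format "x %:c").
Implicit Types (v w z : C) (N : nat) (n m : int).
Local Notation Ci := (Ci R).

Lemma cone_neq0 v : cone v -> v != 0.
Proof. by move=> cv; apply/eqP => v0; move: cv; rewrite v0 /cone /= normr0 ltxx. Qed.

Lemma cone_inv v : cone v -> cone v^-1.
Proof.
move=> cv; have v0 := cone_neq0 cv; move: cv v0; rewrite /cone; case: v => x y /= xy v0.
have p : 0 < x ^+ 2 + y ^+ 2.
  by rewrite ltr_wpDr ?sqr_ge0 // exprn_gt0 // (le_lt_trans _ xy).
by rewrite -mulNr normrM [X in _ * X < _]ger0_norm ?invr_ge0 ?(ltW p) // normrN ltr_pM2r ?invr_gt0.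
Qed.

(** [Sx] and [Th] are the two sides of Poisson's formula, the sums of gauss(v(n + x)) and of
    gauss(m/v) e^(2 pi i m x); they should agree up to the factor v. *)
Definition Sx v (x : R) : C := zsum (gsamp v (v * x%:c) 1).
Definition ghat v m : C := gauss (v^-1 * m%:~R).
Definition Th v (x : R) : C := zsum (fun m => ghat v m * ee (m%:~R * x%:c)).

Lemma Sx_has v (x : R) : cone v -> hasumZ (gsamp v (v * x%:c) 1) (Sx v x).
Proof.
move=> cv; have [K _ h] := gsamp_bound cv (nrm_ge0 (v * x%:c)).
have [s hs _] := riem (isT : (0 < 1)%N) (fun n => h _ 1%N n (lexx _)).
by rewrite /Sx (zsumE hs).
Qed.

Lemma rt1 n : rt R 1 n = n%:~R. Proof. by rewrite /rt divr1. Qed.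
Lemma intC n : (n%:~R : R)%:c = n%:~R. Proof. by rewrite rmorph_int. Qed.
Lemma ghatE v m : ghat v m = gsamp v^-1 0 1 m.
Proof. by rewrite /ghat /gsamp rt1 intC addr0. Qed.
Lemma ghat_bound v : cone v -> exists2 K : R, 0 <= K & forall m, nrm (ghat v m) <= K * dec R 1 m.
Proof.
move=> cv; have [K K0 h] := gsamp_bound (cone_inv cv) (lexx 0).
by exists K => // m; rewrite ghatE h // nrm0.
Qed.
Lemma intCM m (x : R) : m%:~R * x%:c = (m%:~R * x)%:c.
Proof. by rewrite [RHS]rmorphM [X in _ = X * _]intC. Qed.
Lemma Th_has v (x : R) : cone v -> hasumZ (fun m => ghat v m * ee (m%:~R * x%:c)) (Th v x).
Proof.
move=> cv; have [K K0 h] := ghat_bound cv.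
have hb m : nrm (ghat v m * ee (m%:~R * x%:c)) <= K * dec R 1 m.
  by rewrite nrmM intCM nrm_ee_real mulr1.
have [s hs _] := riem (isT : (0 < 1)%N) hb; by rewrite /Th (zsumE hs).
Qed.

(** [Af] is the Riemann sum, with step 1/N, of the m-th Fourier coefficient of [Sx]. *)
Definition fsamp v m N n : C := gauss (v * (rt R N n)%:c) * ee (- (m%:~R * (rt R N n)%:c)).
Definition Af v m N : C := N%:R^-1 * zsum (fsamp v m N).

(** Completing the square turns a modulation into a complex shift, so that [gN_shift] compares [Af]
    with [cN] times [ghat]. *)
Lemma gauss_modulate v m z : v != 0 ->
  gauss (v * z) * ee (- (m%:~R * z)) = ghat v m * gauss (v * z + v * (Ci * m%:~R / v ^+ 2)).
Proof.
move=> v0; rewrite /ghat /gauss /ee -!cexpD; congr cexp.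
have e : Ci ^+ 2 = -1 by exact: Ci2.
have -> : (v * z + v * (Ci * m%:~R / v ^+ 2)) ^+ 2 =
  v ^+ 2 * z ^+ 2 + 2 * Ci * m%:~R * z + Ci ^+ 2 * m%:~R ^+ 2 / v ^+ 2 by field.
rewrite e; field; exact: v0.
Qed.

Lemma fsampE v m N n : v != 0 ->
  fsamp v m N n = ghat v m * gsamp v (v * (Ci * m%:~R / v ^+ 2)) N n.
Proof. by move=> v0; rewrite /fsamp gauss_modulate. Qed.

Lemma fsamp_has v m N : cone v -> (0 < N)%N ->
  hasumZ (fsamp v m N) (zsum (fsamp v m N)) /\ Af v m N = ghat v m * gN v (v * (Ci * m%:~R / v ^+ 2)) N.
Proof.
move=> cv N0; have v0 := cone_neq0 cv; set w := v * _.
have [K _ h] := gsamp_bound cv (nrm_ge0 w).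
have [s hs _] := riem N0 (fun n => h _ N n (lexx _)).
have h2 : hasumZ (fsamp v m N) (ghat v m * s).
  by apply: hasumZ_ext (hasumZZl _ hs) _ => n; rewrite fsampE.
by rewrite /Af (zsumE h2) /gN (zsumE hs); split=> //; rewrite mulrCA.
Qed.

(** Grouping the samples by residue modulo N, the character depends on the residue only and each
    group sums to a value of [Sx]: [Af] is a discrete Fourier transform. *)
Lemma Af_fourier v m N : cone v -> (0 < N)%N ->
  Af v m N = N%:R^-1 * \sum_(l < N) Sx v (l%:R / N%:R) * ee (- (m%:~R * (l%:R / N%:R : R)%:c)).
Proof.
move=> cv N0; have NR : 0 < N%:R :> R by rewrite ltr0n.
have [h _] := fsamp_has m cv N0; rewrite /Af; congr (_ * _).
apply: hasumZ_uniq (hasumZ_group N0 h) _.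
pose s (l : 'I_N) := ee (- (m%:~R * (l%:R / N%:R : R)%:c)) * Sx v (l%:R / N%:R).
have -> : \sum_(l < N) Sx v (l%:R / N%:R) * ee (- (m%:~R * (l%:R / N%:R : R)%:c)) = \sum_(l < N) s l.
  by apply: eq_bigr => l _; rewrite mulrC.
have hh (l : 'I_N) : hasumZ (fun n => ee (- (m%:~R * (l%:R / N%:R : R)%:c)) * gsamp v (v * (l%:R / N%:R : R)%:c) 1 n) (s l).
  exact: hasumZZl (Sx_has _ cv).
apply: (hasumZ_ext (hasumZ_sum (index_enum _) hh)) => n.
apply: eq_bigr => l _; rewrite /gsamp /fsamp mulrC rt1.
have -> : rt R N (n * N%:Z + l%:Z) = n%:~R + l%:R / N%:R.
  by rewrite /rt intrD intrM mulrDl mulfK // gt_eqF.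
have -> : (n%:~R + l%:R / N%:R : R)%:c = n%:~R + (l%:R / N%:R : R)%:c.
  by rewrite -[X in _ = X + _]intC -rmorphD.
rewrite mulrDr mulrDr opprD eeD intC.
have -> : - (m%:~R * n%:~R) = (- (m * n))%:~R :> C by rewrite mulrNz intrM.
by rewrite ee_int mul1r.
Qed.
End Poisson.

Section Poisson.
Variable R : realType.
Notation C := (R[i]).
Local Notation "x %:c" := (x%:C%C : C) (at level 2, format "x %:c").
Implicit Types (v w z : C) (N : nat) (n m : int).

(** Discrete Fourier inversion over the symmetric window from -L to L - 1, where |m| <= N/2 as
    [Af_decay] requires. *)
Lemma Af_inv v L j : cone v -> (j < L + L)%N ->
  \sum_(k < L + L) Af v (k%:Z - L%:Z) (L + L) * ee ((k%:Z - L%:Z)%:~R * (j%:R / (L + L)%:R : R)%:c)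
   = Sx v (j%:R / (L + L)%:R).
Proof.
move=> cv; set N := (L + L)%N => jN; have N0 : (0 < N)%N by lia.
have NR : N%:R != 0 :> C by rewrite pnatr_eq0; lia.
pose q (l : nat) : C := (rt R N (j%:Z - l%:Z))%:c.
rewrite (eq_bigr (fun k : 'I_N => \sum_(l < N) N%:R^-1 * Sx v (l%:R / N%:R) *
   ee (- (L%:R * q l)) * ee (k%:R * q l))); last first.
  move=> k _; rewrite Af_fourier // mulr_sumr mulr_suml; apply: eq_bigr => l _.
  rewrite -!mulrA; congr (_ * (_ * _)); rewrite -!eeD; congr ee.
  have -> : q l = (j%:R / N%:R : R)%:c - (l%:R / N%:R : R)%:c.
    by rewrite /q /rt intrB mulrBl rmorphB.
  by rewrite intrB; ring.
rewrite exchange_big /= (bigD1 (Ordinal jN)) //= [X in _ + X]big1 ?addr0 => [|l ljN].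
  rewrite -mulr_sumr /q subrr /rt mul0r rmorph0 mulr0 oppr0 ee0 mulr1.
  rewrite (eq_bigr (fun=> 1)) => [|k _]; last by rewrite mulr0 ee0.
  rewrite sumr_const card_ord mulrAC mulVf // mul1r //.
rewrite -mulr_sumr /q ee_geosum ?mulr0 //.
  by have := ltn_ord l; lia.
by apply: contra ljN => h; apply/eqP/val_inj => /=; lia.
Qed.

(* The second difference of the samples is O(1/N^2), and it multiplies the m-th
   Fourier coefficient by 2 cos(2 pi m / N) - 2. *)
Lemma Af_decay v : cone v -> exists2 K : R, 0 <= K & exists N0, forall N m, (N0 < N)%N -> (2 * `|m| <= N)%N ->
  m != 0 -> nrm (Af v m N) <= K / m%:~R ^+ 2.
Proof.
move=> cv; have D0 := nrm_ge0 v.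
have [K [e0 [K0 e00 hst]]] := gauss_step (cone_sq cv) (nrm_ge0 v) (lexx 0) D0.
have [N0 hN0] := natinv_small e00.
exists (32 * K); first by rewrite mulr_ge0.
exists N0 => N m hN mN m0; have Np : (0 < N)%N by lia.
have NR : 0 < N%:R :> R by rewrite ltr0n.
have Ni0 : 0 <= N%:R^-1 :> R by rewrite invr_ge0 ltW.
have ein : 0 <= (N%:R^-1 : R) <= e0 by rewrite Ni0 /= hN0.
have [hF _] := fsamp_has m cv Np.
set F := fsamp v m N in hF *; set s := zsum F in hF *.
set r := rt R N m; pose q := ee r%:c; pose q' := ee (- r)%:c.
pose i : C := (N%:R^-1 : R)%:c.
have ni : nrm i = N%:R^-1 by rewrite nrm_real ger0_norm.
(* The phases q and q' undo the change of the character under a step of 1/N, so that each summand is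
   a second difference of the Gaussian times a number of modulus 1. *)
have h1 := hasumZD (hasumZD (hasumZZl q (hasumZ_shift 1 hF)) (hasumZZl q' (hasumZ_pred hF))) (hasumZZl (-2) hF).
have hb n : nrm (q * F (n + 1%N) + q' * F (n - 1) + -2 * F n) <= 2 * K * N%:R^-1 ^+ 2 * dec R N n.
  set t := rt R N n; set y := v * t%:c.
  have T1 : 1 <= 1 + `|t| by rewrite lerDl.
  have E (d : C) : nrm d <= N%:R^-1 * nrm v -> nrm (gauss (y + d) - gauss y * (1 - 2 * cpi R * y * d)) <= K * N%:R^-1 ^+ 2 * dec R N n.
    move=> hd; have := hst v 0 d t N%:R^-1 (lexx _) (lexx _) ltac:(by rewrite nrm0) ein.
    rewrite addr0 -/y => H; apply: le_trans (H _) _.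
      by apply: le_trans hd _; rewrite ler_peMr // mulr_ge0.
    rewrite ler_wpM2l ?exp2_dec // mulr_ge0 // sqr_ge0 //.
  have E1 := E (i * v) ltac:(by rewrite nrmM ni).
  have E2 := E (- (i * v)) ltac:(by rewrite nrmN nrmM ni).
  pose u := ee (- (m%:~R * t%:c)).
  have nu : nrm u = 1 by rewrite /u intCM -rmorphN nrm_ee_real.
  have mi : m%:~R * i = r%:c by rewrite intCM.
  have e1 : q * F (n + 1%N) = gauss (y + i * v) * u.
    rewrite /F /fsamp rtS // -/t rmorphD -/i.
    have -> : v * (t%:c + i) = y + i * v by rewrite /y; ring.
    by rewrite mulrDr opprD eeD mi /u /q mulrCA; congr (_ * _); rewrite mulrCA [ee (- r%:c)]eeN mulfV ?mulr1 ?ee_neq0.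
  have e2 : q' * F (n - 1) = gauss (y + - (i * v)) * u.
    have tm : rt R N (n - 1) = t - N%:R^-1 by rewrite /t /rt intrB mulrBl div1r.
    rewrite /F /fsamp tm rmorphB -/i.
    have -> : v * (t%:c - i) = y + - (i * v) by rewrite /y; ring.
    rewrite mulrBr opprB eeD mi /u /q' mulrCA; congr (_ * _).
    by rewrite rmorphN eeN mulrA mulVf ?mul1r ?ee_neq0.
  have e3 : F n = gauss y * u by [].
  rewrite e1 e2 e3.
  have -> : gauss (y + i * v) * u + gauss (y + - (i * v)) * u + -2 * (gauss y * u) =
    u * ((gauss (y + i * v) - gauss y * (1 - 2 * cpi R * y * (i * v))) +
         (gauss (y + - (i * v)) - gauss y * (1 - 2 * cpi R * y * - (i * v)))) by ring.
  rewrite nrmM nu mul1r; apply: le_trans (nrmD _ _) _.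
  have -> : 2 * K * N%:R^-1 ^+ 2 * dec R N n = K * N%:R^-1 ^+ 2 * dec R N n + K * N%:R^-1 ^+ 2 * dec R N n by ring.
  exact: lerD.
have [s' hs' bs'] := riem Np hb.
have es : s' = (q + q' - 2) * s by rewrite (hasumZ_uniq hs' h1); ring.
have r1 : `|r| <= 1 / 2.
  have hm : (2 * `|m|)%:R <= N%:R :> R by rewrite ler_nat.
  have am : `|m%:~R| = (`|m|%N)%:R :> R by rewrite -intr_norm -abszE.
  by rewrite /r /rt normrM normfV normr_nat am ler_pdivrMr //; rewrite natrM in hm; lra.
have q2 := ee_second r1; rewrite -/q -/q' in q2.
rewrite es nrmM in bs'.
have h2 := le_trans (ler_wpM2r (nrm_ge0 s) q2) bs'.
have mR : 0 < m%:~R ^+ 2 :> R by rewrite exprn_even_gt0 //= intr_eq0.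
rewrite /Af nrmM nrmV nrm_nat -/F -/s ler_pdivlMr //.
have -> : N%:R^-1 * nrm s * m%:~R ^+ 2 = 4 * N%:R * (r ^+ 2 / 4 * nrm s).
  by rewrite /r /rt; field; rewrite gt_eqF.
have -> : 32 * K = 4 * N%:R * (4 * N%:R * (2 * K * N%:R^-1 ^+ 2)).
  by field; rewrite gt_eqF.
by rewrite ler_pM2l // mulr_gt0.
Qed.

Lemma invsq_tail (M L : nat) : (0 < M)%N ->
  \sum_(M <= i < M + L) (i.+1%:R ^+ 2)^-1 <= M%:R^-1 - (M + L)%:R^-1 :> R.
Proof.
move=> M0; elim: L => [|L IH]; first by rewrite addn0 big_geq // subrr.
rewrite addnS big_nat_recr ?leq_addr //=.
have x0 : 0 < (M + L)%:R :> R by rewrite ltr0n; lia.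
have e : (M + L).+1%:R = (M + L)%:R + 1 :> R by rewrite natr1.
rewrite e; set x := (M + L)%:R in IH x0 *; clearbody x.
have h : ((x + 1) ^+ 2)^-1 <= x^-1 - (x + 1)^-1.
  have x1 : 0 < x + 1 by lra.
  have -> : x^-1 - (x + 1)^-1 = (x * (x + 1))^-1 by field; rewrite (gt_eqF x0) (gt_eqF x1).
  by rewrite lef_pV2 ?posrE ?exprn_gt0 ?mulr_gt0 // expr2 ler_pM2r //; lra.
lra.
Qed.

(** Dominated convergence with majorant K/i^2: the tail is uniformly small by [invsq_tail], and
    finitely many terms remain. *)
Lemma tannery_nat (b : nat -> nat -> C) (K : R) (L1 : nat) : 0 <= K ->
  (forall i (e : R), 0 < e -> exists L0, forall L, (L0 < L)%N -> nrm (b L i) <= e) ->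
  (forall L i, (L1 < L)%N -> (i < L)%N -> (0 < i)%N -> nrm (b L i) <= K / i%:R ^+ 2) ->
  forall e : R, 0 < e -> exists L0, forall L, (L0 < L)%N -> nrm (\sum_(i < L) b L i) <= e.
Proof.
move=> K0 hl hb e e0; have e2 : 0 < e / 2 by rewrite divr_gt0.
have e3 : 0 < e / 2 / (K + 1) by rewrite divr_gt0 // ltr_wpDl.
have [M hM] := natinv_small e3; set M1 := M.+1.
have h1 q p : (0 < q)%N -> exists L0, forall L, (L0 < L)%N -> forall i, (i < p)%N -> nrm (b L i) <= e / 2 / q%:R.
  move=> q0; elim: p => [|p IH]; first by exists 0%N.
  have [L0 h0] := IH; have [L2 h2] := hl p (e / 2 / q%:R) ltac:(by rewrite divr_gt0 // ltr0n).
  exists (L0 + L2)%N => L hL i; rewrite ltnS leq_eqVlt => /orP[/eqP->|ip].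
    by apply: h2; lia.
  by apply: h0 => //; lia.
have [L0 h0] := h1 M1.+1 M1.+1 isT; exists (L0 + L1 + M1.+1)%N => L hL.
rewrite -(big_mkord predT) (big_cat_nat (n := M1.+1)) //=; last by lia.
apply: le_trans (nrmD _ _) _; rewrite (_ : e = e / 2 + e / 2); last by field.
apply: lerD.
  rewrite big_mkord; apply: le_trans (nrm_sum _ _ _) _.
  apply: (@le_trans _ _ (\sum_(i < M1.+1) e / 2 / M1.+1%:R)).
    by apply: ler_sum => i _; apply: h0 => //; lia.
  by rewrite sumr_const card_ord -[_ *+ _]mulr_natr divfK // pnatr_eq0.
apply: le_trans (nrm_sum _ _ _) _.
apply: (@le_trans _ _ (\sum_(M1.+1 <= i < L) K / i%:R ^+ 2)).
  by rewrite !big_seq; apply: ler_sum => i; rewrite mem_index_iota => hi; apply: hb; lia.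
rewrite -mulr_sumr big_add1 /=.
have -> : L.-1 = (M1 + (L.-1 - M1))%N by lia.
have h := invsq_tail (L.-1 - M1) (isT : (0 < M1)%N).
have h3 := hM M1 (leqnn _).
have p0 : 0 <= (M1 + (L.-1 - M1))%:R^-1 :> R by rewrite invr_ge0.
apply: le_trans (ler_wpM2l K0 (le_trans h _)) _.
  by apply: le_trans h3; lra.
rewrite mulrCA ler_piMr ?(ltW e2) // ler_pdivrMr ?ltr_wpDl // mul1r; lra.
Qed.
End Poisson.

(** * Passage to the limit and theta inversion *)

Section Poisson.
Variable R : realType.
Notation C := (R[i]).
Local Notation "x %:c" := (x%:C%C : C) (at level 2, format "x %:c").
Implicit Types (v w z : C) (N : nat) (n m : int).

Lemma cN_bound v : cone v -> exists2 K : R, 0 <= K & forall N, (0 < N)%N -> nrm (cN v N) <= K.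
Proof.
move=> cv; have [K K0 h] := gsamp_bound cv (lexx 0).
exists (4 * K); first by rewrite mulr_ge0.
move=> N N0; have NR : 0 < N%:R :> R by rewrite ltr0n.
have [s hs bs] := riem N0 (fun n => h 0 N n ltac:(by rewrite nrm0)).
by rewrite /cN (zsumE hs) nrmM nrmV nrm_nat mulrC ler_pdivrMr // mulrAC.
Qed.

Lemma dec_sq (i : nat) m : (0 < i)%N -> (i <= `|m|)%N -> dec R 1 m <= 4 / i%:R ^+ 2.
Proof.
move=> i0 im; have iR : 0 < i%:R :> R by rewrite ltr0n.
have h : dec R 1 m <= expR (- i%:R).
  rewrite /dec rt1 ler_expR lerN2 -intr_norm -abszE -[(`|m|%:Z)%:~R]/(`|m|%N%:R).
  by rewrite ler_nat.
apply: le_trans h _; have -> : - i%:R = - (i%:R / 2 + i%:R / 2) :> R by field.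
rewrite expRN expRD -[leLHS]div1r ler_pdivrMr ?mulr_gt0 ?expR_gt0 // mulrAC ler_pdivlMr ?exprn_gt0 // mul1r.
have e : i%:R / 2 <= expR (i%:R / 2) :> R by have := expR_ge1Dx (i%:R / 2 : R); lra.
have i2 : 0 <= i%:R / 2 :> R by rewrite divr_ge0.
have := ler_pM i2 i2 e e; lra.
Qed.

(** By Fourier inversion [Sx] is a sum of the [Af]; each is close to [cN] times [ghat], and both are
    dominated by a multiple of 1/m^2. *)
Lemma poisson_lim v (x : R) : cone v -> x = 0 \/ x = 1 / 2 ->
  forall e : R, 0 < e -> exists L0, forall L, (L0 < L)%N ->
  nrm (Sx v x - cN v (L + L) * Th v x) <= e.
Proof.
move=> cv hx e e0.
have [K1 K10 [N1 h1]] := Af_decay cv.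
have [K2 K20 h2] := ghat_bound cv.
have [K3 K30 h3] := cN_bound cv.
pose b L m : C := (Af v m (L + L) - cN v (L + L) * ghat v m) * ee (m%:~R * x%:c).
have nee m : nrm (ee (m%:~R * x%:c)) = 1 by rewrite intCM nrm_ee_real.
have bpt m (d : R) : 0 < d -> exists L0, forall L, (L0 < L)%N -> nrm (b L m) <= d.
  move=> d0; have [B [N0 hB]] := gN_shift (Ci R * m%:~R / v ^+ 2) cv.
  have g0 := nrm_ge0 (ghat v m).
  have dd : 0 < d / (nrm (ghat v m) * `|B| + 1) by rewrite divr_gt0 // ltr_wpDl // mulr_ge0.
  have [M hM] := natinv_small dd.
  exists (N0 + M)%N => L hL; have Lp : (0 < L + L)%N by clear -hL; lia.
  have [_ ea] := fsamp_has m cv Lp.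
  rewrite /b nrmM nee mulr1 ea [X in _ - X]mulrC -mulrBr nrmM.
  have := hB (L + L)%N ltac:(clear -hL; lia); set u := nrm (_ - _) => hu.
  have hm := hM (L + L)%N ltac:(clear -hL; lia).
  have i0 : 0 <= (L + L)%:R^-1 :> R by rewrite invr_ge0.
  apply: le_trans (ler_wpM2l g0 hu) _.
  have hB2 : B / (L + L)%:R <= `|B| * (L + L)%:R^-1 by rewrite ler_wpM2r // ler_norm.
  apply: le_trans (ler_wpM2l g0 hB2) _; rewrite mulrA.
  apply: le_trans (ler_wpM2l _ hm) _; first by rewrite mulr_ge0.
  rewrite mulrCA ler_piMr ?(ltW d0) // ler_pdivrMr ?mul1r ?lerDl //.
  by rewrite ltr_wpDl // mulr_ge0.
have bbd L i m : (N1 < L)%N -> (0 < i)%N -> (i <= `|m|)%N -> (`|m| <= L)%N -> nrm (b L m) <= (K1 + K3 * K2 * 4) / i%:R ^+ 2.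
  move=> hL i0 im mL; rewrite /b nrmM nee mulr1.
  have iR : 0 < i%:R ^+ 2 :> R by rewrite exprn_gt0 // ltr0n.
  apply: le_trans (nrmB _ _) _; rewrite mulrDl; apply: lerD.
    apply: le_trans (h1 (L + L)%N m _ _ _) _; [lia|lia|lia|].
    rewrite ler_wpM2l // lef_pV2 ?posrE //; last by rewrite exprn_even_gt0 //= intr_eq0; lia.
    have -> : m%:~R ^+ 2 = (`|m|%N)%:R ^+ 2 :> R.
      by rewrite -(real_normK (num_real m%:~R)) -intr_norm -abszE.
    by rewrite ler_pXn2r ?nnegrE ?ler0n // ler_nat.
  rewrite nrmM -!mulrA; apply: ler_pM; rewrite ?nrm_ge0 //; first by apply: h3; lia.
  by apply: le_trans (h2 m) _; rewrite ler_wpM2l // dec_sq.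
have K0 : 0 <= K1 + K3 * K2 * 4 by rewrite addr_ge0 // !mulr_ge0.
have e3 : 0 < e / 3 by rewrite divr_gt0.
have [L1 t1] := tannery_nat (b := fun L i => b L i%:Z) K0 (fun i => bpt i%:Z)
  (fun L i (h : (N1 < L)%N) hi i0 => bbd L i i%:Z h i0 (leqnn _) (ltnW hi)) e3.
have [L2 t2] := tannery_nat (b := fun L i => b L (Negz i)) (L1 := N1) K0 (fun i => bpt (Negz i))
  ltac:(by move=> L i h hi i0; apply: bbd; clear -h hi i0; lia) e3.
have K31 : 0 < e / 3 / (K3 + 1) by rewrite divr_gt0 // ltr_wpDl.
have [M hM] := Th_has x cv K31.
exists (L1 + L2 + M)%N => L hL.
have S1 : nrm (\sum_(k < L + L) b L (k%:Z - L%:Z)) <= e / 3 + e / 3.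
  by rewrite sumZ_split; apply: le_trans (nrmD _ _) _; apply: lerD; [apply: t1 | apply: t2]; clear -hL; lia.
have [j jL ej] : exists2 j : nat, (j < L + L)%N & x = j%:R / (L + L)%:R.
  case: hx => ->; first by exists 0%N; [clear -hL; lia | rewrite mul0r].
  exists L; first (by clear -hL; lia); have LR : 0 < L%:R :> R by rewrite ltr0n; clear -hL; lia.
  by rewrite natrD; move: LR; set y := L%:R; clearbody y => LR; field; rewrite gt_eqF //; lra.
have inv := Af_inv cv jL; rewrite -ej in inv.
have S2 := hM L L ltac:(clear -hL; lia) ltac:(clear -hL; lia).
set W := \sum_(i < L + L) ghat v _ * _ in S2.
have eS : Sx v x - cN v (L + L) * Th v x = \sum_(k < L + L) b L (k%:Z - L%:Z) + cN v (L + L) * (W - Th v x).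
  rewrite /W /b -inv mulrBr mulr_sumr addrA; congr (_ - _).
  by rewrite -big_split /=; apply: eq_bigr => k _; ring.
rewrite eS; apply: le_trans (nrmD _ _) _; rewrite (_ : e = e / 3 + e / 3 + e / 3); last by field.
apply: lerD => //; rewrite nrmM.
apply: le_trans (ler_pM (nrm_ge0 _) (nrm_ge0 _) (h3 (L + L)%N ltac:(clear -hL; lia)) S2) _.
rewrite mulrCA ler_piMr ?(ltW e3) // ler_pdivrMr ?ltr_wpDl // mul1r; lra.
Qed.

Lemma Th1_neq0 : Th (1 : C) 0 != 0.
Proof.
apply/eqP => h; have c1 := cone1 R.
have hT := Th_has 0 c1; rewrite h in hT.
have [M hM] := hT (1 / 2) ltac:(lra).
have := hM M.+1 M.+1 (leqnSn _) (leqnSn _); rewrite subr0 => hh.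
have := le_trans (le_trans (ler_norm _) (nrm_Re _)) hh; rewrite (Re_sum _ (fun k : nat => ghat (1 : C) (k%:Z - M.+1%:Z) * ee ((k%:Z - M.+1%:Z)%:~R * (0 : R)%:c))).
have tm (m : int) : complex.Re (ghat (1 : C) m * ee (m%:~R * (0 : R)%:c)) = expR (- (pi * m%:~R ^+ 2)).
  rewrite rmorph0 mulr0 ee0 mulr1 /ghat invr1 mul1r /gauss.
  have -> : - (cpi R * m%:~R ^+ 2) = (- (pi * m%:~R ^+ 2))%:c.
    by rewrite rmorphN rmorphM rmorphXn /= intC.
  by rewrite /cexp /= cos0 mulr1.
have jM : (M.+1 < M.+1 + M.+1)%N by lia.
rewrite (eq_bigr (fun k : 'I_(M.+1 + M.+1) => expR (- (pi * (k%:Z - M.+1%:Z)%:~R ^+ 2)) : R)); last first.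
  by move=> k _; exact: tm.
rewrite (bigD1 (Ordinal jM)) // [nat_of_ord _]/= subrr expr0n mulr0 oppr0 expR0.
rewrite leNgt => /negP; apply; apply: (@lt_le_trans _ _ 1); first lra.
by rewrite lerDl; apply: sumr_ge0 => i _; rewrite expR_ge0.
Qed.

Lemma Sx1_Th1 : Sx (1 : C) 0 = Th (1 : C) 0.
Proof.
rewrite /Sx /Th; congr zsum; apply/funext => n.
by rewrite /gsamp rt1 intC rmorph0 mulr0 addr0 mulr0 ee0 mulr1 /ghat invr1.
Qed.

(* The self-dual case v = 1 determines the limit of cN 1, and cN_scale transports
   it to the whole cone. *)
Theorem theta_inversion v (x : R) : cone v -> x = 0 \/ x = 1 / 2 -> v * Sx v x = Th v x.
Proof.
move=> cv hx; apply/eqP; rewrite -subr_eq0; apply/eqP.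
have c1 := cone1 R; have T0 := Th1_neq0.
have T1 : 0 < nrm (Th (1 : C) 0).
  by rewrite lt_def nrm_ge0 andbT; apply: contra T0 => /eqP/nrm_eq0->.
set t := nrm (Th (1 : C) 0) in T1; set T := nrm (Th v x).
have T2 : 0 <= T := nrm_ge0 _; have v0 := nrm_ge0 v.
apply: nrm_eps => e e0.
have d1 : 0 < e / 3 / (nrm v + 1) by rewrite !divr_gt0 // ltr_wpDl.
have d2 : 0 < e / 3 / (T + 1) * t by rewrite mulr_gt0 // !divr_gt0 // ltr_wpDl.
have d3 : 0 < e / 3 / (T + 1) by rewrite !divr_gt0 // ltr_wpDl.
have [L1 h1] := poisson_lim cv hx d1.
have [L2 h2] := poisson_lim c1 (or_introl (erefl 0)) d2.
have [B [N0 h3]] := cN_scale cv.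
have d4 : 0 < e / 3 / (T + 1) / (`|B| + 1) by rewrite divr_gt0 // ltr_wpDl.
have [N1 h4] := natinv_small d4.
pose L := (L1 + L2 + N0 + N1).+1; set N := (L + L)%N.
have [l1 l2 l3 l4] : [/\ (L1 < L)%N, (L2 < L)%N, (N0 < N)%N & (N1 < N)%N].
  by rewrite /N /L; clear; split; lia.
have {}h1 := h1 L l1; have {}h2 := h2 L l2; have {}h3 := h3 N l3; have {}h4 := h4 N l4.
rewrite -/N in h1 h2.
have a2 : nrm (1 - cN 1 N) <= e / 3 / (T + 1).
  rewrite Sx1_Th1 in h2; have E : Th (1 : C) 0 - cN 1 N * Th 1 0 = (1 - cN 1 N) * Th 1 0 by ring.
  by rewrite E nrmM -/t ler_pM2r in h2.
have a3 : nrm (v * cN v N - cN 1 N) <= e / 3 / (T + 1).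
  apply: le_trans h3 _; have i0 : 0 <= N%:R^-1 :> R by rewrite invr_ge0.
  apply: le_trans (ler_wpM2r i0 (ler_norm B)) _.
  apply: le_trans (ler_wpM2l (normr_ge0 _) h4) _.
  rewrite mulrCA ler_piMr ?(ltW d3) // ler_pdivrMr ?ltr_wpDl // mul1r; lra.
(* The three errors: Poisson at v, rotation from 1 to v, and the distance of [cN 1] from 1, which
   Poisson at v = 1 controls because Th(1) is nonzero. *)
have -> : v * Sx v x - Th v x = v * (Sx v x - cN v N * Th v x) + (v * cN v N - cN 1 N) * Th v x - (1 - cN 1 N) * Th v x by ring.
apply: le_trans (nrmB _ _) _; rewrite (_ : e = e / 3 + e / 3 + e / 3); last by field.
have k3 : e / 3 / (T + 1) * T <= e / 3.
  by rewrite -mulrA ler_piMr ?divr_ge0 ?(ltW e0) // mulrC ler_pdivrMr ?ltr_wpDl // mul1r; lra.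
have k1 : nrm v * (e / 3 / (nrm v + 1)) <= e / 3.
  by rewrite mulrCA ler_piMr ?divr_ge0 ?(ltW e0) // ler_pdivrMr ?ltr_wpDl // mul1r; lra.
apply: lerD; last by rewrite nrmM; apply: le_trans k3; rewrite ler_wpM2r.
apply: le_trans (nrmD _ _) _; apply: lerD; rewrite nrmM.
  by apply: le_trans k1; rewrite ler_wpM2l.
by apply: le_trans k3; rewrite ler_wpM2r.
Qed.
End Poisson.

(** * Evaluation of power series *)

Lemma leq_exp2r_w a b e : (a <= b)%N -> (a ^ e <= b ^ e)%N.
Proof. by case: e => [|e] h; rewrite ?expn0 // leq_exp2r. Qed.

(** Growth ensuring convergence for |z| < 1/B. The polynomial factor makes the class stable under
    products; B = 1 serves the modular forms, B = 3 their inverses. *)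
Definition bd (B : nat) (f : fps) := exists K d : nat, forall n, (`|f n| <= K * n.+1 ^ d * B ^ n)%N.

Lemma bdD B f g : bd B f -> bd B g -> bd B (f + g).
Proof.
move=> [K [d h]] [K' [d' h']]; exists (K + K')%N, (d + d')%N => n.
rewrite cfD; have : (absz (f n + g n)%R <= `|f n| + `|g n|)%N by lia.
move/leq_trans; apply; apply: leq_trans (leq_add (h n) (h' n)) _.
rewrite -mulnDl leq_mul2r; apply/orP; right.
by rewrite mulnDl leq_add // leq_mul2l leq_pexp2l ?orbT // ?leq_addr // leq_addl.
Qed.
Lemma bdN B f : bd B f -> bd B (- f).
Proof. by move=> [K [d h]]; exists K, d => n; rewrite cfN abszN. Qed.
Lemma absz_sum n (F : nat -> int) : (absz (\sum_(i < n) F i)%R <= \sum_(i < n) `|F i|)%N.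
Proof.
elim: n => [|n IH]; first by rewrite !big_ord0.
rewrite !big_ord_recr /=; apply: leq_trans (leq_add IH (leqnn _)).
by set x := (\sum_(i < n) F i)%R; lia.
Qed.
Lemma bdM B f g : bd B f -> bd B g -> bd B (f * g).
Proof.
move=> [K [d h]] [K' [d' h']]; exists (K * K')%N, (d + d').+1 => n.
rewrite cfM; apply: leq_trans (absz_sum _ (fun i => f i * g (n - i)%N)) _.
apply: (@leq_trans (\sum_(i < n.+1) K * K' * n.+1 ^ (d + d') * B ^ n)).
  apply: leq_sum => i _; rewrite abszM; have := ltn_ord i; rewrite ltnS => iN.
  apply: leq_trans (leq_mul (h i) (h' (n - i)%N)) _.
  have e1 : (i.+1 ^ d <= n.+1 ^ d)%N by rewrite leq_exp2r_w.
  have e2 : ((n - i).+1 ^ d' <= n.+1 ^ d')%N by rewrite leq_exp2r_w // ltnS leq_subr.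
  have -> : (B ^ n = B ^ i * B ^ (n - i))%N by rewrite -expnD subnKC.
  rewrite expnD.
  have -> : (K * i.+1 ^ d * B ^ i * (K' * (n - i).+1 ^ d' * B ^ (n - i)) =
   (K * K') * (i.+1 ^ d * (n - i).+1 ^ d') * (B ^ i * B ^ (n - i)))%N by ring.
  by rewrite leq_mul2r leq_mul2l leq_mul ?orbT.
rewrite sum_nat_const card_ord expnS; apply: eq_leq; ring.
Qed.
Lemma bd_mono B B' f : (B <= B')%N -> bd B f -> bd B' f.
Proof.
move=> BB [K [d h]]; exists K, d => n; apply: leq_trans (h n) _.
by rewrite leq_mul2l leq_exp2r_w ?orbT.
Qed.
Lemma bd1 B : bd B 1.
Proof. by exists 1%N, 0%N => -[|n] //; rewrite cf1 /=. Qed.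
Lemma bdX B f k : bd B f -> bd B (f ^+ k).
Proof. by move=> h; elim: k => [|k IH]; rewrite ?expr0 ?exprS; [exact: bd1 | exact: bdM]. Qed.
Lemma bd_nat B k : bd B (k%:R).
Proof. by exists k, 0%N => -[|n]; rewrite -[k%:R]mulr1 cfMz_nat cf1 ?mulr0 ?mulr1 //=; lia. Qed.

Lemma bd_fX B : (0 < B)%N -> bd B X.
Proof.
move=> B0; exists 1%N, 0%N => -[|[|n]]; rewrite cfX //= ?expn1 //; lia.
Qed.
Lemma bd_fsgn B f : bd B f -> bd B (fsgn f).
Proof.
by move=> [K [d h]]; exists K, d => n; rewrite cf_fsgn abszM abszX /= exp1n mul1n.
Qed.
Lemma bd_fdil k f : (0 < k)%N -> bd 1 f -> bd 1 (fdil k f).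
Proof.
move=> k0 [K [d h]]; exists K, d => n; rewrite cf_fdil; case: ifP => // _.
apply: leq_trans (h _) _; rewrite !exp1n !muln1 leq_mul2l leq_exp2r_w ?orbT //.
by rewrite ltnS leq_div.
Qed.
Lemma bd_opZ B f (c : int) : bd B f -> bd B (c%:~R * f).
Proof.
move=> [K [d h]]; exists (`|c| * K)%N, d => n; rewrite cfMz abszM -!mulnA leq_mul2l.
by rewrite mulnA h orbT.
Qed.
Lemma bd_U p f : bd 1 f -> bd 1 (Fps (fun n => f (p * n)%N)).
Proof.
move=> [K [d h]]; exists (K * p.+1 ^ d)%N, d => n /=.
apply: leq_trans (h _) _; rewrite !exp1n !muln1 -mulnA -expnMn leq_mul2l leq_exp2r_w ?orbT //.
by nia.
Qed.
(* Inverting a series with constant term 1 and other coefficients at most 2: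
   the recursion |V_n| <= 2 (|V_0| + ... + |V_(n-1)|) gives |V_n| <= 3^n. *)
Lemma bd_inv (V u : fps) : V * u = 1 -> u 0%N = 1 -> (forall i, (`|u i| <= 2)%N) -> bd 3 V.
Proof.
move=> Vu u0 u2; exists 1%N, 0%N => n; rewrite expn0 !mul1n.
suff : forall n m, (m <= n)%N -> (`|V m| <= 3 ^ m)%N by apply.
elim=> [|{}n IH] m.
  rewrite leqn0 => /eqP->; have := congr1 (fun f : fps => f 0%N) Vu.
  by rewrite cfM big_ord1 u0 mulr1 cf1 => ->.
rewrite leq_eqVlt ltnS => /orP[/eqP->|]; last exact: IH.
have := congr1 (fun f : fps => f n.+1) Vu; rewrite cfM cf1 big_ord_recr /= subnn u0 mulr1.
set S := \sum_(i < _) _ => hS.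
have -> : V n.+1 = - S by apply/eqP; rewrite -addr_eq0 addrC; apply/eqP.
rewrite abszN; apply: leq_trans (absz_sum _ (fun i => V i * u (n.+1 - i)%N)) _.
apply: (@leq_trans (\sum_(i < n.+1) 3 ^ i * 2)).
  by apply: leq_sum => i _; rewrite abszM leq_mul // IH // -ltnS.
rewrite -big_distrl /= ltnW // -ltnS.
elim: {IH hS S} n.+1 => [|k IH]; first by rewrite big_ord0.
by rewrite big_ord_recr /= mulnDl expnS; lia.
Qed.

Section Ev.
Variable R : realType.
Notation C := (R[i]).
Implicit Types (f g : fps) (z : C).

Lemma poly_geo (d : nat) (x : R) : 0 <= x < 1 -> exists2 K : R, 0 <= K & exists2 r : R, 0 <= r < 1 &
  forall n, n.+1%:R ^+ d * x ^+ n <= K * r ^+ n.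
Proof.
elim: d x => [|d IH] x hx; first by exists 1 => //; exists x => // n; rewrite expr0 !mul1r.
have /andP[x0 x1] := hx; have [xe0|xn0] := eqVneq x 0.
  exists 1 => //; exists 0; first by rewrite lexx ltr01.
  by case=> [|n]; rewrite xe0 ?expr0 ?expr1n ?mulr1 ?lexx // !(expr0n _ n.+1) /= !mulr0.
have xp : 0 < x by rewrite lt_def xn0.
pose y := (1 + x) / 2.
have y1 : 0 <= y < 1 by rewrite /y; lra.
have xy : x < y by rewrite /y; lra.
clearbody y; have [K K0 [r hr h]] := IH y y1.
have q1 : 0 <= x / y < 1 by rewrite divr_ge0 ?(ltW xp) ?(le_trans x0 (ltW xy)) //= ltr_pdivrMr ?mul1r //; lra.
have d0 : 0 < 1 - x / y by rewrite subr_gt0; have /andP[] := q1.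
exists (K / (1 - x / y)); first by rewrite divr_ge0 // ltW.
exists r => // n.
have e : n.+1%:R * (x / y) ^+ n <= (1 - x / y)^-1.
  apply: le_trans (geo_sum_le n.+1 q1).
  have -> : n.+1%:R * (x / y) ^+ n = \sum_(i < n.+1) (x / y) ^+ n.
    by rewrite sumr_const card_ord mulr_natl.
  apply: ler_sum => i _; have /andP[q0 q2] := q1.
  by rewrite ler_wiXn2l // ?(ltW q2) // -ltnS.
have -> : n.+1%:R ^+ d.+1 * x ^+ n = (n.+1%:R ^+ d * y ^+ n) * (n.+1%:R * (x / y) ^+ n).
  have : y ^+ n != 0 by rewrite expf_neq0 // gt_eqF //; lra.
  rewrite exprS expr_div_n; move: (n.+1%:R) (y ^+ n) (x ^+ n) => a b c b0.
  by move: (a ^+ d) => a'; field.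
rewrite [leRHS]mulrAC; have /andP[q0 _] := q1; have /andP[y0 _] := y1.
by apply: ler_pM => //; apply: mulr_ge0; rewrite ?exprn_ge0.
Qed.

Definition cterm f z (n : nat) : C := (f n)%:~R * z ^+ n.
Definition ev f z : C := tsum (cterm f z).

Lemma cterm_geo B f z : bd B f -> B%:R * nrm z < 1 -> exists2 K : R, 0 <= K & exists2 r : R, 0 <= r < 1 &
  forall n, nrm (cterm f z n) <= K * r ^+ n.
Proof.
move=> [K [d h]] hz; have z0 := nrm_ge0 z.
have [K' K'0 [r hr h']] := @poly_geo d (B%:R * nrm z) ltac:(by rewrite mulr_ge0).
exists (K%:R * K'); first by rewrite mulr_ge0.
exists r => // n; rewrite /cterm nrmM nrmX nrm_int.
have hn : `|f n|%:~R <= (K * n.+1 ^ d * B ^ n)%:R :> R.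
  by rewrite -abszE -[(`|f n|%N%:Z)%:~R]/(`|f n|%N%:R) ler_nat.
apply: le_trans (ler_wpM2r (exprn_ge0 n z0) hn) _.
rewrite !natrM !natrX -!mulrA ler_wpM2l //.
by have := h' n; rewrite exprMn.
Qed.

Lemma ev_has B f z : bd B f -> B%:R * nrm z < 1 -> hasum (cterm f z) (ev f z).
Proof.
move=> hf hz; have [K K0 [r hr h]] := cterm_geo hf hz.
by have [s hs] := hasum_geo hr h; rewrite /ev (tsumE hs).
Qed.
Lemma evE f z s : hasum (cterm f z) s -> ev f z = s. Proof. exact: tsumE. Qed.
Lemma hasum_ext (a b : nat -> C) s : hasum a s -> (forall n, a n = b n) -> hasum b s.
Proof. by move=> h e; have -> // : b = a by apply/funext => n; rewrite e. Qed.

Lemma evD B f g z : bd B f -> bd B g -> B%:R * nrm z < 1 -> ev (f + g) z = ev f z + ev g z.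
Proof.
move=> hf hg hz; apply: evE; apply: hasum_ext (hasumD (ev_has hf hz) (ev_has hg hz)) _ => n.
by rewrite /cterm cfD rmorphD mulrDl.
Qed.
Lemma evZ B f (c : int) z : bd B f -> B%:R * nrm z < 1 -> ev (c%:~R * f) z = c%:~R * ev f z.
Proof.
move=> hf hz; apply: evE; apply: hasum_ext (hasumZl _ (ev_has hf hz)) _ => n.
by rewrite /cterm cfMz rmorphM mulrA.
Qed.
Lemma evN B f z : bd B f -> B%:R * nrm z < 1 -> ev (- f) z = - ev f z.
Proof.
move=> hf hz; have := evZ (-1) hf hz.
by rewrite !mulrN1z !mulN1r.
Qed.
Lemma ev1 z : ev 1 z = 1.
Proof.
apply: evE => e e0; exists 1%N => -[//|n] _.
rewrite big_ord_recl big1 => [|i _]; last by rewrite /cterm cf1 /= mul0r.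
have -> : cterm 1 z (@ord0 n) = 1 by rewrite /cterm cf1 eqxx expr0 mulr1.
by rewrite addr0 subrr nrm0 ltW.
Qed.
Lemma evX z : ev X z = z.
Proof.
apply: evE => e e0; exists 2%N => -[//|[//|n]] _.
rewrite !big_ord_recl big1 => [|i _]; last by rewrite /cterm cfX /= mul0r.
have -> : cterm X z (@ord0 n.+1) = 0 by rewrite /cterm cfX mul0r.
have -> : cterm X z (lift ord0 (@ord0 n)) = z by rewrite /cterm cfX mul1r expr1.
by rewrite add0r addr0 subrr nrm0 ltW.
Qed.
Lemma hasum_small (b : nat -> R) : (exists2 K : R, 0 <= K & exists2 r : R, 0 <= r < 1 & forall n, b n <= K * r ^+ n) ->
  forall e, 0 < e -> exists N, forall n, (N <= n)%N -> b n <= e.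
Proof.
move=> [K K0 [r /andP[r0 r1] h]] e e0.
have : cvgn (series (geometric K r)) by apply: is_cvg_geometric_series; rewrite ger0_norm.
move/cvg_series_cvg_0/cvgrPdist_le/(_ e e0) => [N _ hN]; exists N => n Nn.
apply: le_trans (h n) _; have := hN n Nn; rewrite sub0r normrN /=.
by apply: le_trans; rewrite ler_norm.
Qed.
(** The product of the partial sums and the partial sum of the product differ by terms with i + j >=
    n, at most n^2 of them, each at most K K' rho^n. *)
Lemma evM B f g z : bd B f -> bd B g -> B%:R * nrm z < 1 -> ev (f * g) z = ev f z * ev g z.
Proof.
move=> hf hg hz.
have [K K0 [r hr hF]] := cterm_geo hf hz; have [K' K'0 [r' hr' hG]] := cterm_geo hg hz.
have Hf := ev_has hf hz; have Hg := ev_has hg hz; have Hfg := ev_has (bdM hf hg) hz.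
set F := ev f z in Hf *; set G := ev g z in Hg *; set H := ev _ z in Hfg *.
pose rho := Num.max r r'.
have /andP[r0 r1] := hr; have /andP[r'0 r'1] := hr'.
have rho1 : 0 <= rho < 1 by rewrite /rho le_max r0 /= gt_max r1.
have /andP[p0 p1] := rho1.
have hF' n : nrm (cterm f z n) <= K * rho ^+ n.
  by apply: le_trans (hF n) _; rewrite ler_wpM2l //; apply: lerXn2r; rewrite ?nnegrE // /rho le_max lexx.
have hG' n : nrm (cterm g z n) <= K' * rho ^+ n.
  by apply: le_trans (hG n) _; rewrite ler_wpM2l //; apply: lerXn2r; rewrite ?nnegrE // /rho le_max lexx orbT.
pose A n := \sum_(i < n) cterm f z i; pose Bs n := \sum_(i < n) cterm g z i.
pose D n := \sum_(i < n) cterm (f * g) z i.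
have key n : nrm (A n * Bs n - D n) <= n%:R ^+ 2 * (K * K') * rho ^+ n.
  have -> : D n = \sum_(i < n) \sum_(j < n) (if (i + j < n)%N then cterm f z i * cterm g z j else 0).
    rewrite /D; transitivity (\sum_(k < n) \sum_(i < n) (if (i <= k)%N then cterm f z i * cterm g z (k - i) else 0)).
      apply: eq_bigr => k _; rewrite /cterm cfM rmorph_sum mulr_suml.
      rewrite -(big_mkord predT (fun i => (f i * g (k - i)%N)%:~R * z ^+ k)).
      rewrite (big_nat_widen _ _ n) ?ltn_ord // big_mkcond big_mkord; apply: eq_bigr => i _ /=.
      rewrite ltnS; case: ifP => // ik; rewrite rmorphM mulrACA -exprD subnKC //.
    rewrite exchange_big /=; apply: eq_bigr => i _.
    rewrite -(big_mkord predT (fun k => if (i <= k)%N then cterm f z i * cterm g z (k - i) else 0)).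
    rewrite (big_cat_nat (n := i)) //=; last by rewrite ltnW.
    rewrite big_nat_cond big1 ?add0r => [|k /andP[/andP[_ ki] _]]; last by rewrite leqNgt ki.
    rewrite -{1}[i : nat]add0n big_addn -(big_mkord predT (fun j => if (i + j < n)%N then cterm f z i * cterm g z j else 0)).
    rewrite [RHS](big_cat_nat (n := n - i)) ?leq_subr //= [X in _ = _ + X]big_nat_cond [X in _ = _ + X]big1 ?addr0.
      apply: eq_big_nat => j /andP[_ hj]; rewrite leq_addl addnK ifT //; lia.
    by move=> j /andP[/andP[h1 h2] _]; rewrite ifF //; lia.
  rewrite /A /Bs big_distrlr /= -sumrB; apply: le_trans (nrm_sum _ _ _) _.
  have -> : n%:R ^+ 2 * (K * K') * rho ^+ n = \sum_(i < n) \sum_(j < n) (K * K' * rho ^+ n).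
    by rewrite !sumr_const !card_ord -mulrnA -[RHS]mulr_natl natrM expr2 !mulrA.
  apply: ler_sum => i _; rewrite -sumrB; apply: le_trans (nrm_sum _ _ _) _; apply: ler_sum => j _.
  case: ifP => ij; first by rewrite subrr nrm0 !mulr_ge0 ?exprn_ge0.
  rewrite subr0 nrmM; apply: le_trans (ler_pM (nrm_ge0 _) (nrm_ge0 _) (hF' i) (hG' j)) _.
  rewrite mulrACA -exprD ler_wpM2l ?mulr_ge0 // ler_wiXn2l ?(ltW p1) //; lia.
have sm := @hasum_small (fun n => n%:R ^+ 2 * (K * K') * rho ^+ n).
have {}sm : forall e, 0 < e -> exists N, forall n, (N <= n)%N -> n%:R ^+ 2 * (K * K') * rho ^+ n <= e.
  apply: sm; have [L L0 [t ht hL]] := poly_geo 2 rho1.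
  exists (K * K' * L); first by rewrite !mulr_ge0.
  exists t => // n; rewrite mulrAC mulrC -mulrA ler_wpM2l ?mulr_ge0 //.
  apply: le_trans (hL n); rewrite ler_wpM2r ?exprn_ge0 // ler_pXn2r ?nnegrE ?ler0n // ler_nat //.
apply/eqP; rewrite -subr_eq0; apply/eqP; apply: nrm_eps => e e0.
have e4 : 0 < e / 4 by rewrite divr_gt0.
have [N1 h1] := sm _ e4; have [N2 h2] := Hfg _ e4.
have fg0 : 0 < nrm F + nrm G + 1 by rewrite ltr_wpDl // addr_ge0 ?nrm_ge0.
pose d := Num.min 1 (e / 4 / (nrm F + nrm G + 1)).
have d0 : 0 < d by rewrite /d lt_min ltr01 divr_gt0.
have d1 : d <= 1 by rewrite /d ge_min lexx.
have d2 : d * (nrm F + nrm G + 1) <= e / 4 by rewrite -ler_pdivlMr // /d ge_min lexx orbT.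
have [N3 h3] := Hf _ d0; have [N4 h4] := Hg _ d0.
pose n := (N1 + N2 + N3 + N4)%N.
have [l1 l2 l3 l4] : [/\ (N1 <= n)%N, (N2 <= n)%N, (N3 <= n)%N & (N4 <= n)%N].
  by rewrite /n; clear; split; lia.
have {}h1 := le_trans (key n) (h1 n l1); have {}h2 := h2 n l2; have {}h3 := h3 n l3; have {}h4 := h4 n l4.
rewrite -/(D n) in h2; rewrite -/(A n) in h3; rewrite -/(Bs n) in h4.
have -> : H - F * G = (A n - F) * (Bs n - G) + (A n - F) * G + F * (Bs n - G) - (D n - H) - (A n * Bs n - D n) by ring.
have f0 := nrm_ge0 F; have g0 := nrm_ge0 G.
have E1 : nrm ((A n - F) * (Bs n - G)) <= d.
  by rewrite nrmM -[leRHS]mulr1 ler_pM ?nrm_ge0 // (le_trans h4).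
have E2 : nrm ((A n - F) * G) <= d * nrm G by rewrite nrmM ler_wpM2r.
have E3 : nrm (F * (Bs n - G)) <= d * nrm F by rewrite nrmM mulrC ler_wpM2r.
apply: le_trans (nrmB _ _) _; apply: le_trans (lerD (nrmB _ _) h1) _.
apply: le_trans (lerD (lerD (nrmD _ _) h2) (lexx _)) _.
apply: le_trans (lerD (lerD (lerD (nrmD _ _) E3) (lexx _)) (lexx _)) _.
move: E1 E2 d2 e0; clear.
set x1 := nrm _; set x2 := nrm (_ * G); set y1 := nrm F; set y2 := nrm G; clearbody x1 x2 y1 y2; lra.
Qed.
End Ev.

Lemma bd_phi : bd 1 phi.
Proof.
exists 3%N, 0%N => n; rewrite expn0 exp1n !muln1.
have [[k e]|h] := pselect (exists k, (k ^ 2 = n)%N).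
  have [k0|k0] := posnP k; first by rewrite -e k0 /phi [cf _ _]/= big_geq.
  by rewrite -e phi_sq.
by rewrite phi_nsq // => k e; apply: h; exists k.
Qed.
Lemma bd_psi : bd 1 psi.
Proof.
exists 1%N, 0%N => n; rewrite expn0 exp1n !muln1.
have [[k e]|h] := pselect (exists k, (k * k.+1 = 2 * n)%N).
  by rewrite (psi_tri e).
by rewrite psi_ntri // => k e; apply: h; exists k.
Qed.
Lemma phi0 : phi 0%N = 1.
Proof. by rewrite /phi [cf _ _]/= big_geq. Qed.

Section Theta.
Variable R : realType.
Notation C := (R[i]).
Local Notation "x %:c" := (x%:C%C : C) (at level 2, format "x %:c").
Implicit Types (f g : fps) (v z u : C).

(** Used for series with sparse exponents: summing over the exponents that occur means following a
    subsequence of partial sums. *)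
Lemma hasum_sub (b c : nat -> C) (N : nat -> nat) s : hasum b s -> (forall k, (k <= N k)%N) ->
  (forall k, \sum_(j < N k) b j = \sum_(i < k) c i) -> hasum c s.
Proof.
move=> hs hN e d d0; have [M hM] := hs _ d0; exists M => n Mn.
by rewrite -e; apply: hM; apply: leq_trans (hN n).
Qed.
Lemma sum_sparse (b : nat -> C) (A B : nat) : (A < B)%N -> (forall j, (A < j < B)%N -> b j = 0) ->
  \sum_(j < B) b j = \sum_(j < A) b j + b A.
Proof.
move=> AB h; rewrite -!(big_mkord predT) (big_cat_nat (n := A)) //=; last by rewrite ltnW.
congr (_ + _); rewrite big_ltn // big_nat_cond big1 ?addr0 // => j /andP[/andP[h1 h2] _].
by apply: h; rewrite h1.
Qed.

Lemma ev_fdil k f z : (0 < k)%N -> bd 1 f -> nrm z < 1 -> ev (fdil k f) z = ev f (z ^+ k).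
Proof.
move=> k0 hf hz; apply/esym/evE.
have h := ev_has (bd_fdil k0 hf) (ltac:(by rewrite mul1r) : 1%:R * nrm z < 1).
apply: (hasum_sub (N := fun i => (k * i)%N) h) => i; first by nia.
elim: i => [|i IH]; first by rewrite muln0 !big_ord0.
rewrite [RHS]big_ord_recr -IH /= (@sum_sparse _ (k * i) (k * i.+1)); last 2 first.
- by rewrite mulnS; lia.
- move=> j hj; rewrite /cterm cf_fdil; case: ifP => [/dvdnP[l ej]|_]; last by rewrite mul0r.
  by move: hj; rewrite ej ![(k * _)%N]mulnC !ltn_mul2r k0 /=; lia.
by rewrite /cterm cf_fdil_mul // exprM.
Qed.
Lemma ev_fsgn f z : ev (fsgn f) z = ev f (- z).
Proof.
rewrite /ev; congr tsum; apply/funext => n.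
by rewrite /cterm cf_fsgn rmorphM rmorphXn rmorphN1 [(- z) ^+ n]exprNn [RHS]mulrCA mulrA.
Qed.

Lemma hasum_shift (a : nat -> C) s : hasum a s -> hasum (fun n => a n.+1) (s - a 0%N).
Proof.
move=> h e e0; have [N hN] := h _ e0; exists N => n Nn.
have := hN n.+1 (leqW Nn); rewrite big_ord_recl.
by set A := \sum_(i < n) _; have -> : a (@ord0 n) + A - s = A - (s - a 0%N) by rewrite /=; ring.
Qed.
Lemma hasum_delta (c : C) : hasum (fun n => if n is 0%N then c else 0) c.
Proof.
move=> e e0; exists 1%N => -[//|n] _; rewrite big_ord_recl big1 // addr0 subrr nrm0 ltW //.
Qed.

Lemma phi_sum u : nrm u < 1 -> hasumZ (fun n : int => u ^+ (`|n| ^ 2)) (ev phi u).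
Proof.
move=> hu; have u0 := nrm_ge0 u.
have [s hs] : exists s, hasum (fun n : nat => u ^+ (n ^ 2)) s.
  apply: (@hasum_geo _ _ (nrm u) 1); first by rewrite u0.
  move=> n; rewrite mul1r nrmX; apply: ler_wiXn2l; rewrite ?(ltW hu) //; nia.
have hp := ev_has bd_phi (ltac:(by rewrite mul1r) : 1%:R * nrm u < 1).
have e : ev phi u = s + (s - 1).
  pose c n : C := 2 * u ^+ (n ^ 2) + (if n is 0%N then -1 else 0).
  have hc1 : hasum c (ev phi u).
    apply: (hasum_sub (N := fun i => (i ^ 2)%N) hp) => i; first by nia.
    elim: i => [|i IH]; first by rewrite exp0n // !big_ord0.
    rewrite [RHS]big_ord_recr -IH /= (@sum_sparse _ (i ^ 2) (i.+1 ^ 2)); last 2 first.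
    - by rewrite ltn_exp2r.
    - move=> j hj; rewrite /cterm phi_nsq ?mul0r // => k ek; move: hj; rewrite -ek !ltn_exp2r //; lia.
    congr (_ + _); rewrite /c /cterm; case: i {IH} => [|i].
      by rewrite exp0n // expr0 phi0; ring.
    by rewrite phi_sq // addr0.
  have hc2 : hasum c (2 * s - 1) by exact: hasumD (hasumZl _ hs) (hasum_delta _).
  by rewrite (hasum_uniq hc1 hc2); ring.
by rewrite e; apply: (hasumZ_nat _ _ hs (hasum_shift hs)) => n.
Qed.

Lemma psi_sum z : nrm z < 1 -> hasum (fun n : nat => z ^+ (n * n.+1)./2) (ev psi z).
Proof.
move=> hz.
have tri n : (n * n.+1 = 2 * (n * n.+1)./2)%N.
  by have := odd_double_half (n * n.+1); rewrite oddM /= andbN add0n -mul2n.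
have hp := ev_has bd_psi (ltac:(by rewrite mul1r) : 1%:R * nrm z < 1).
have triS n : ((n.+1 * n.+2)./2 = (n * n.+1)./2 + n.+1)%N.
  by have := tri n; have := tri n.+1; nia.
apply: (hasum_sub (N := fun n => (n * n.+1)./2%N) hp) => i.
  by elim: i => // i IH; rewrite triS; lia.
elim: i => [|i IH]; first by rewrite !big_ord0.
rewrite [RHS]big_ord_recr -IH /= (@sum_sparse _ (i * i.+1)./2 (i.+1 * i.+2)./2); last 2 first.
- by rewrite triS; lia.
- move=> j hj; rewrite /cterm psi_ntri ?mul0r // => k ek.
  have t1 := tri i; have t2 := tri i.+1; move: hj ek t1 t2 => /andP[].
  move: (i * i.+1)./2 (i.+1 * i.+2)./2 => A B h1 h2 ek t1 t2.
  have l1 : (i * i.+1 < k * k.+1)%N by rewrite t1 ek; clear -h1; lia.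
  have l2 : (k * k.+1 < i.+1 * i.+2)%N by rewrite t2 ek; clear -h2; lia.
  case: (leqP k i) => ki; first by have := leq_mul ki (ki : (k < i.+1)%N); clear -l1; lia.
  have := leq_mul ki (ki : (i.+1 < k.+1)%N); clear -l2; lia.
by rewrite /cterm (psi_tri (tri i)) mul1r.
Qed.

(** Jacobi's theta constants of nome e^(-pi v^2), that is at tau = i v^2. The last one is written on
    the dual side, so that inversion applies to it directly. *)
Definition T3 v : C := Sx v 0.
Definition T2 v : C := Sx v (1 / 2).
Definition T4 v : C := Th v^-1 (1 / 2).

Lemma nrm_gauss_lt1 v : cone v -> nrm (gauss v) < 1.
Proof.
move=> cv; rewrite nrm_gauss -[ltRHS]expR0 ltr_expR oppr_lt0 mulr_gt0 ?pi_gt0 //.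
exact: cone_sq.
Qed.
Lemma gauss_int v n : gauss (v * n%:R) = gauss v ^+ (n ^ 2).
Proof.
by rewrite /gauss -cexpX; congr cexp; rewrite natrX; ring.
Qed.
Lemma gauss_opp v : gauss (- v) = gauss v.
Proof. by rewrite /gauss sqrrN. Qed.
Lemma gauss_absz v (n : int) : gauss (v * n%:~R) = gauss v ^+ (`|n| ^ 2).
Proof.
case: n => n; first exact: gauss_int.
by rewrite NegzE mulrNz mulrN gauss_opp gauss_int abszN.
Qed.

Lemma T3_ev v : cone v -> T3 v = ev phi (gauss v).
Proof.
move=> cv; rewrite /T3 /Sx; apply: zsumE; apply: hasumZ_ext (phi_sum (nrm_gauss_lt1 cv)) _ => n.
by rewrite /gsamp rt1 intC rmorph0 mulr0 addr0 gauss_absz.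
Qed.
Lemma T4_ev v : cone v -> T4 v = ev phi (- gauss v).
Proof.
move=> cv; have h := nrm_gauss_lt1 cv; rewrite -nrmN in h.
rewrite /T4 /Th; apply: zsumE; apply: hasumZ_ext (phi_sum h) _ => n.
rewrite /ghat invrK gauss_absz exprNn mulrC; congr (_ * _).
have half : ee ((1 / 2 : R)%:c) = -1.
  rewrite ee_real (_ : 2 * pi * (1 / 2) = pi); last by field.
  by rewrite cospi sinpi; congr Complex; rewrite oppr0.
rewrite -signr_odd oddX /= -[in RHS]intC.
have nat_case (k : nat) : ee (k%:R * (1 / 2 : R)%:c) = (-1) ^+ odd k by rewrite eeX half signr_odd.
rewrite intC; case: n => k; first exact/esym/nat_case.
rewrite NegzE mulrNz mulNr eeN abszN [absz _]/=.
by rewrite -[k.+1%:~R]/(k.+1%:R) nat_case; case: (odd _); rewrite ?expr1 ?expr0 ?invrN1 ?invr1.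
Qed.
Lemma T2_ev v : cone v -> T2 v = 2 * gauss (v / 2) * ev psi (gauss v ^+ 2).
Proof.
move=> cv; have h := nrm_gauss_lt1 cv.
have h2 : nrm (gauss v ^+ 2) < 1 by rewrite nrmX exprn_ilt1 ?nrm_ge0.
have hp := hasumZl (gauss (v / 2)) (psi_sum h2).
have key (n : nat) : gauss (v / 2) * (gauss v ^+ 2) ^+ (n * n.+1)./2 = gauss (v * (n%:R + 2^-1)).
  have tri : (n * n.+1 = 2 * (n * n.+1)./2)%N.
    by have := odd_double_half (n * n.+1); rewrite oddM /= andbN add0n -mul2n.
  by rewrite -exprM -tri /gauss -cexpX -cexpD; congr cexp; rewrite natrM -natr1; field.
have half : (1 / 2 : R)%:c = 2^-1 by rewrite div1r fmorphV rmorph_nat.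
rewrite -mulrA mulr_natl mulr2n.
rewrite /T2 /Sx; apply: zsumE; apply: (hasumZ_nat _ _ hp hp) => n.
  by rewrite key /gsamp rt1 intC half; congr gauss; rewrite -[n%:~R]/(n%:R); ring.
rewrite key /gsamp rt1 intC half -gauss_opp; congr gauss.
by rewrite NegzE mulrNz -[n.+1%:~R]/(n.+1%:R) -natr1; field.
Qed.
End Theta.

(** * Modularity *)

Lemma bd_A : bd 1 serA. Proof. exact: bdX bd_phi. Qed.
Lemma bd_P : bd 1 serP. Proof. exact: bdX (bd_fsgn bd_phi). Qed.
Lemma bd_W : bd 1 serW. Proof. exact: bdM (bd_fX _) (bdX _ bd_psi). Qed.
Lemma bd_D : bd 1 serD. Proof. exact: bdM bd_W (bdX _ bd_P). Qed.
Lemma bd_E : bd 1 serE.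
Proof. by rewrite serE_W; apply: bdD (bdM (bd_nat _ _) bd_W) (bdX _ bd_P). Qed.

Section Modular.
Variable R : realType.
Notation C := (R[i]).
Local Notation "x %:c" := (x%:C%C : C) (at level 2, format "x %:c").
Implicit Types (f g : fps) (v z u tau : C).

Lemma lt1 z : nrm z < 1 -> 1%:R * nrm z < 1. Proof. by rewrite mul1r. Qed.
Lemma ev_X f k z : bd 1 f -> nrm z < 1 -> ev (f ^+ k) z = ev f z ^+ k.
Proof.
move=> hf hz; elim: k => [|k IH]; first by rewrite !expr0 ev1.
by rewrite !exprS (evM hf (bdX k hf) (lt1 hz)) IH.
Qed.
Lemma ev_natM f k z : bd 1 f -> nrm z < 1 -> ev (k%:R * f) z = k%:R * ev f z.
Proof. by move=> hf hz; exact: (evZ k%:Z hf (lt1 hz)). Qed.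

Section AtCone.
Variable v : C.
Hypothesis cv : cone v.
Let u := gauss v.
Let q := u ^+ 2.
Let hu : nrm u < 1. Proof. exact: nrm_gauss_lt1. Qed.
Let hq : nrm q < 1. Proof. by rewrite nrmX exprn_ilt1 ?nrm_ge0. Qed.

Lemma T34_add : T3 v ^+ 2 + T4 v ^+ 2 = 2 * ev serA q.
Proof.
have b1 := bd_phi; have b2 := bd_fsgn b1.
rewrite (T3_ev cv) (T4_ev cv) -ev_fsgn -(ev_X 2 b1 hu) -(ev_X 2 b2 hu).
rewrite -(evD (bdX 2 b1) (bdX 2 b2) (lt1 hu)) -fsgnX phi2_even.
by rewrite (ev_natM 2 (bd_fdil (isT : (0 < 2)%N) (bdX 2 b1)) hu) (ev_fdil (isT : (0 < 2)%N) (bdX 2 b1) hu).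
Qed.
Lemma T34_mul : T3 v * T4 v = ev serP q.
Proof.
rewrite (T3_ev cv) (T4_ev cv) -ev_fsgn.
have b1 := bd_phi; have b2 := bd_fsgn b1.
by rewrite -(evM b1 b2 (lt1 hu)) phi_sgn_mul (ev_fdil (isT : (0 < 2)%N) (bdX 2 b2) hu).
Qed.
Lemma T2_8 : T2 v ^+ 8 = 256 * ev serW q.
Proof.
rewrite (T2_ev cv) /serW (evM (bd_fX (isT : (0 < 1)%N)) (bdX 8 bd_psi) (lt1 hq)) evX (ev_X 8 bd_psi hq).
rewrite !exprMn.
have -> : gauss (v / 2) ^+ 8 = q.
  by rewrite /q /u /gauss -!cexpX; congr cexp; field.
have -> : 2 ^+ 8 = 256 :> C by rewrite -natrX.
by rewrite mulrA.
Qed.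
(** The classical 2 E4 = theta2^8 + theta3^8 + theta4^8. The two expressions of E4, with w and with
    A, P, eliminate w; the rest is symmetric in theta3^2 and theta4^2. *)
Lemma serE_theta : 2 * ev serE q = T2 v ^+ 8 + T3 v ^+ 8 + T4 v ^+ 8.
Proof.
have ha := T34_add; have hp := T34_mul; have hw := T2_8.
have hA := bd_A; have hP := bd_P; have hl := lt1 hq.
have e : ev serE q = 256 * ev serW q + ev serP q ^+ 4.
  rewrite serE_W (evD (bdM (bd_nat _ 256) bd_W) (bdX 4 hP) hl).
  by rewrite (ev_natM 256 bd_W hq) (ev_X 4 hP hq).
have e' : ev serE q = 16 * ev serA q ^+ 4 - 16 * (ev serA q ^+ 2 * ev serP q ^+ 2) + ev serP q ^+ 4.
  have hAP := bdM (bdX 2 hA) (bdX 2 hP).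
  rewrite /serE (evD (bdD (bdM (bd_nat _ 16) (bdX 4 hA)) (bdN (bdM (bd_nat _ 16) hAP))) (bdX 4 hP) hl).
  rewrite (evD (bdM (bd_nat _ 16) (bdX 4 hA)) (bdN (bdM (bd_nat _ 16) hAP)) hl) (evN (bdM (bd_nat _ 16) hAP) hl).
  rewrite (ev_natM 16 (bdX 4 hA) hq) (ev_natM 16 hAP hq) (evM (bdX 2 hA) (bdX 2 hP) hl).
  by rewrite (ev_X 4 hA hq) (ev_X 2 hA hq) (ev_X 2 hP hq) (ev_X 4 hP hq).
rewrite hw; move: e e' ha hp.
set E := ev serE q; set W := ev serW q; set A := ev serA q; set P := ev serP q.
set x := T3 v; set y := T4 v => e e' ha hp.
have -> : 256 * W = E - P ^+ 4 by rewrite e; ring.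
rewrite -[in RHS]hp.
have -> : E - (x * y) ^+ 4 + x ^+ 8 + y ^+ 8 = E + ((x ^+ 2 + y ^+ 2) ^+ 4 - 4 * ((x ^+ 2 + y ^+ 2) ^+ 2 * (x * y) ^+ 2) + (x * y) ^+ 4) by ring.
rewrite ha hp e'; ring.
Qed.
Lemma serD_theta : 256 * ev serD q = (T2 v * T3 v * T4 v) ^+ 8.
Proof.
rewrite -mulrA T34_mul exprMn T2_8 /serD (evM bd_W (bdX 8 bd_P) (lt1 hq)) (ev_X 8 bd_P hq).
by rewrite mulrA.
Qed.
End AtCone.

Lemma T3_inv v : cone v -> T3 v^-1 = v * T3 v.
Proof.
move=> cv; rewrite /T3 (theta_inversion cv (or_introl erefl)) /Sx /Th; congr zsum.
by apply/funext => n; rewrite /gsamp rt1 intC rmorph0 !mulr0 addr0 ee0 mulr1.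
Qed.
Lemma T42_inv v : cone v -> T4 v^-1 = v * T2 v.
Proof.
move=> cv. rewrite /T4 /T2 (theta_inversion cv (or_intror erefl)) invrK //.
Qed.
Lemma T24_inv v : cone v -> T2 v^-1 = v * T4 v.
Proof.
move=> cv; have := T42_inv (cone_inv cv); rewrite invrK => ->.
by rewrite mulrA mulfV ?mul1r // cone_neq0.
Qed.

Definition upper tau := 0 < complex.Im tau.
Lemma nrm_ee_lt1 tau : upper tau -> nrm (ee tau) < 1.
Proof.
by move=> h; rewrite nrm_ee -[ltRHS]expR0 ltr_expR oppr_lt0 !mulr_gt0 ?pi_gt0.
Qed.
Lemma upper_cone tau : upper tau -> exists2 v, cone v & v ^+ 2 = - (Ci R * tau).
Proof.
move=> h; have [v hv] : exists v : C, v ^+ 2 = - (Ci R * tau) by exists (sqrtC (- (Ci R * tau))); rewrite sqrtCK.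
have hr : `|complex.Im v| < `|complex.Re v|.
  have : 0 < complex.Re (v ^+ 2) by rewrite hv; move: h; rewrite /upper; case: (tau) => a b /=; lra.
  rewrite Re_sqr subr_gt0 -(real_normK (num_real (complex.Im v))) -(real_normK (num_real (complex.Re v))).
  by rewrite ltr_pXn2r ?nnegrE.
have [v0|v0] := leP 0 (complex.Re v).
  by exists v => //; rewrite /cone -(ger0_norm v0).
exists (- v); last by rewrite sqrrN.
by rewrite /cone ReN ImN normrN -(ltr0_norm v0).
Qed.
Lemma ee_gauss v tau : v ^+ 2 = - (Ci R * tau) -> ee tau = gauss v ^+ 2.
Proof. by move=> h; rewrite /ee /gauss h -cexpX; congr cexp; ring. Qed.
Lemma Ci_sq : Ci R * Ci R = -1. Proof. by rewrite -expr2 Ci2. Qed.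

Lemma upper_neq0 tau : upper tau -> tau != 0.
Proof. by rewrite /upper => h; apply/eqP => e; move: h; rewrite e ltxx. Qed.

Lemma cone_S v tau : upper tau -> v ^+ 2 = - (Ci R * tau) -> v^-1 ^+ 2 = - (Ci R * - tau^-1).
Proof.
move=> /upper_neq0 t0 h; rewrite exprVn h mulrN opprK invrN invfM.
have -> : (Ci R)^-1 = - Ci R.
  have c0 : Ci R != 0 by apply/eqP => e; have := Ci_sq; rewrite e mul0r => /eqP; rewrite eq_sym oppr_eq0 oner_eq0.
  by apply: (mulIf c0); rewrite mulVf // mulNr Ci_sq opprK.
by rewrite mulNr opprK.
Qed.

(** Inversion exchanges theta2 and theta4 and fixes theta3, each up to the factor v, and v^8 =
    tau^4. *)
Lemma E_S tau : upper tau -> ev serE (ee (- tau^-1)) = tau ^+ 4 * ev serE (ee tau).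
Proof.
move=> h; have [v cv hv] := upper_cone h.
have hv' := cone_S h hv; have cv' := cone_inv cv.
have n2 : (2 : C) != 0 by rewrite pnatr_eq0.
have e1 := serE_theta cv; have e2 := serE_theta cv'.
rewrite (ee_gauss hv) (ee_gauss hv').
move: (ev _ _) (ev _ _) e1 e2 => x y e1 e2.
apply: (mulfI n2); rewrite [RHS]mulrCA ?e1 ?e2.
rewrite (T3_inv cv) (T42_inv cv) (T24_inv cv) !exprMn.
have -> : v ^+ 8 = tau ^+ 4.
  have -> : v ^+ 8 = (v ^+ 2) ^+ 4 by ring.
  have -> : tau ^+ 4 = (Ci R * Ci R * (Ci R * Ci R)) * tau ^+ 4 by rewrite Ci_sq; ring.
  by rewrite hv; ring.
by ring.
Qed.
Lemma D_S tau : upper tau -> ev serD (ee (- tau^-1)) = tau ^+ 12 * ev serD (ee tau).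
Proof.
move=> h; have [v cv hv] := upper_cone h.
have hv' := cone_S h hv; have cv' := cone_inv cv.
have n2 : (256 : C) != 0 by rewrite pnatr_eq0.
have e1 := serD_theta cv; have e2 := serD_theta cv'.
rewrite (ee_gauss hv) (ee_gauss hv').
move: (ev _ _) (ev _ _) e1 e2 => x y e1 e2.
apply: (mulfI n2); rewrite [RHS]mulrCA ?e1 ?e2.
rewrite (T3_inv cv) (T42_inv cv) (T24_inv cv) !exprMn.
have -> : tau ^+ 12 = v ^+ 8 * v ^+ 8 * v ^+ 8.
  have -> : v ^+ 8 * v ^+ 8 * v ^+ 8 = (v ^+ 2) ^+ 12 by ring.
  have -> : tau ^+ 12 = (Ci R * Ci R) ^+ 6 * tau ^+ 12 by rewrite Ci_sq; ring.
  by rewrite hv; ring.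
by ring.
Qed.
End Modular.

(** * The full modular group and the Hecke operators *)

Section Modular.
Variable R : realType.
Notation C := (R[i]).
Local Notation "x %:c" := (x%:C%C : C) (at level 2, format "x %:c").
Implicit Types (f g : fps) (z tau : C) (a b c d : int).

Definition modular (w : nat) (F : C -> C) :=
  (forall tau (n : int), upper tau -> F (tau + n%:~R) = F tau) /\
  (forall tau, upper tau -> F (- tau^-1) = tau ^+ w * F tau).

Definition evq f tau : C := ev f (ee tau).

Lemma ee_shift tau (n : int) : ee (tau + n%:~R) = ee tau.
Proof. by rewrite eeD ee_int mulr1. Qed.
Lemma upper_shift tau (n : int) : upper tau -> upper (tau + n%:~R).
Proof. by rewrite /upper ImD -intC /= addr0. Qed.
Lemma Im_inv z : complex.Im (- z^-1) = complex.Im z / nrm z ^+ 2.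
Proof. by rewrite nrm_sqr; case: z => x y /=; rewrite ?mulNr opprK. Qed.
Lemma nrm_gt0 z : z != 0 -> 0 < nrm z.
Proof. by move=> z0; rewrite lt_def nrm_ge0 andbT; apply: contra z0 => /eqP/nrm_eq0->. Qed.
Lemma upper_S tau : upper tau -> upper (- tau^-1).
Proof.
by move=> h; rewrite /upper Im_inv divr_gt0 // exprn_gt0 // nrm_gt0 // upper_neq0.
Qed.

Definition mob a b c d tau : C := (a%:~R * tau + b%:~R) / (c%:~R * tau + d%:~R).

Lemma den_neq0 c d tau : upper tau -> (c != 0) || (d != 0) -> c%:~R * tau + d%:~R != 0.
Proof.
move=> h cd; apply/eqP => e; have := congr1 (@complex.Im R) e.
rewrite -!intC ImD Im_scale /= addr0 => /eqP; rewrite mulf_eq0 (gt_eqF h) orbF intr_eq0 => /eqP c0.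
move: e cd; rewrite c0 mul0r add0r eqxx /= => /eqP; rewrite intr_eq0 => /eqP ->.
by rewrite eqxx.
Qed.

Lemma det_den a b c d : a * d - b * c = 1 -> (c != 0) || (d != 0).
Proof.
move=> h; case: (eqVneq c 0) => //= c0; apply/eqP => d0.
by move: h; rewrite c0 d0 !mulr0 subrr => /eqP; rewrite eq_sym oner_eq0.
Qed.

Lemma Im_div z u : complex.Im (z / u) =
  (complex.Im z * complex.Re u - complex.Re z * complex.Im u) / nrm u ^+ 2.
Proof. by rewrite nrm_sqr; case: z u => x y [x' y'] /=; rewrite ?mulNr; ring. Qed.
Lemma Im_mob a b c d tau : a * d - b * c = 1 ->
  complex.Im (mob a b c d tau) = complex.Im tau / nrm (c%:~R * tau + d%:~R) ^+ 2.
Proof.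
move=> h; have hR : a%:~R * d%:~R - b%:~R * c%:~R = 1 :> R by rewrite -!intrM -intrB h.
rewrite /mob Im_div; congr (_ / _); rewrite -!intC !(ImD, ReD, Im_scale, Re_scale) /= !addr0.
transitivity ((a%:~R * d%:~R - b%:~R * c%:~R) * complex.Im tau); last by rewrite hR mul1r.
by ring.
Qed.
Lemma mob_upper a b c d tau : a * d - b * c = 1 -> upper tau -> upper (mob a b c d tau).
Proof.
move=> h ht; rewrite /upper Im_mob // divr_gt0 // exprn_gt0 // nrm_gt0 //.
exact: den_neq0 (det_den h).
Qed.

(* Euclid on the bottom row: translate to reduce a modulo c, then apply S. *)
Lemma modular_SL2 w F : ~~ odd w -> modular w F -> forall a b c d tau, a * d - b * c = 1 -> upper tau ->
  F (mob a b c d tau) = (c%:~R * tau + d%:~R) ^+ w * F tau.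
Proof.
move=> ow [hT hS] a b c d; have [n] := ubnP `|c|%N; elim: n a b c d => // n IH a b c d cn tau det ht.
have n0 := den_neq0 ht (det_den det).
have [c0|c0] := eqVneq c 0.
  subst c; rewrite mulr0 subr0 in det.
  have [[ea ed]|[ea ed]] : (a = 1 /\ d = 1) \/ (a = -1 /\ d = -1).
    have : (`|a| * `|d| == 1)%N by rewrite -abszM det.
    rewrite muln_eq1 => /andP[/eqP ea _].
    have [ha|ha] : a = 1 \/ a = -1 by clear -ea; lia.
      by left; move: det; rewrite ha mul1r.
    by right; move: det; rewrite ha; clear; lia.
    subst a d; rewrite /mob mulr0z mul0r add0r mul1r divr1 expr1n mul1r; exact: hT.
  subst a d; rewrite /mob mulr0z mul0r add0r.
  have -> : ((-1)%:~R * tau + b%:~R) / (-1)%:~R = tau + (- b)%:~R :> C.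
    by rewrite mulrN1z mulrNz; field.
  by rewrite hT // mulrN1z -signr_odd (negPf ow) expr0 mul1r.
pose k := (a %/ c)%Z; pose a' := (a %% c)%Z; pose b' := b - k * d.
have ea : a = k * c + a' by rewrite /k /a' -divz_eq.
have det' : a' * d - b' * c = 1 by rewrite -det /b' ea; ring.
have hu := mob_upper det' ht.
have e1 : mob a b c d tau = mob a' b' c d tau + k%:~R.
  rewrite /mob; have -> : a%:~R = k%:~R * c%:~R + a'%:~R :> C by rewrite -intrM -intrD -ea.
  have -> : b%:~R = b'%:~R + k%:~R * d%:~R :> C by rewrite -intrM -intrD /b' subrK.
  by field.
rewrite e1 hT //.
(* The reduced matrix followed by S: its lower left entry is a' = a mod c, smaller than c in
   absolute value. *)
have detS : - c * b' - (- d) * a' = 1 by rewrite -det'; ring.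
have lt : (`|a'| < n)%N.
  have := ltz_mod a c0; have := modz_ge0 a c0; rewrite -/a'; lia.
have h2 := IH (- c) (- d) a' b' lt tau detS ht.
have m0 := den_neq0 ht (det_den detS).
have s0 := upper_neq0 hu.
have e2 : mob (- c) (- d) a' b' tau = - (mob a' b' c d tau)^-1.
  rewrite /mob invf_div !mulrNz; field; exact: m0.
rewrite e2 hS // in h2.
have sw : mob a' b' c d tau ^+ w != 0 by rewrite expf_neq0.
apply: (mulfI sw); rewrite h2 mulrA -exprMn /mob divfK //.
Qed.

(** Averaging over the p translates keeps exactly the exponents divisible by p, since a sum of p-th
    roots of unity vanishes otherwise. *)
Lemma hecke_eval p w f tau : (0 < p)%N -> bd 1 f -> upper tau ->
  evq (hecke p w f) tau = (p ^ w.-1)%:R * evq f (p%:R * tau) +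
    p%:R^-1 * \sum_(b < p) evq f ((tau + b%:R) / p%:R).
Proof.
move=> p0 hf ht; have pR : p%:R != 0 :> C by rewrite pnatr_eq0; lia.
pose U : fps := Fps (fun n => f (p * n)%N).
have hU : bd 1 U := bd_U p hf.
have hd := bd_fdil p0 hf.
have hq := nrm_ee_lt1 ht.
have -> : hecke p w f = U + (p ^ w.-1)%:R * fdil p f.
  by apply: fpsP => n; rewrite cfD cfMz_nat /hecke natz.
rewrite /evq (evD hU (bdM (bd_nat _ _) hd) (lt1 hq)) (ev_natM _ hd hq) (ev_fdil p0 hf hq) -eeX addrC.
congr (_ + _); apply: evE.
pose zeta := tau / p%:R.
have hz : upper zeta.
  rewrite /zeta; have -> : tau / p%:R = (p%:R^-1 : R)%:c * tau by rewrite fmorphV rmorph_nat mulrC.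
  by rewrite /upper Im_scale mulr_gt0 // invr_gt0 ltr0n.
have eb (b : nat) : ee ((tau + b%:R) / p%:R) = ee zeta * ee (rt R p b%:Z)%:c.
  by rewrite -eeD mulrDl; congr (ee (_ + _)); rewrite /rt rmorphM fmorphV !rmorph_nat.
have lt1b (b : nat) : nrm (ee ((tau + b%:R) / p%:R)) < 1.
  by rewrite eb nrmM nrm_ee_real mulr1 nrm_ee_lt1.
have hsum (r : seq 'I_p) : hasum (fun n => \sum_(b <- r) cterm f (ee ((tau + (b : nat)%:R) / p%:R)) n)
   (\sum_(b <- r) ev f (ee ((tau + (b : nat)%:R) / p%:R))).
  elim: r => [|b r IH].
    rewrite big_nil => e e0; exists 0%N => m _; rewrite subr0 big1 ?nrm0 ?(ltW e0) // => k _.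
    by rewrite big_nil.
  rewrite big_cons; apply: hasum_ext (hasumD (ev_has hf (lt1 (lt1b b))) IH) _ => n.
  by rewrite big_cons.
have inner n : \sum_(b <- index_enum 'I_p) cterm f (ee ((tau + (b : nat)%:R) / p%:R)) n =
   if (p %| n)%N then p%:R * cterm f (ee zeta) n else 0.
  transitivity (cterm f (ee zeta) n * \sum_(b < p) ee (b%:R * (rt R p (n %% p)%:Z)%:c)).
    rewrite mulr_sumr; apply: eq_bigr => b _; rewrite eb /cterm exprMn mulrA; congr (_ * _).
    rewrite -eeX; have -> : n%:R * (rt R p b%:Z)%:c = b%:R * (rt R p (n %% p)%:Z)%:c + (b * (n %/ p))%:Z%:~R.
      have eC (k : nat) : (rt R p k%:Z)%:c = k%:R / p%:R by rewrite /rt rmorphM fmorphV !rmorph_nat.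
      rewrite !eC -[(b * (n %/ p))%:Z%:~R]/((b * (n %/ p))%:R) natrM.
      rewrite {1}(divn_eq n p) natrD natrM; field; exact: pR.
    by rewrite eeD ee_int mulr1.
  case: ifP => pn; last first.
    by rewrite ee_geosum ?mulr0 //; [rewrite /= ltn_pmod | rewrite eqz_nat -[_ == _]/(p %| n)%N pn].
  move/eqP: (pn) => ->; rewrite (eq_bigr (fun=> 1)) => [|b _]; last by rewrite /rt mul0r rmorph0 mulr0 ee0.
  by rewrite sumr_const card_ord mulrC.
pose B n := p%:R^-1 * \sum_(b <- index_enum 'I_p) cterm f (ee ((tau + (b : nat)%:R) / p%:R)) n.
have hp : hasum B (p%:R^-1 * \sum_(b < p) evq f ((tau + b%:R) / p%:R)) := hasumZl (p%:R^-1) (hsum (index_enum 'I_p)).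
have BE n : B n = if (p %| n)%N then cterm f (ee zeta) n else 0.
  by rewrite /B inner; case: ifP; rewrite ?mulr0 // mulrA mulVf // mul1r.
apply: (hasum_sub (N := fun i => (p * i)%N) hp) => i; first by nia.
elim: i => [|i IH]; first by rewrite muln0 !big_ord0.
rewrite [RHS]big_ord_recr -IH (@sum_sparse _ B (p * i) (p * i.+1)); last 2 first.
- by rewrite mulnS; lia.
- move=> j hj; rewrite BE; case: ifP => [/dvdnP[l ej]|_] //.
  by move: hj; rewrite ej ![(p * _)%N]mulnC !ltn_mul2r p0 /=; lia.
rewrite BE dvdn_mulr // /cterm; congr (_ + _ * _).
by rewrite exprM -eeX /zeta mulrCA mulfV // mulr1.
Qed.
End Modular.

Section Hecke.
Variable R : realType.
Notation C := (R[i]).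
Local Notation "x %:c" := (x%:C%C : C) (at level 2, format "x %:c").
Implicit Types (f g : fps) (z tau : C).

Lemma upper_scale (r : R) tau : 0 < r -> upper tau -> upper (r%:c * tau).
Proof. by move=> r0 h; rewrite /upper Im_scale mulr_gt0. Qed.
Lemma upper_natM (p : nat) tau : (0 < p)%N -> upper tau -> upper (p%:R * tau).
Proof.
move=> p0 h; have -> : p%:R = (p%:R : R)%:c by rewrite rmorph_nat.
by apply: upper_scale; rewrite ?ltr0n.
Qed.
Lemma upper_natV (p : nat) tau : (0 < p)%N -> upper tau -> upper (tau / p%:R).
Proof.
move=> p0 h; have -> : tau / p%:R = (p%:R^-1 : R)%:c * tau by rewrite fmorphV rmorph_nat mulrC.
by apply: upper_scale; rewrite ?invr_gt0 ?ltr0n.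
Qed.

Lemma sum_Fp (p : nat) (A : nat -> C) : prime p -> \sum_(b < p) A b = \sum_(b : 'F_p) A b.
Proof.
by move=> pp; rewrite -(big_mkord predT A) -[in LHS](Fp_cast pp) big_mkord.
Qed.

Lemma Fp_neg_inv (p : nat) (b : 'F_p) : prime p -> b != 0 ->
  exists k : nat, (b * (- b^-1 : 'F_p) + 1 = p * k)%N.
Proof.
move=> pp b0; suff /dvdnP[k ->] : (p %| b * (- b^-1 : 'F_p) + 1)%N by exists k; rewrite mulnC.
rewrite (dvdn_pcharf (pchar_Fp pp)) natrD natrM.
by rewrite !natr_Zp mulrN mulfV // addNr.
Qed.

Lemma hecke_alg (t P x y s : C) w : P != 0 ->
  P ^+ w * ((t / P) ^+ w.+1 * x) + P^-1 * ((P * t) ^+ w.+1 * y + t ^+ w.+1 * s) =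
  t ^+ w.+1 * (P ^+ w * y + P^-1 * (x + s)).
Proof.
move=> P0; have e : (t / P) ^+ w.+1 = t ^+ w.+1 * P^-1 * (P ^+ w)^-1.
  by rewrite expr_div_n [in X in _ / X]exprS invfM mulrA.
have Pw : P ^+ w != 0 by rewrite expf_neq0.
rewrite e exprMn [P ^+ w.+1]exprS; move: (P ^+ w) (t ^+ w.+1) Pw => a b a0.
by field; rewrite P0 a0.
Qed.

(* S permutes the summands of T_p: it swaps F(p tau) with F(tau / p), and sends
   the summand of b to that of -1/b modulo p. *)
Lemma hecke_modular p w f : prime p -> ~~ odd w -> (0 < w)%N -> bd 1 f -> modular w (evq (R := R) f) ->
  modular w (evq (R := R) (hecke p w f)).
Proof.
move=> pp ow w0 hf hm; have [_ hS] := hm; have p0 := prime_gt0 pp.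
split=> [tau n ht|tau ht]; first by rewrite /evq ee_shift.
have pR : p%:R != 0 :> C by rewrite pnatr_eq0; lia.
have t0 := upper_neq0 ht.
have H1 := hecke_eval w p0 hf (upper_S ht); have H2 := hecke_eval w p0 hf ht.
have [A eA] : exists A : nat -> C, forall b, evq f ((- tau^-1 + b%:R) / p%:R) = A b by eexists.
have [B eB] : exists B : nat -> C, forall b, evq f ((tau + b%:R) / p%:R) = B b by eexists.
rewrite (eq_bigr (fun b : 'I_p => A b)) in H1; last by move=> b _; exact: eA.
rewrite (eq_bigr (fun b : 'I_p => B b)) in H2; last by move=> b _; exact: eB.
have dF (Y : nat -> C) : \sum_(b < p) Y b = Y 0%N + \sum_(b : 'F_p | b != 0) Y b.
  by rewrite (sum_Fp Y pp) (bigD1 (0 : 'F_p)).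
rewrite dF in H1; rewrite dF in H2.
have main : \sum_(b : 'F_p | b != 0) A b = tau ^+ w * \sum_(b : 'F_p | b != 0) B b.
  rewrite mulr_sumr [RHS](reindex_inj (h := fun b : 'F_p => - b^-1)) /=; last first.
    by move=> x y /oppr_inj/invr_inj.
  apply: eq_big => [b|b b0]; first by rewrite oppr_eq0 invr_eq0.
  have [k hk] := Fp_neg_inv pp b0; rewrite -eA -eB.
  move: hk; set b' : nat := (- b^-1 : 'F_p); set bn : nat := b => hk.
  have hu : upper ((tau + b'%:R) / p%:R).
    apply: upper_natV => //; exact: (upper_shift b'%:Z ht).
  (* This matrix sends (tau + b')/p to (-1/tau + b)/p, and its automorphy factor there is tau. *)
  have det : bn%:Z * (- b'%:Z) - (- k%:Z) * p%:Z = 1.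
    by move: hk; clear; lia.
  have hk' : bn%:R * b'%:R + 1 = p%:R * k%:R :> C by rewrite -!natrM natr1 -addn1 hk.
  have := modular_SL2 ow hm det hu.
  have -> : p%:Z%:~R * ((tau + b'%:R) / p%:R) + (- b'%:Z)%:~R = tau :> C.
    by rewrite mulrNz -[p%:Z%:~R]/(p%:R) -[b'%:Z%:~R]/(b'%:R) mulrCA mulfV // mulr1 addrK.
  move=> <-; congr (evq f _); rewrite /mob.
  have -> : p%:Z%:~R * ((tau + b'%:R) / p%:R) + (- b'%:Z)%:~R = tau :> C.
    by rewrite mulrNz -[p%:Z%:~R]/(p%:R) -[b'%:Z%:~R]/(b'%:R) mulrCA mulfV // mulr1 addrK.
  rewrite mulrNz -[bn%:Z%:~R]/(bn%:R) -[k%:Z%:~R]/(k%:R).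
  have -> : bn%:R * ((tau + b'%:R) / p%:R) - k%:R = (bn%:R * tau - 1) / p%:R.
    apply: (mulIf pR); rewrite mulrBl !divfK // -mulrA divfK // mulrDr [k%:R * _]mulrC -hk'; ring.
  by field; rewrite pR t0.
rewrite main -eA -eB !addr0 in H1 H2.
etransitivity; first exact: H1.
rewrite H2.
have e1 : evq f (p%:R * - tau^-1) = (tau / p%:R) ^+ w * evq f (tau / p%:R).
  have h := hS _ (upper_natV p0 ht); etransitivity; last exact: h.
  by congr (evq f _); field; rewrite pR t0.
have e2 : evq f (- tau^-1 / p%:R) = (p%:R * tau) ^+ w * evq f (p%:R * tau).
  have h := hS _ (upper_natM p0 ht); etransitivity; last exact: h.
  by congr (evq f _); field; rewrite pR t0.
rewrite e1 e2 natrX; case: w w0 {H1 H2 main e1 e2 ow hm hS} => // w' _.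
exact: hecke_alg.
Qed.
End Hecke.

(** * Sturm's bound and Hecke stability *)

Section Cauchy.
Variable R : realType.
Notation C := (R[i]).
Local Notation "x %:c" := (x%:C%C : C) (at level 2, format "x %:c").
Implicit Types (f g : fps) (z tau : C).

Lemma nrm_natV (N : nat) : nrm (N%:R^-1 : C) = N%:R^-1.
Proof. by rewrite nrmV nrm_nat. Qed.

Lemma sum_exp_tail (a : nat -> C) (K r : R) (s : C) (N : nat) : 0 <= r < 1 -> (forall n, nrm (a n) <= K * r ^+ n) ->
  hasum a s -> nrm (\sum_(i < N) a i - s) <= K * r ^+ N / (1 - r).
Proof.
move=> hr h hs.
have hs' : hasum (fun n => a (N + n)%N) (s - \sum_(i < N) a i).
  move=> e e0; have [M hM] := hs _ e0; exists M => n Mn.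
  have := hM (N + n)%N (leq_trans Mn (leq_addl _ _)).
  rewrite big_split_ord /=; set A := \sum_(i < N) _; set B := \sum_(i < n) _.
  by have -> : A + B - s = B - (s - A) by ring.
rewrite nrm_sub; apply: (hasum_le hs') => n.
apply: (@geo_bound _ (fun n => a (N + n)%N) r (K * r ^+ N) n hr) => i.
by apply: le_trans (h _) _; rewrite exprD mulrA.
Qed.

(* Averaging over the N-th roots of unity extracts a coefficient up to a tail. *)
Lemma cauchy_bound B f z (G : R) : bd B f -> B%:R * nrm z < 1 ->
  (forall r : R, nrm (ev f (z * ee r%:c)) <= G) -> forall n, nrm (cterm f z n) <= G.
Proof.
move=> hf hz hG n; have [K K0 [r hr hb]] := cterm_geo hf hz.
apply/ler_addgt0Pr => e e0.
have /andP[r0 r1] := hr; have d1 : 0 <= (1 - r)^-1 by rewrite invr_ge0 subr_ge0 ltW.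
have [N1 hN1] : exists N, forall n, (N <= n)%N -> K * r ^+ n / (1 - r) <= e.
  apply: hasum_small e0; exists (K / (1 - r)); first by rewrite mulr_ge0.
  by exists r => // i; rewrite mulrAC.
pose N := (N1 + n.+1)%N; have nN : (n < N)%N by rewrite /N; lia.
have NN : (N1 <= N)%N by rewrite /N leq_addr.
have N0 : (0 < N)%N by rewrite /N; lia.
have NR : N%:R != 0 :> C by rewrite pnatr_eq0; lia.
pose w (k : nat) : C := ee (rt R N k%:Z)%:c.
have wk k j : w k ^+ j = ee (k%:R * (rt R N j%:Z)%:c).
  rewrite /w -eeX; congr ee; rewrite /rt !rmorphM !fmorphV !rmorph_nat; ring.
have nz k : nrm (z * w k) = nrm z by rewrite nrmM nrm_ee_real mulr1.
pose P k := \sum_(j < N) cterm f (z * w k) j.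
have hP k : nrm (P k) <= G + e.
  have hb' j : nrm (cterm f (z * w k) j) <= K * r ^+ j.
    by have := hb j; rewrite /cterm !nrmM !nrmX nz.
  have t := sum_exp_tail N hr hb' (ev_has hf (ltac:(by rewrite nz) : B%:R * nrm (z * w k) < 1)).
  have -> : P k = ev f (z * w k) + (P k - ev f (z * w k)) by ring.
  by apply: le_trans (nrmD _ _) _; apply: lerD; [exact: hG | exact: le_trans t (hN1 _ NN)].
have key : cterm f z n = N%:R^-1 * \sum_(k < N) P k * ee (- (k%:R * (rt R N n%:Z)%:c)).
  have -> : \sum_(k < N) P k * ee (- (k%:R * (rt R N n%:Z)%:c)) =
     \sum_(j < N) cterm f z j * \sum_(k < N) ee (k%:R * (rt R N (j%:Z - n%:Z))%:c).
    under eq_bigr do rewrite /P mulr_suml.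
    rewrite exchange_big /=; apply: eq_bigr => j _; rewrite mulr_sumr; apply: eq_bigr => k _.
    rewrite /cterm exprMn wk -!mulrA -eeD; congr (_ * (_ * ee _)).
    by rewrite /rt intrB mulrBl rmorphB; ring.
  rewrite (bigD1 (Ordinal nN)) //= [X in _ + X]big1 ?addr0 => [|j jn]; last first.
    by rewrite ee_geosum ?mulr0 //; [have := ltn_ord j; lia | apply: contra jn => h; apply/eqP/val_inj => /=; lia].
  rewrite (eq_bigr (fun=> 1)) => [|k _]; last by rewrite subrr /rt mul0r rmorph0 mulr0 ee0.
  by rewrite sumr_const card_ord mulrCA mulVf ?mulr1.
rewrite key nrmM nrm_natV mulrC ler_pdivrMr ?ltr0n //.
apply: le_trans (nrm_sum _ _ _) _.
apply: (@le_trans _ _ (\sum_(k < N) (G + e))).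
  apply: ler_sum => k _; rewrite nrmM.
  have -> : - (k%:R * (rt R N n%:Z)%:c) = (- (k%:R * rt R N n%:Z))%:c by rewrite [RHS]rmorphN [X in _ = - X]rmorphM rmorph_nat.
  by rewrite nrm_ee_real mulr1.
by rewrite sumr_const card_ord mulr_natr.
Qed.

Lemma ev_bound0 f z (G x : R) : 0 <= x < 1 -> f 0%N = 0 -> (forall n, nrm (cterm f z n) <= G * x ^+ n) ->
  nrm (ev f z) <= G * (x / (1 - x)).
Proof.
move=> hx f0 h; have [s hs] := hasum_geo hx h; rewrite (evE hs).
have /andP[x0 x1] := hx.
have G0 : 0 <= G by have := le_trans (nrm_ge0 _) (h 0%N); rewrite expr0 mulr1.
apply: (hasum_le hs) => -[|n].
  by rewrite big_ord0 nrm0 mulr_ge0 // divr_ge0 // subr_ge0 ltW.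
rewrite big_ord_recl {1}/cterm f0 mul0r add0r mulrA.
apply: (@geo_bound _ (fun n => cterm f z n.+1) x (G * x) n hx) => i.
by apply: le_trans (h _) _; rewrite exprS mulrA.
Qed.
End Cauchy.

Lemma psi0 : psi 0%N = 1.
Proof. by rewrite (@psi_tri 0 0). Qed.
Lemma psi_le n : (`|psi n| <= 2)%N.
Proof.
have [[k e]|h] := pselect (exists k, (k * k.+1 = 2 * n)%N); first by rewrite (psi_tri e).
by rewrite psi_ntri // => k e; apply: h; exists k.
Qed.
Lemma phi_le n : (`|phi n| <= 2)%N.
Proof.
have [[k e]|h] := pselect (exists k, (k ^ 2 = n)%N).
  have [k0|k0] := posnP k; first by rewrite -e k0 (_ : (0 ^ 2 = 0)%N) // phi0.
  by rewrite -e phi_sq.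
by rewrite phi_nsq // => k e; apply: h; exists k.
Qed.

(* The cofactor of q in serD is inverted by a series converging for |q| < 1/3. *)
Lemma serD_inv : exists I : fps, bd 3 I /\ serD * I = X.
Proof.
have [V hV] := V_exists; have [W hW] := fps_inv psi0.
have bV : bd 3 V.
  apply: (bd_inv hV); first by rewrite cf_fsgn mul1r phi0.
  by move=> i; rewrite cf_fsgn abszM abszX /= exp1n mul1n phi_le.
have bW : bd 3 W by apply: (bd_inv hW psi0 psi_le).
exists (W ^+ 8 * V ^+ 16); split; first by apply: bdM; apply: bdX.
rewrite /serD /serW /serP -exprM.
have -> : X * psi ^+ 8 * fsgn phi ^+ (2 * 8) * (W ^+ 8 * V ^+ 16) = X * (W * psi) ^+ 8 * (V * fsgn phi) ^+ 16.
  by rewrite !exprMn; move: (psi ^+ 8) (W ^+ 8) (V ^+ 16) (fsgn phi ^+ 16) => a b c d; ring.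
by rewrite hW hV !expr1n !mulr1.
Qed.

Lemma bd_shift m f : bd 1 f -> bd 1 (Fps (fun n => f (n + m)%N)).
Proof.
move=> [K [d h]]; exists (K * m.+1 ^ d)%N, d => n /=.
apply: leq_trans (h _) _; rewrite !exp1n !muln1 -mulnA -expnMn leq_mul2l leq_exp2r_w ?orbT //.
by nia.
Qed.

Section Sturm.
Variable R : realType.
Notation C := (R[i]).
Local Notation "x %:c" := (x%:C%C : C) (at level 2, format "x %:c").
Implicit Types (f g : fps) (z tau : C).

(** After a translation to |Re| <= 1/2, a point with Im below 3/5 has |tau|^2 <= 61/100, so
    inversion multiplies Im by at least 8/5; hence finitely many steps suffice. *)
Lemma reduce_upper (h : C -> C) : (forall tau (n : int), upper tau -> h (tau + n%:~R) = h tau) ->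
  (forall tau, upper tau -> h (- tau^-1) = h tau) ->
  forall tau, upper tau -> exists tau', 3 / 5 <= complex.Im tau' /\ h tau' = h tau.
Proof.
move=> hT hS tau ht; have [n] : exists n : nat, 3 / 5 <= complex.Im tau * (8 / 5) ^+ n.
  pose n := (Num.truncn (complex.Im tau)^-1).+1; exists n.
  have b : (n%:R * (3 / 5) : R) <= (8 / 5) ^+ n.
    elim: n => [|k IH]; first by rewrite mul0r expr0.
    rewrite exprS -natr1; have : 0 <= k%:R :> R by [].
    have : 1 <= (8 / 5) ^+ k :> R by rewrite exprn_ege1 //; lra.
    by move: IH; set y := k%:R; set e := _ ^+ k; clear; lra.
  have t : (complex.Im tau)^-1 < n%:R := truncnS_gt _.
  have ht' : 0 < complex.Im tau := ht.
  have t2 : 1 <= complex.Im tau * n%:R by rewrite mulrC -ler_pdivrMr // div1r ltW.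
  apply: le_trans (ler_wpM2l (ltW ht') b); rewrite mulrA; lra.
elim: n tau ht => [|n IH] tau ht hn.
  by exists tau; split=> //; rewrite expr0 mulr1 in hn.
have [big|small] := leP (3 / 5) (complex.Im tau); first by exists tau.
pose k : int := - Num.floor (complex.Re tau + 1 / 2); pose t1 := tau + k%:~R.
have ht1 : upper t1 by exact: upper_shift.
have i1 : complex.Im t1 = complex.Im tau by rewrite /t1 ImD -intC /= addr0.
have r1 : `|complex.Re t1| <= 1 / 2.
  rewrite /t1 ReD -intC /= /k mulrNz ler_norml.
  by have /andP[] := floor_itv (complex.Re tau + 1 / 2); rewrite intrD; lra.
have n2 : nrm t1 ^+ 2 <= 61 / 100.
  rewrite nrm_sqr i1 -(real_normK (num_real (complex.Re t1))).
  have e1 : `|complex.Re t1| ^+ 2 <= (1 / 2) ^+ 2 by rewrite ler_pXn2r ?nnegrE.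
  have e2 : complex.Im tau ^+ 2 <= (3 / 5) ^+ 2 by rewrite ler_pXn2r ?nnegrE ?(ltW ht) ?(ltW small).
  lra.
have np : 0 < nrm t1 ^+ 2 by rewrite exprn_gt0 // nrm_gt0 // upper_neq0.
have hn' : 3 / 5 <= complex.Im (- t1^-1) * (8 / 5) ^+ n.
  have p8 : 0 <= (8 / 5 : R) ^+ n by apply: exprn_ge0; lra.
  apply: le_trans hn _; rewrite exprS mulrA ler_wpM2r //.
  rewrite Im_inv i1 ler_pdivlMr // -mulrA ler_piMr ?(ltW ht) //; lra.
have [tau' [h1 h2]] := IH _ (upper_S ht1) hn'.
by exists tau'; split=> //; rewrite h2 hS // hT.
Qed.

Lemma ee_small tau : 3 / 5 <= complex.Im tau -> nrm (ee tau) <= 2 / 15.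
Proof.
move=> h; rewrite nrm_ee expRN.
have e1 : 7 / 5 <= expR (2 / 5) :> R by have := expR_ge1Dx (2 / 5 : R); lra.
have e2 : 15 / 2 <= expR (2 * pi * complex.Im tau).
  (* From pi >= 2 the exponent is at least 12/5 = 6 (2/5), and (7/5)^6 exceeds 15/2. *)
  apply: (@le_trans _ _ (expR (6%:R * (2 / 5)))).
    rewrite expRM_natl; apply: (@le_trans _ _ ((7 / 5) ^+ 6)); first lra.
    by rewrite ler_pXn2r ?nnegrE ?expR_ge0 //; lra.
  rewrite ler_expR; have := ler_wpM2r (ltac:(lra) : 0 <= 2 * (3 / 5) :> R) (pi_ge2 R).
  have : 0 <= 2 * pi * (complex.Im tau - 3 / 5) by rewrite !mulr_ge0 ?pi_ge0 // subr_ge0.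
  lra.
rewrite -[leRHS]invrK lef_pV2 ?posrE ?expR_gt0 //; lra.
Qed.

(** The radius 3/10 lies below 1/3, where the inverse of Delta/q converges, and is large enough
    against 2/15 to make the contraction factor less than 1. *)
Lemma ee_circle : exists2 tau0 : C, upper tau0 & nrm (ee tau0) = 3 / 10.
Proof.
exists (Complex 0 (- ln (3 / 10) / (2 * pi))).
  rewrite /upper /= divr_gt0 ?mulr_gt0 ?pi_gt0 // oppr_gt0 ln_lt0 //; lra.
rewrite nrm_ee /= (_ : - (2 * pi * (- ln (3 / 10) / (2 * pi))) = ln (3 / 10)).
  by rewrite lnK // posrE; lra.
by rewrite mulNr mulrN opprK mulrCA mulfV ?mulr1 // gt_eqF // mulr_gt0 ?pi_gt0.
Qed.

Section Fixed.
Variables (m : nat) (f : fps).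
Hypothesis hf : bd 1 f.
Hypothesis hm : modular (12 * m) (evq (R := R) f).
Hypothesis f0 : forall n, (n <= m)%N -> f n = 0.

Let h tau : C := evq f tau / evq serD tau ^+ m.

Lemma quot_T tau (n : int) : upper tau -> h (tau + n%:~R) = h tau.
Proof. by move=> ht; rewrite /h /evq ee_shift. Qed.
Lemma quot_S tau : upper tau -> h (- tau^-1) = h tau.
Proof.
move=> ht; have [_ hS] := hm; rewrite /h (hS tau ht) /evq (D_S ht) exprMn -exprM.
have t0 : tau ^+ (12 * m) != 0 by rewrite expf_neq0 // upper_neq0.
by rewrite invfM mulrACA mulfV // mul1r.
Qed.

(* On Im tau >= 3/5, |q| <= 2/15, while all values of the invariant quotient h on
   |q| = 3/10 are attained there: a bound G for h implies the bound 4/5 G. *)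
Lemma sturm_fixed : f = 0.
Proof.
have [I [bI hI]] := serD_inv.
pose f1 := Fps (fun n => f (n + m)%N).
have bf1 : bd 1 f1 by exact: bd_shift.
have ef : f = X ^+ m * f1.
  apply: fpsP => n; rewrite cfXM; case: ltnP => nm; first by rewrite f0 // ltnW.
  by rewrite -[LHS](congr1 f (subnK nm)).
(* The series of f/Delta^m. It converges only near q = 0, whereas h is defined and invariant on the
   whole half-plane; its constant term vanishes because f vanishes to order m + 1. *)
pose H := f1 * I ^+ m.
have bH : bd 3 H by apply: bdM; [exact: bd_mono bf1 | exact: bdX].
have fH : f = serD ^+ m * H by rewrite ef -hI /H exprMn mulrCA mulrC mulrA.
have H0 : H 0%N = 0 by rewrite /H cfM big_ord1 /f1 [cf _ 0%N]/= add0n f0 ?mul0r.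
have b3 z : nrm z <= 3 / 10 -> 3%:R * nrm z < 1 by move=> hz; lra.
have bD3 := bd_mono (isT : (1 <= 3)%N) bd_D.
have hH tau : nrm (ee tau) <= 3 / 10 -> h tau = ev H (ee tau).
  move=> hz; have hz3 := b3 _ hz; set z := ee tau in hz hz3 *.
  have D0 : ev serD z != 0.
    apply/eqP => e; have := evM bD3 bI hz3; rewrite hI evX e mul0r => /eqP.
    by rewrite (negPf (ee_neq0 _)).
  have eX : ev (serD ^+ m) z = ev serD z ^+ m.
    elim: (m) => [|k IH]; first by rewrite !expr0 ev1.
    by rewrite !exprS (evM bD3 (bdX k bD3) hz3) IH.
  rewrite /h /evq -/z {1}fH (evM (bdX m bD3) bH hz3) eX mulrC mulKf //.
  by rewrite expf_neq0.
have [tau0 u0 n0] := ee_circle.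
have upper_ge tau : 3 / 5 <= complex.Im tau -> upper tau by rewrite /upper; apply: lt_le_trans; lra.
pose P (G : R) := forall tau, 3 / 5 <= complex.Im tau -> nrm (ev H (ee tau)) <= G.
have PC G : P G -> forall n, nrm (cterm H (ee tau0) n) <= G.
  move=> hP; apply: (cauchy_bound bH); first by apply: b3; rewrite n0.
  move=> r; have e : ee tau0 * ee r%:c = ee (tau0 + r%:c) by rewrite eeD.
  have ut : upper (tau0 + r%:c) by rewrite /upper ImD /= addr0.
  (* A point of the circle has small imaginary part, but h takes the same value at an equivalent
     point with Im >= 3/5. *)
  have [tau' [h1 h2]] := reduce_upper quot_T quot_S ut.
  rewrite e -hH; last by rewrite eeD nrmM nrm_ee_real mulr1 n0.
  rewrite -h2 hH; first exact: hP.
  by apply: le_trans (ee_small h1) _; lra.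
have PS G : P G -> P (4 / 5 * G).
  move=> hP tau ht; have hz := ee_small ht.
  (* 4/9 is the ratio of 2/15 to 3/10; without constant term the geometric sum is x/(1 - x) =
     4/5. *)
  have x1 : 0 <= (4 / 9 : R) < 1 by lra.
  have -> : 4 / 5 * G = G * (4 / 9 / (1 - 4 / 9)) by field.
  apply: (ev_bound0 x1 H0).
  move=> n; have hc := PC G hP n; have g0 : 0 <= G := le_trans (nrm_ge0 _) hc.
  have -> : nrm (cterm H (ee tau) n) = nrm (cterm H (ee tau0) n) * (nrm (ee tau) / (3 / 10)) ^+ n.
    by rewrite /cterm !nrmM !nrmX n0 -mulrA -exprMn [3 / 10 * _]mulrCA mulfV ?mulr1.
  apply: ler_pM => //; first exact: nrm_ge0.
    by rewrite exprn_ge0 // divr_ge0 ?nrm_ge0.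
  apply: lerXn2r; rewrite ?nnegrE ?divr_ge0 ?nrm_ge0 //; lra.
have [G0 hG0] : exists G0, P G0.
  have n03 : 3%:R * nrm (ee tau0) < 1 by apply: b3; rewrite n0.
  have [K K0 [r hr hb]] := cterm_geo bH n03.
  exists (K / (1 - r)) => tau ht; have hz := ee_small ht.
  have hz3 : 3%:R * nrm (ee tau) < 1 by apply: b3; lra.
  have hs := ev_has bH hz3; apply: (hasum_le hs) => n; apply: (@geo_bound _ _ r K n hr) => i.
  apply: le_trans (hb i); rewrite /cterm !nrmM !nrmX ler_wpM2l ?nrm_ge0 // n0.
  by apply: lerXn2r; rewrite ?nnegrE ?nrm_ge0 //; lra.
have Pk k : P ((4 / 5) ^+ k * G0).
  by elim: k => [|k IH]; [rewrite expr0 mul1r | rewrite exprS -mulrA; apply: PS].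
have Hz n : H n = 0.
  have : cterm H (ee tau0) n = 0.
    apply: nrm_eps => e e0.
    have [N hN] : exists N, forall k, (N <= k)%N -> (4 / 5) ^+ k * G0 <= e.
      apply: hasum_small e0; exists `|G0|; first exact: normr_ge0.
      exists (4 / 5); first lra.
      by move=> k; rewrite mulrC; apply: ler_wpM2r (ler_norm _); apply: exprn_ge0; lra.
    exact: le_trans (PC _ (Pk N) n) (hN N (leqnn N)).
  rewrite /cterm => /eqP; rewrite mulf_eq0 expf_eq0 (negPf (ee_neq0 _)) andbF orbF intr_eq0.
  by move/eqP.
have -> : f = serD ^+ m * 0 by rewrite {1}fH; congr (_ * _); apply: fpsP => n; rewrite Hz cf0.
by rewrite mulr0.
Qed.
End Fixed.
End Sturm.

Lemma cfM0 (f g : fps) : (f * g) 0%N = f 0%N * g 0%N.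
Proof. by rewrite cfM big_ord1. Qed.
Lemma cfX0 (f : fps) k : f 0%N = 1 -> (f ^+ k) 0%N = 1.
Proof. by move=> h; elim: k => [|k IH]; rewrite ?expr0 // exprS cfM0 h IH. Qed.

Definition serDu : fps := psi ^+ 8 * serP ^+ 8.
Lemma serP0 : serP 0%N = 1.
Proof. by apply: cfX0; rewrite cf_fsgn mul1r phi0. Qed.
Lemma serDu0 : serDu 0%N = 1.
Proof. by rewrite cfM0 (cfX0 8 psi0) (cfX0 8 serP0). Qed.
Lemma serE0 : serE 0%N = 1.
Proof. by rewrite serE_W cfD cfMz_nat cfM0 cfX mul0r mulr0 add0r (cfX0 4 serP0). Qed.
Lemma expr_mulCA (a x u : fps) j : a * (x * u) ^+ j = x ^+ j * (a * u ^+ j).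
Proof. by rewrite exprMn mulrCA. Qed.
Lemma basis_X m j : basis m j = X ^+ j * (serE ^+ (3 * (m - j)) * serDu ^+ j).
Proof.
have e : serD = X * serDu by exact: esym (mulrA X (psi ^+ 8) (serP ^+ 8)).
by rewrite /basis e; exact: expr_mulCA.
Qed.
Lemma basis_lt m j n : (n < j)%N -> basis m j n = 0.
Proof. by rewrite basis_X cfXM => ->. Qed.
Lemma basis_diag m j : basis m j j = 1.
Proof. by rewrite basis_X cfXM ltnn subnn cfM0 (cfX0 _ serE0) (cfX0 _ serDu0). Qed.

(** [basis m j] starts with q^j and coefficient 1, so the system is unitriangular and its solution
    integral. *)
Lemma basis_interp m (g : fps) : exists c : nat -> int,
  forall n, (n <= m)%N -> (g - \sum_(j < m.+1) (c j)%:~R * basis m j) n = 0.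
Proof.
suff : forall k, exists c : nat -> int, forall n, (n < k)%N -> (g - \sum_(j < k) (c j)%:~R * basis m j) n = 0.
  by move=> /(_ m.+1).
elim=> [|k [c IH]]; first by exists (fun=> 0).
have [S eS] : exists S, S = \sum_(j < k) (c j)%:~R * basis m j by eexists.
rewrite -eS in IH; exists (fun j => if j == k then (g - S) k else c j) => n.
rewrite ltnS => nk.
have -> : \sum_(j < k.+1) (if j == k :> nat then (g - S) k else c j)%:~R * basis m j = S + ((g - S) k)%:~R * basis m k.
  rewrite big_ord_recr [nat_of_ord ord_max]/= eqxx eS; congr (_ + _).
  by apply: eq_bigr => j _; rewrite [nat_of_ord _]/= ltn_eqF ?ltn_ord.
rewrite cfB [cf (S + _) n]cfD cfMz.
move: nk; rewrite leq_eqVlt => /orP[/eqP->|nk]; first by rewrite basis_diag mulr1 cfB; ring.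
by rewrite basis_lt // mulr0 addr0 -cfB IH.
Qed.

Lemma bd_basis m j : bd 1 (basis m j).
Proof. exact: bdM (bdX _ bd_E) (bdX _ bd_D). Qed.
Lemma bd_hecke p w f : (0 < p)%N -> bd 1 f -> bd 1 (hecke p w f).
Proof.
move=> p0 hf; have -> : hecke p w f = Fps (fun n => f (p * n)%N) + (p ^ w.-1)%:R * fdil p f.
  by apply: fpsP => n; rewrite cfD cfMz_nat /hecke natz.
exact: bdD (bd_U p hf) (bdM (bd_nat _ _) (bd_fdil p0 hf)).
Qed.
Lemma bd_comb m (c : nat -> int) k : bd 1 (\sum_(j < k) (c j)%:~R * basis m j).
Proof.
elim: k => [|k IH]; first by rewrite big_ord0; exists 0%N, 0%N => n.
by rewrite big_ord_recr; apply: bdD IH (bd_opZ _ (bd_basis m k)).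
Qed.

Section Stable.
Variable R : realType.
Notation C := (R[i]).
Implicit Types (f g : fps) (tau : C).

Lemma modularP w f : (forall tau : C, upper tau -> evq f (- tau^-1) = tau ^+ w * evq f tau) -> modular w (evq (R := R) f).
Proof. by move=> h; split; [move=> tau n ht; rewrite /evq ee_shift | exact: h]. Qed.

Lemma modularD w f g : bd 1 f -> bd 1 g -> modular w (evq (R := R) f) -> modular w (evq (R := R) g) ->
  modular w (evq (R := R) (f + g)).
Proof.
move=> hf hg [_ h1] [_ h2]; apply: modularP => tau ht.
have l1 := lt1 (nrm_ee_lt1 ht); have l2 := lt1 (nrm_ee_lt1 (upper_S ht)).
have e1 := evD hf hg l1; have e2 := evD hf hg l2.
by rewrite /evq e1 e2 mulrDr; congr (_ + _); [exact: h1 | exact: h2].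
Qed.
Lemma modularZ w f (c : int) : bd 1 f -> modular w (evq (R := R) f) -> modular w (evq (R := R) (c%:~R * f)).
Proof.
move=> hf [_ h1]; apply: modularP => tau ht.
have l1 := lt1 (nrm_ee_lt1 ht); have l2 := lt1 (nrm_ee_lt1 (upper_S ht)).
have e1 := evZ c hf l1; have e2 := evZ c hf l2.
by rewrite /evq e1 e2 mulrCA; congr (_ * _); exact: h1.
Qed.

Lemma modular_basis m j : (j <= m)%N -> modular (12 * m) (evq (R := R) (basis m j)).
Proof.
move=> jm; apply: modularP => tau ht; rewrite /evq /basis.
have l1 := nrm_ee_lt1 ht; have l2 := nrm_ee_lt1 (upper_S ht).
rewrite (evM (bdX _ bd_E) (bdX _ bd_D) (lt1 l1)) (evM (bdX _ bd_E) (bdX _ bd_D) (lt1 l2)).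
rewrite (ev_X _ bd_E l1) (ev_X _ bd_D l1) (ev_X _ bd_E l2) (ev_X _ bd_D l2).
rewrite (E_S ht) (D_S ht); move: (ev serE _) (ev serD _) => a b.
rewrite [(tau ^+ 4 * a) ^+ _]exprMn [(tau ^+ 12 * b) ^+ _]exprMn mulrACA; congr (_ * _).
by rewrite -!exprM -exprD; congr (_ ^+ _); lia.
Qed.

Lemma modular_comb m (c : nat -> int) : modular (12 * m) (evq (R := R) (\sum_(j < m.+1) (c j)%:~R * basis m j)).
Proof.
suff : forall k, (k <= m.+1)%N -> modular (12 * m) (evq (R := R) (\sum_(j < k) (c j)%:~R * basis m j)).
  by apply.
elim=> [|k IH] km.
  rewrite big_ord0; apply: modularP => tau ht.
  have z (x : C) : ev 0 x = 0.
    apply: evE => e e0; exists 0%N => n _; rewrite big1 ?subrr ?nrm0 ?(ltW e0) // => i _.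
    by rewrite /cterm mul0r.
  by rewrite /evq !z mulr0.
rewrite big_ord_recr; apply: (modularD (bd_comb m c k) (bd_opZ (c k) (bd_basis m k))).
  by apply: IH; lia.
by apply: modularZ; [exact: bd_basis | exact: modular_basis].
Qed.
End Stable.

(** Match the coefficients up to q^m by an integral combination; the difference is modular of weight
    12m and vanishes to order m + 1, so [sturm_fixed] applies. *)
Theorem hecke_stableP (R : realType) : hecke_stable.
Proof.
move=> p m i pp op im; have p0 := prime_gt0 pp.
have bh := bd_hecke (12 * m) p0 (bd_basis m i).
(* In weight 0 the truncated exponent w - 1 is 0, so that T_p 1 = 2; the modular argument needs w >
   0. *)
have [m0|mp] := posnP m.
  exists (fun=> 2); move: im; rewrite m0 leqn0 => /eqP->; rewrite big_ord1.
  have -> : basis 0 0 = 1 by rewrite /basis !expr0 mulr1.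
  apply: fpsP => n; rewrite cf_hecke muln0 expn0 fdil1 // cfMz !cf1 muln_eq0 (gtn_eqF p0) /=.
  by case: (n == 0%N).
have [c hc] := basis_interp m (hecke p (12 * m) (basis m i)); exists c.
have hm : modular (12 * m) (evq (R := R) (hecke p (12 * m) (basis m i))).
  have ow : ~~ odd (12 * m) by rewrite oddM.
  have w0 : (0 < 12 * m)%N by lia.
  exact: hecke_modular pp ow w0 (bd_basis m i) (modular_basis R im).
apply/eqP; rewrite -subr_eq0; apply/eqP.
have bn := bdN (bd_comb m c m.+1).
apply: (@sturm_fixed R m) hc; first exact: bdD bh bn.
apply: (modularD bh bn hm).
have := modularZ (-1) (bd_comb m c m.+1) (modular_comb R m c).
by rewrite mulrN1z mulN1r.
Qed.

(** * Density *)

Lemma goodn_gt_good r n : goodn_gt 0 r n -> good r n.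
Proof. by move=> [s [h1 h2 h3 h4 _]]; exists s. Qed.

Lemma abar_lacunary (R : realType) (c k : nat) : (2 <= c)%N -> ~~ odd c ->
  exists r, forall n, good r n -> ((2 ^ k)%:Z %| abar c n)%Z.
Proof.
move=> c2 oc; have [V hV] := V_exists.
have [r hr] := Lac_target (hecke_stableP R) hV oc (ltnW c2) k.
by exists r => n hn; rewrite (abarE _ hV c2) hr.
Qed.

Lemma density_bound (R : realType) (c k : nat) (e : R) : (2 <= c)%N -> ~~ odd c -> 0 < e ->
  exists A : R, forall X, X%:R * (1 - e) - A <= (count_div c k X)%:R.
Proof.
move=> c2 oc e0; have [r hr] := abar_lacunary R k c2 oc.
(* The constant accounts for the X + 1 integers from 0 to X. *)
have [B hB] := density_good r 0 e0; exists (e + B - 1) => X.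
have h : (X.+1 <= count_div c k X + count (fun n => ~~ `[< goodn_gt 0 r n >]) (iota 0 X.+1))%N.
  rewrite /count_div -[in leqLHS](size_iota 0 X.+1) -(count_predC (fun n => `[< goodn_gt 0 r n >])).
  rewrite leq_add2r; apply: sub_count => n /= /asboolP hn; exact: hr (goodn_gt_good hn).
have hX := hB X.+1.
have : X.+1%:R <= (count_div c k X)%:R + (count (fun n => ~~ `[< goodn_gt 0 r n >]) (iota 0 X.+1))%:R :> R.
  by rewrite -natrD ler_nat.
move: hX; rewrite -natr1; move: (count _ _)%:R (count_div _ _ _)%:R (X%:R) => x y z; lra.
Qed.

Lemma count_div_le c k X : (count_div c k X <= X.+1)%N.
Proof. by rewrite /count_div -[leqRHS](size_iota 0) count_size. Qed.

Local Open Scope classical_set_scope.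

Theorem theorem1p10 (R : realType) (k alpha m : nat)
  (hk : (1 <= k)%N) (halpha : (1 <= alpha)%N) (hm : (1 <= m)%N)
  (hodd : gcdn m 2 = 1%N) :
  (fun X : nat => (count_div (2 ^ alpha * m) k X)%:R / X%:R : R) @ \oo --> (1 : R).
Proof.
have oc : ~~ odd (2 ^ alpha * m) by rewrite oddM oddX (gtn_eqF halpha).
have c2 : (2 <= 2 ^ alpha * m)%N.
  by apply: (@leq_trans (2 ^ alpha)); [rewrite -{1}(expn1 2) leq_exp2l | rewrite leq_pmulr].
apply/cvgrPdist_le => e e0.
have e2 : 0 < e / 2 by rewrite divr_gt0.
have [A hA] := density_bound k c2 oc e2.
(* This absorbs the constant A in the lower bound and the excess 1 in the upper bound, where X + 1
   integers are divided by X. *)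
have [N hN] : exists N : nat, `|A| + 1 <= (e / 2) * N%:R.
  exists (Num.truncn ((`|A| + 1) / (e / 2))).+1.
  rewrite mulrC -ler_pdivrMr //; exact: ltW (truncnS_gt _).
exists N.+1 => // X /= NX.
have X0 : 0 < X%:R :> R by rewrite ltr0n (leq_trans _ NX).
have NX' : N%:R <= X%:R :> R by rewrite ler_nat ltnW.
have l := hA X; have u : (count_div (2 ^ alpha * m) k X)%:R <= X%:R + 1 :> R.
  by rewrite natr1 ler_nat count_div_le.
have a1 := ler_norm A; have a0 := normr_ge0 A.
have k2 : e / 2 * N%:R <= e / 2 * X%:R by rewrite ler_pM2l.
rewrite -[X in X - _](divff (lt0r_neq0 X0)) -mulrBl normrM normfV (gtr0_norm X0) ler_pdivrMr //.
move: l u hN k2; move: (count_div _ _ _)%:R => y l u hN k2.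
by rewrite ler_norml; apply/andP; split; lra.
Qed.
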